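(* For $\mathcal{D}\in L^2(\partial_+SM)$, the following two conditions are equivalent. (a) (Moment conditions for functions supported in the unit disk, in fan-beam coordinates.) $\mathcal{D}(\beta+\pi+2\alpha,-\alpha)=\mathcal{D}(\beta,\alpha)$ for a.e. $(\beta,\alpha)\in\partial_+SM$, and $$\int_{\partial_+ SM} \cos\alpha\ \sin^n\alpha\ e^{\pm ik (\beta+\alpha)}\, \mathcal{D}(\beta,\alpha)\ d\alpha\ d\beta = 0$$ for both choices of sign, for all integers $n \ge 0$ and all integers $k>n$ with $k-n$ even. (b) (Pestov--Uhlmann range characterization of $I_0$.) $\mathcal{D}$ belongs to the range of $P_-$, i.e. $\mathcal{D}=P_-h$ for some $h\in L^2(\partial_+SM)$.
   Context: $M$ is the Euclidean unit disk, $\mathbb{S}^1=\mathbb{R}/2\pi\mathbb{Z}$. The boundary $\partial SM$ of its unit circle bundle is parameterized by $(\beta,\alpha)\in\mathbb{S}^1\times\mathbb{S}^1$, representing the boundary point $e^{i\beta}$ and the direction of angle $\beta+\pi+\alpha$; the influx boundary $\partial_+SM$ is $\alpha\in(-\frac\pi2,\frac\pi2)$ and the outflux boundary $\partial_-SM$ is $\alpha\in(\frac\pi2,\frac{3\pi}2)$. $L^2$ spaces are with respect to $d\beta\,d\alpha$. The scattering relation is $\mathcal{S}:\partial SM\to\partial SM$, $\mathcal{S}(\beta,\alpha)=(\beta+\pi+2\alpha,\pi-\alpha)$, which exchanges $\partial_+SM$ and $\partial_-SM$. For $f$ on $\partial_+SM$, $A_\pm f$ is the function on $\partial SM$ equal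 to $f$ on $\partial_+SM$ and to $\pm f\circ\mathcal{S}$ on $\partial_-SM$. The adjoints $A_\pm^\star:L^2(\partial SM)\to L^2(\partial_+SM)$ are $A_\pm^\star f(\beta,\alpha)=f(\beta,\alpha)\pm f(\mathcal{S}(\beta,\alpha))$, $(\beta,\alpha)\in\partial_+SM$. $H$ is the fiberwise Hilbert transform on $L^2(\partial SM)$: for each fixed $\beta$, it multiplies the harmonic $e^{ik\alpha}$ by $-i\,\mathrm{sign}(k)$, with $\mathrm{sign}(0)=0$. $H_-$ is the composition of $H$ with the projection onto odd harmonics in $\alpha$. Then $P_-:=A_-^\star H_-A_+:L^2(\partial_+SM)\to L^2(\partial_+SM)$. *)

(* Defs.v *)
From HB Require Import structures.
From mathcomp Require Import all_boot all_order all_algebra.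
From mathcomp Require Import complex.
From mathcomp Require Import all_classical all_reals all_analysis.

Set Implicit Arguments.
Unset Strict Implicit.
Unset Printing Implicit Defensive.

Import Order.TTheory GRing.Theory Num.Theory.
Import numFieldNormedType.Exports.

Local Open Scope classical_set_scope.
Local Open Scope ring_scope.
Local Open Scope complex_scope.

Section fan_beam.
Context {R : realType}.
Implicit Types (f g h w : R * R -> R[i]) (D : set (R * R)).

(* The circle is R / 2 pi Z.  A function on the boundary S^1 x S^1 of the unit
   circle bundle is a function of (beta, alpha) in R x R that is 2 pi-periodic
   in each variable.  A function on the influx boundary, an open subset of
   S^1 x S^1, is represented in the same way; its values at points outside the
   influx boundary are irrelevant. *)
Definition torus_fun f : Prop :=
  forall b a : R, f (b + 2 * pi, a) = f (b, a) /\ f (b, a + 2 * pi) = f (b, a).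

Definition circle_cell : set R := `[0, 2 * pi[%classic.
Definition fiber_cell : set R := `[- (pi / 2), 3 * (pi / 2)[%classic.
Definition influx_fiber : set R := `]- (pi / 2), pi / 2[%classic.

(* Fundamental domains of S^1 x S^1 and of the influx boundary. *)
Definition bdry : set (R * R) := circle_cell `*` fiber_cell.
Definition influx : set (R * R) := circle_cell `*` influx_fiber.

Definition leb2 := (@lebesgue_measure R \x @lebesgue_measure R)%E.

(* Elements of L^2(D), for D one of [bdry] and [influx], are represented by
   Borel functions; equality in L^2(D) is equality almost everywhere on D. *)
Definition L2 D f : Prop :=
  [/\ torus_fun f,
      measurable_fun D (fun x => complex.Re (f x)),
      measurable_fun D (fun x => complex.Im (f x)) &
      (\int[leb2]_(x in D)
         (complex.Re (f x) ^+ 2 + complex.Im (f x) ^+ 2)%:E < +oo)%E].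

Definition eqL2 D f g : Prop := {ae leb2, forall x, D x -> f x = g x}.

Definition Cintegral d (T : measurableType d) (mu : {measure set T -> \bar R})
    (A : set T) (f : T -> R[i]) : R[i] :=
  Rintegral mu A (fun x => complex.Re (f x)) +i*
  Rintegral mu A (fun x => complex.Im (f x)).

(* e^(i t) *)
Definition cis (t : R) : R[i] := cos t +i* sin t.

Definition scattering (x : R * R) : R * R := (x.1 + pi + 2 * x.2, pi - x.2).

(* For alpha in R, the class of alpha mod 2 pi lies in (-pi/2, pi/2) iff
   cos alpha > 0, and in (pi/2, 3 pi/2) iff cos alpha < 0.  The value chosen on
   the null set cos alpha = 0 is irrelevant. *)
Definition Aplus f : R * R -> R[i] := fun x =>
  if 0 < cos x.2 then f x
  else if cos x.2 < 0 then f (scattering x) else 0.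

Definition Aminus_adj f : R * R -> R[i] := fun x => f x - f (scattering x).

Definition fiber_coef f (b : R) (k : int) : R[i] :=
  ((2 * pi)^-1)%:C *
  Cintegral lebesgue_measure fiber_cell (fun a => cis (- (k%:~R * a)) * f (b, a)).

(* [fiber_multiplier m f g] is the graph of the operator on L^2(bdry) that, for
   (almost) each fixed beta, multiplies the harmonic e^(i k alpha) by [m k]:
   for bounded m, f determines g up to a null set since the Fourier
   coefficients of g(beta, .) determine it. *)
Definition fiber_multiplier (m : int -> R[i]) f g : Prop :=
  L2 bdry g /\
  {ae lebesgue_measure, forall b : R, circle_cell b ->
     forall k : int, fiber_coef g b k = m k * fiber_coef f b k}.

Definition hilbert_symbol (k : int) : R[i] := - 'i * (sgz k)%:~R.

Definition odd_symbol (k : int) : R[i] := (odd `|k|%N)%:R.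

Definition odd_projection f g : Prop := fiber_multiplier odd_symbol f g.

Definition fiber_hilbert f g : Prop := fiber_multiplier hilbert_symbol f g.

(* Graph of H_- : the odd projection followed by the Hilbert transform. *)
Definition Hminus f g : Prop :=
  exists2 p, odd_projection f p & fiber_hilbert p g.

(* Graph of P_- = A_-^* H_- A_+ on L^2(influx). *)
Definition Pminus h f : Prop :=
  exists2 w, Hminus (Aplus h) w & eqL2 influx f (Aminus_adj w).

Definition range_Pminus f : Prop := exists2 h, L2 influx h & Pminus h f.

Definition fan_beam_symmetry f : Prop :=
  {ae leb2, forall x, influx x -> f (x.1 + pi + 2 * x.2, - x.2) = f x}.

(* The boolean s selects the sign (-1) ^+ s of the exponent. *)
Definition moment f (n k : nat) (s : bool) : R[i] :=
  Cintegral leb2 influx (fun x =>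
    (cos x.2 * sin x.2 ^+ n)%:C
    * cis ((-1) ^+ s * k%:R * (x.1 + x.2)) * f x).

End fan_beam.

(* Main.v *)
Require Import Defs.
From HB Require Import structures.
From mathcomp Require Import all_boot all_order all_algebra.
From mathcomp Require Import complex ring lra zify.
From mathcomp Require Import all_classical all_reals all_analysis measurable_realfun.

Set Implicit Arguments.
Unset Strict Implicit.
Unset Printing Implicit Defensive.

Import Order.TTheory GRing.Theory Num.Theory.
Import numFieldNormedType.Exports.

Local Open Scope classical_set_scope.
Local Open Scope ring_scope.

(** When q and 2 p - q have the same sign, H multiplies both modes exchanged by S by the same
    number, so an invariant u gives an invariant H u, which A_-^* kills; when the signs are
    opposite, H exchanges invariance and anti-invariance. The constant in h comes from H^2 = -1 on
    odd modes: H h = v / 2, and A_-^* (v / 2) = v is D on the influx boundary. What remains is that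
    A_+ h is - (1/2) H v itself, that is, that H v is invariant; this is where the moments enter.
    Real and imaginary parts decouple because - i sign (k) is conjugated when k changes sign. On
    real functions a coefficient carries a phase t, and H becomes the shift of t by pi / 2 for q >
    0. The Hilbert transform must be one jointly measurable function with the right coefficients on
    almost every fiber. L^2 bounds on the partial sums do not give a pointwise limit; summable
    increments do, together with a majorant that is integrable on almost every fiber. *)

(* The functions A_+ h on the torus are exactly the invariant ones under the
   scattering relation S, and the extension v = D - D o S of the data is
   anti-invariant.  On Fourier modes S exchanges e^(i (p b + q a)) and, up to the
   sign (-1)^(p + q), e^(i (p b + (2 p - q) a)).  Hence A_-^* H_- A_+ keeps only the
   modes with q odd for which q and 2 p - q have opposite signs, and D lies in the
   range of P_- iff v has no other modes; then D = P_- h with h = - (1/2) H v.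
   Fan-beam symmetry of D says that v has no mode with q even.  The moments with
   exponent e^(i k (b + a)) span, by the anti-invariance of v and a triangular
   change of basis, the modes p = k, 0 < q < 2 k, q odd, where q and 2 p - q have
   the same sign.  Real and imaginary parts are treated separately.

   Completeness of the trigonometric system: the polynomials
   (1 - y^n)^(2^n), applied to an affine function y of cos (a - a0), converge boundedly to the
   indicator of an arc, so a function with zero Fourier coefficients has zero
   integral on arcs.  The Hilbert transform of v is the limit of the conjugate
   partial sums along a subsequence N_j independent of the fiber, chosen so that
   the increments are summable in L^1. *)

(** * Periodic functions on the line *)

Section circle.
Context {R : realType}.
Local Notation mu := (@lebesgue_measure R).
Implicit Types (c t x : R) (F : R -> \bar R).

(** The base point is free because the circle and the fiber are cut at different points, 0 and
    [- (pi / 2)]. *)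
Definition cell c : set R := `[c, c + 2 * pi[%classic.

Lemma pi2_gt0 : 0 < 2 * pi :> R.
Proof. by rewrite mulr_gt0// pi_gt0. Qed.

Lemma measurable_cell c : measurable (cell c : set (measurableTypeR R)).
Proof. exact: measurable_itv. Qed.

Lemma lebesgue_cell c : mu (cell c) = (2 * pi)%:E.
Proof.
rewrite /cell lebesgue_measure_itv/= lte_fin ltrDl pi2_gt0.
by rewrite -EFinD addrAC subrr add0r.
Qed.

(** The translated measure agrees with Lebesgue measure on half-open intervals, and these determine
    it. *)
Lemma lebesgue_measure_shift t (A : set R) : measurable A ->
  pushforward mu (fun x : R => (x + t : measurableTypeR R)) A = mu A.
Proof.
move=> mA.
have mf : measurable_fun [set: R] (fun x : R => (x + t : measurableTypeR R)).
  exact: measurable_funD.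
pose mfm := isMeasurableFun.Build _ _ _ _ _ mf.
pose f : {mfun _ >-> _} := HB.pack (fun x : R => (x + t : measurableTypeR R)) mfm.
apply/esym/(lebesgue_measure_unique (mu := pushforward mu f)) => //= _ [[a b]] _ <-.
rewrite /pushforward/=.
rewrite (_ : _ @^-1` _ = `]a - t, b - t]%classic); last first.
  by apply/seteqP; split => x /=; rewrite !in_itv/= ltrBlDr lerBrDr.
rewrite !lebesgue_measure_itv/= !lte_fin ltrD2r; case: ifPn => // _.
by rewrite -!EFinD; congr EFin; ring.
Qed.

Lemma ge0_integral_shift F t (D : set R) : measurable D -> measurable_fun setT F ->
  (forall x, 0 <= F x)%E ->
  (\int[mu]_(x in (fun x : R => (x + t)%R) @^-1` D) F (x + t)%R =
   \int[mu]_(x in D) F x)%E.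
Proof.
move=> mD mF F0.
have mf : measurable_fun [set: R] (fun x : R => (x + t : measurableTypeR R)).
  exact: measurable_funD.
transitivity (\int[pushforward mu (fun x : R => (x + t)%R : measurableTypeR R)]_(x in D)
  F x)%E.
  by rewrite ge0_integral_pushforward//; exact: measurable_funTS.
apply: eq_measure_integral => A mA _; exact: lebesgue_measure_shift.
Qed.

Lemma shift_itvco t (a b : R) :
  (fun x : R => x + t) @^-1` `[a, b[%classic = `[a - t, b - t[%classic.
Proof. by apply/seteqP; split => x /=; rewrite !in_itv/= ltrBrDr lerBlDr. Qed.

Lemma ge0_integral_opp F (D : set R) : measurable D -> measurable_fun setT F ->
  (forall x, 0 <= F x)%E ->
  (\int[mu]_(x in (-%R : R -> R) @^-1` D) F (- x)%R = \int[mu]_(x in D) F x)%E.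
Proof.
move=> mD mF F0.
transitivity (\int[pushforward mu (-%R : _ -> measurableTypeR R)]_(x in D) F x)%E.
  by rewrite ge0_integral_pushforward//; exact: measurable_funTS.
apply: eq_measure_integral => A mA _; exact: lebesgue_measureN.
Qed.

Lemma measurable_floor : measurable_fun setT (fun x => (Num.floor x)%:~R : R).
Proof.
apply: (measurability _ (RGenOInfty.measurableE R)) => //.
move=> /= _ [_ [a ->] <-]; rewrite setTI preimage_itvoy.
rewrite (_ : [set x | _] = `[(Num.floor a + 1)%:~R, +oo[%classic).
  exact: measurable_itv.
apply/seteqP; split => x /=; rewrite in_itv/= andbT.
  by rewrite -floor_lt_int -floor_ge_int lezD1.
by rewrite -floor_lt_int -floor_ge_int lezD1.
Qed.

(** The representative of x modulo 2 pi in [cell c]. *)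
Definition wrap c x : R := x - 2 * pi * (Num.floor ((x - c) / (2 * pi)))%:~R.

Lemma wrap_cell c x : cell c (wrap c x).
Proof.
rewrite /cell /wrap /= in_itv/=.
have := floor_itv ((x - c) / (2 * pi)); rewrite intrD.
set m := (_%:~R); rewrite ler_pdivlMr ?pi2_gt0// ltr_pdivrMr ?pi2_gt0//.
move=> /andP[h1 h2]; apply/andP; split; lra.
Qed.

Lemma measurable_wrap c : measurable_fun setT (wrap c).
Proof.
apply: measurable_funB => //.
apply: measurable_funM => //.
apply: (@measurableT_comp _ _ _ _ _ _ (fun y : R => (Num.floor y)%:~R : R) _ (fun x => (x
  - c) / (2 * pi))).
  exact: measurable_floor.
by apply: measurable_funM => //; exact: measurable_funB.
Qed.

Lemma periodic_int (T : Type) (f : R -> T) : (forall x, f (x + 2 * pi) = f x) ->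
  forall x (m : int), f (x + 2 * pi * m%:~R) = f x.
Proof.
move=> fp.
have fpn x (n : nat) : f (x + 2 * pi * n%:R) = f x.
  elim: n x => [|n ih] x; first by rewrite mulr0 addr0.
  by rewrite -(natr1 n) mulrDr mulr1 addrA fp ih.
move=> x [n|n]; first by rewrite -pmulrn fpn.
by rewrite NegzE mulrNz -pmulrn mulrN -(fpn _ n.+1) subrK.
Qed.

Lemma periodic_wrap (T : Type) (f : R -> T) c : (forall x, f (x + 2 * pi) = f x) ->
  forall x, f (wrap c x) = f x.
Proof. by move=> fp x; rewrite /wrap -mulrN -mulrNz periodic_int. Qed.

Lemma ge0_integral_cell F c t : measurable_fun setT F ->
  (forall x, 0 <= F x)%E -> (forall x, F (x + 2 * pi) = F x) ->
  (\int[mu]_(x in cell c) F x = \int[mu]_(x in cell t) F x)%E.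
Proof.
move=> mF F0 Fp.
(* Translation by whole periods reduces to an offset s in [0, 2 pi[. The two cells then share [[u +
   s, u + 2 * pi[], and the remaining pieces differ by one period. *)
suff main s u : 0 <= s < 2 * pi ->
    (\int[mu]_(x in cell (u + s)) F x = \int[mu]_(x in cell u) F x)%E.
  rewrite -(main (wrap 0 (c - t)) t); last first.
    by have := wrap_cell 0 (c - t); rewrite /cell/= in_itv/= add0r.
  rewrite /wrap subr0; set m := Num.floor _.
  rewrite (_ : t + _ = c + 2 * pi * (- m)%:~R); last by rewrite mulrNz; ring.
  rewrite -[RHS](@ge0_integral_shift F (2 * pi * (- m)%:~R) (cell _))//;
    last exact: measurable_cell.
  rewrite [in RHS]/cell shift_itvco (addrAC _ _ (2 * pi)) !addrK.
  by apply: eq_integral => x _; rewrite periodic_int.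
move=> /andP[s0 s2].
have cU (v : R) (w : R) : v <= w -> w <= v + 2 * pi ->
    cell v = `[v, w[%classic `|` `[w, v + 2 * pi[%classic.
  move=> h1 h2; apply/seteqP; split => x; rewrite /cell/= !in_itv/=.
    by move=> /andP[-> ->]; rewrite andbT; case: (ltP x w); [left|right].
  by case=> /andP[a b]; apply/andP; split; lra.
have dis (v w z : R) : [disjoint `[v, w[%classic & `[w, z[%classic].
  apply/disj_setPS => x /= []; rewrite !in_itv/=.
  by move=> /andP[_ h] /andP[h1 _]; move: h; rewrite ltNge h1.
rewrite (cU u (u + s)) 1?(cU (u + s) (u + 2 * pi)); [|lra..].
rewrite !ge0_integral_setU//=; try exact: measurable_funTS.
rewrite addeC; congr (_ + _)%E.
rewrite -(@ge0_integral_shift F (2 * pi) `[_, u + s + 2 * pi[%classic)//.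
rewrite shift_itvco !addrK.
by apply: eq_integral => x _; rewrite Fp.
Qed.

Lemma ge0_integral_cell_shift F c t : measurable_fun setT F ->
  (forall x, 0 <= F x)%E -> (forall x, F (x + 2 * pi) = F x) ->
  (\int[mu]_(x in cell c) F (x + t)%R = \int[mu]_(x in cell c) F x)%E.
Proof.
move=> mF F0 Fp; rewrite (@ge0_integral_cell F c (c + t))//.
rewrite -(@ge0_integral_shift F t (cell _))//; last exact: measurable_cell.
by rewrite [in RHS]/cell shift_itvco (addrAC _ _ (2 * pi)) !addrK.
Qed.

Lemma ge0_integral_cell_opp F c : measurable_fun setT F ->
  (forall x, 0 <= F x)%E -> (forall x, F (x + 2 * pi) = F x) ->
  (\int[mu]_(x in cell c) F (- x)%R = \int[mu]_(x in cell c) F x)%E.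
Proof.
move=> mF F0 Fp; rewrite (@ge0_integral_cell F c (- c - 2 * pi))//.
rewrite -(@ge0_integral_opp F (cell _))//; last exact: measurable_cell.
rewrite (_ : _ @^-1` _ = `]c, c + 2 * pi]%classic); last first.
  by apply/seteqP; split => x; rewrite /cell/= !in_itv/= => /andP[h1 h2]; apply/andP;
    split; lra.
have mFN : measurable_fun setT (fun x : R => F (- x)).
  exact: (measurableT_comp mF).
(* Reflection moves the closed end of the interval to the other side, so both integrals are compared
   on the open interval. *)
rewrite /cell (@integral_itv_bndoo R c (c + 2 * pi) (fun x => F (- x)) true true);
  last exact: measurable_funTS.
rewrite (@integral_itv_bndoo R c (c + 2 * pi) (fun x => F (- x)) false false)//.
exact: measurable_funTS.
Qed.

End circle.

(** * Completeness of the trigonometric system *)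

Section uniqueness.
Context {R : realType}.
Local Notation mu := (@lebesgue_measure R).
Implicit Types (c t x y s : R) (f : R -> R).

Lemma bernoulli_ge x m : 0 <= x <= 1 -> 1 - m%:R * x <= (1 - x) ^+ m.
Proof.
move=> /andP[x0 x1]; elim: m => [|m ih]; first by rewrite mul0r subr0 expr0.
rewrite exprS -(natr1 m).
apply: (@le_trans _ _ ((1 - x) * (1 - m%:R * x))).
  have : 0 <= m%:R * x ^+ 2 by rewrite mulr_ge0// sqr_ge0.
  by rewrite expr2; lra.
by rewrite ler_wpM2l// subr_ge0.
Qed.

(** The upper counterpart of Bernoulli's inequality, written without division. The induction rests
    on (1 - x) (1 + (m + 1) x) <= 1 + m x. *)
Lemma bernoulli_le x m : 0 <= x <= 1 -> (1 - x) ^+ m * (1 + m%:R * x) <= 1.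
Proof.
move=> /andP[x0 x1]; elim: m => [|m ih]; first by rewrite mul0r addr0 expr0 mul1r.
apply: le_trans ih; rewrite exprS -mulrA mulrCA ler_wpM2l ?exprn_ge0 ?subr_ge0//.
rewrite -(natr1 m).
have : 0 <= m%:R * x ^+ 2 by rewrite mulr_ge0// sqr_ge0.
have : 0 <= x ^+ 2 by rewrite sqr_ge0.
by rewrite expr2; lra.
Qed.

(** By the two Bernoulli bounds everything depends on 2^n y^n = (2 y)^n, which tends to 0 or to
    infinity on either side of y = 1/2. These are the polynomials of the Brosowski-Deutsch proof of
    the Stone-Weierstrass theorem. *)
Lemma cvg_bernoulli y : 0 <= y <= 1 -> y != 2^-1 ->
  (1 - y ^+ n) ^+ (2 ^ n)%N @[n --> \oo] --> ((y < 2^-1)%R%:R : R).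
Proof.
move=> /andP[y0 y1] yn.
have yn01 n : 0 <= y ^+ n <= 1 by rewrite exprn_ge0//= exprn_ile1.
have up n : (1 - y ^+ n) ^+ (2 ^ n)%N <= 1.
  by apply: exprn_ile1; have /andP[] := yn01 n; lra.
have lo n : 0 <= (1 - y ^+ n) ^+ (2 ^ n)%N.
  by apply: exprn_ge0; have /andP[] := yn01 n; lra.
have pw n : ((2 ^ n)%N%:R * y ^+ n : R) = (2 * y) ^+ n by rewrite natrX exprMn.
case: (ltP y 2^-1) => yh /=.
  apply: (squeeze_cvgr (f := fun n => 1 - (2 * y) ^+ n) (h := cst 1)).
  - apply: nearW => n; rewrite up andbT -pw; exact: bernoulli_ge.
  - rewrite -[X in _ --> X]subr0; apply: cvgB; first exact: cvg_cst.
    by apply: cvg_expr; rewrite ger0_norm; lra.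
  - exact: cvg_cst.
have {}yh : 2^-1 < y by rewrite lt_neqAle eq_sym yn.
apply: (squeeze_cvgr (f := cst 0) (h := fun n => (2 * y)^-1 ^+ n)).
- apply: nearW => n; rewrite lo/= exprVn -pw.
  have yn0 : 0 < (2 ^ n)%N%:R * y ^+ n.
    by rewrite pw exprn_gt0//; lra.
  rewrite -[leRHS]mul1r ler_pdivlMr//.
  apply: le_trans (bernoulli_le (2 ^ n)%N (yn01 n)).
  by rewrite ler_wpM2l// lerDr.
- exact: cvg_cst.
- by apply: cvg_expr; rewrite ger0_norm ?invr_ge0; [rewrite invf_lt1|]; lra.
Qed.

Section real_integrable.
Context d (T : measurableType d) (m : {measure set T -> \bar R}) (D : set T).
Hypothesis mD : measurable D.
Implicit Types g h : T -> R.

Lemma integrableZlR (k : R) h : m.-integrable D (EFin \o h) ->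
  m.-integrable D (EFin \o (fun z => k * h z)).
Proof.
by move=> /(integrableZl mD k); apply: eq_integrable => // z _; rewrite /= EFinM.
Qed.

Lemma integrableDR g h : m.-integrable D (EFin \o g) ->
  m.-integrable D (EFin \o h) -> m.-integrable D (EFin \o (fun z => g z + h z)).
Proof.
move=> gi hi; apply: eq_integrable (integrableD mD gi hi) => // z _.
Qed.

Lemma integrable_bndM g (f : T -> R) (M : R) :
  measurable_fun D g -> (forall z, D z -> `|g z| <= M) ->
  m.-integrable D (EFin \o f) -> m.-integrable D (EFin \o (fun z => g z * f z)).
Proof.
move=> mg gM fi.
have := @integrableMr _ _ _ m _ mD g (EFin \o f) mg _ fi.
rewrite (_ : ((EFin \o g) \* (EFin \o f))%E = EFin \o (fun z => g z * f z)); last first.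
  by apply/funext => z /=; rewrite EFinM.
apply; exists M; split; first exact: num_real.
by move=> N MN z Dz /=; apply: le_trans (gM _ Dz) (ltW MN).
Qed.

End real_integrable.

Lemma cos_periodic x : cos (x + 2 * pi) = cos x.
Proof. by rewrite mulr_natl cosD2pi. Qed.

Lemma continuous_cosMD (u v : R) : continuous (fun x => cos (u * x + v)).
Proof.
move=> x; apply: continuous_comp; last exact: continuous_cos.
by apply: cvgD; [apply: cvgM; [exact: cvg_cst|exact: cvg_id]|exact: cvg_cst].
Qed.

Lemma measurable_cosMD (D : set R) (u v : R) :
  measurable_fun D (fun x => cos (u * x + v)).
Proof.
apply: measurable_funTS; apply: continuous_measurable_fun.
exact: continuous_cosMD.
Qed.

(* Real-valued Fourier coefficients; the phase t encodes both the cosine (t = 0)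
   and the sine (t = - pi / 2) coefficient of frequency q, and q < 0 is allowed. *)
Definition circle_cc c f (q : int) (t : R) : R :=
  (\int[mu]_(a in cell c) (cos (q%:~R * a + t) * f a))%R.

Lemma integrable_cosM c f (u v : R) : mu.-integrable (cell c) (EFin \o f) ->
  mu.-integrable (cell c) (EFin \o (fun a => cos (u * a + v) * f a)).
Proof.
move=> fi.
apply: (@integrable_bndM _ _ mu (cell c) _ (fun a : R => cos (u * a + v)) f 1 _ _ fi).
- exact: measurable_cell.
- exact: measurable_cosMD.
- by move=> x _; exact: cos_max.
Qed.

Lemma cos_prod x y : cos x * cos y = 2^-1 * (cos (x + y) + cos (y - x)).
Proof. by rewrite cosD cosB; field. Qed.

(** Multiplying by cos (a - s) replaces (q, t) by (q + 1, t - s) and (q - 1, t + s), so the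
    induction on p must quantify over q and t. Integrability is carried along in order to split the
    integral. *)
Lemma circle_cc0_horner c f s : mu.-integrable (cell c) (EFin \o f) ->
  (forall q t, circle_cc c f q t = 0) ->
  forall (p : {poly R}) (q : int) t,
  mu.-integrable (cell c) (EFin \o (fun a => p.[cos (a - s)] * (cos (q%:~R * a + t) * f
    a))) /\
  (\int[mu]_(a in cell c) (p.[cos (a - s)] * (cos (q%:~R * a + t) * f a)) = 0)%R.
Proof.
move=> fi f0; elim/poly_ind => [|p k ih] q t.
  split.
    rewrite (_ : _ \o _ = cst 0%E); first exact: integrable0.
    by apply/funext => a /=; rewrite horner0 mul0r.
  under eq_Rintegral do rewrite horner0 mul0r.
  by rewrite Rintegral_cst ?mul0r//; exact: measurable_cell.
have mc := @measurable_cell R c.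
have [i1 e1] := ih (q + 1)%R (t - s).
have [i2 e2] := ih (q - 1)%R (t + s).
have i3 := integrable_cosM q%:~R t fi.
have e3 := f0 q t.
pose F1 a := p.[cos (a - s)] * (cos ((q + 1)%:~R * a + (t - s)) * f a).
pose F2 a := p.[cos (a - s)] * (cos ((q - 1)%:~R * a + (t + s)) * f a).
pose F3 a := cos (q%:~R * a + t) * f a.
have E : (fun a => (p * 'X + k%:P).[cos (a - s)] * (cos (q%:~R * a + t) * f a)) =
    (fun a => 2^-1 * F1 a + (2^-1 * F2 a + k * F3 a)).
  apply/funext => a; rewrite hornerMXaddC mulrDl -mulrA (mulrA (cos (a - s))) cos_prod
    /F1 /F2 /F3.
  rewrite !intrD (_ : a - s + _ = (q%:~R + 1%:~R) * a + (t - s)); last by ring.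
  rewrite (_ : q%:~R * a + t - _ = (q%:~R + (-1)%:~R) * a + (t + s)); last by ring.
  by ring.
have j1 : mu.-integrable (cell c) (EFin \o (fun a => 2^-1 * F1 a)).
  exact: integrableZlR.
have j2 : mu.-integrable (cell c) (EFin \o (fun a => 2^-1 * F2 a)).
  exact: integrableZlR.
have j3 : mu.-integrable (cell c) (EFin \o (fun a => k * F3 a)).
  exact: integrableZlR.
have j23 : mu.-integrable (cell c) (EFin \o (fun a => 2^-1 * F2 a + k * F3 a)).
  exact: integrableDR.
rewrite E; split; first exact: integrableDR.
rewrite RintegralD// RintegralD// !RintegralZl//.
by rewrite e1 e2 -/(circle_cc c f q t) e3 !mulr0 !addr0.
Qed.

(* On [cell c], the arc [cos (x - (c + t) / 2) > cos ((t - c) / 2)] is ]c, t[. *)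
Lemma cos_arc c t x : cell c t -> cell c x -> x != c -> x != t ->
  cos (x - (c + t) / 2) != cos ((t - c) / 2) /\
  (cos ((t - c) / 2) < cos (x - (c + t) / 2)) = (c < x < t).
Proof.
rewrite /cell /= !in_itv/= => /andP[t1 t2] /andP[x1 x2] xc xt.
have cx : c < x by rewrite lt_neqAle eq_sym xc.
rewrite cx /=.
have rI : (t - c) / 2 \in `[0, pi]%R by rewrite in_itv/=; apply/andP; split; lra.
(* Cosine is decreasing on [0, pi]; the cases below fold the angle x - (c + t) / 2 into that
   range. *)
have main z : z \in `[0, pi]%R -> (z < (t - c) / 2) = (x < t) -> z != (t - c) / 2 ->
   cos z != cos ((t - c) / 2) /\ (cos ((t - c) / 2) < cos z) = (x < t).
  move=> zI zt zn; split; last by rewrite ltr_cos.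
  by apply: contra zn => /eqP /cos_inj ->.
have xt' : x < t \/ t < x by apply/orP; rewrite -neq_lt.
case: (leP (x - (c + t) / 2) pi) => h.
  rewrite -(cos_norm (x - _)).
  have [h0|h0] := leP 0 (x - (c + t) / 2).
    rewrite ger0_norm//; apply: main.
    - by rewrite in_itv/= h0.
    - by apply/idP/idP => ?; lra.
    - by apply/eqP => ?; case: xt' => ?; lra.
  rewrite ltr0_norm//; apply: main.
  - by rewrite in_itv/=; apply/andP; split; lra.
  - by apply/idP/idP => ?; lra.
  - by apply/eqP => ?; lra.
have -> : cos (x - (c + t) / 2) = cos (2 * pi - (x - (c + t) / 2)).
  by rewrite -(cosN (2 * pi - _)) opprB -(cos_periodic (_ - 2 * pi)) subrK.
apply: main.
- by rewrite in_itv/=; apply/andP; split; lra.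
- by apply/idP/idP => ?; lra.
- by apply/eqP => ?; lra.
Qed.

Lemma integral_itv_circle_cc0 c f t : mu.-integrable (cell c) (EFin \o f) ->
  (forall q s, circle_cc c f q s = 0) -> cell c t ->
  (\int[mu]_(a in `]c, t[) (f a)%:E = 0)%E.
Proof.
move=> fi f0 ct.
have mc := @measurable_cell R c.
pose k := cos ((t - c) / 2).
pose s := (c + t) / 2.
(* Since [k - cos] is at most 2 in absolute value, the slope 1/4 keeps Y in [0, 1]; the critical
   value 1/2 is reached exactly where cos (x - s) = k. *)
pose Y : {poly R} := (2^-1 + 4^-1 * k)%:P - (4^-1)%:P * 'X.
have YE x : Y.[x] = 2^-1 + (k - x) / 4 by rewrite /Y !hornerE; field.
pose P n : {poly R} := (1 - Y ^+ n) ^+ (2 ^ n)%N.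
have PE n x : (P n).[x] = (1 - Y.[x] ^+ n) ^+ (2 ^ n)%N.
  by rewrite /P !(horner_exp, hornerE).
have Y01 x : 0 <= Y.[cos x] <= 1.
  rewrite YE; have := cos_le1 x; have := cos_geN1 x.
  have := cos_le1 ((t - c) / 2); have := cos_geN1 ((t - c) / 2).
  by rewrite -/k => *; apply/andP; split; lra.
have P01 n x : `|(P n).[cos x]| <= 1.
  have /andP[y0 y1] := Y01 x.
  have : 0 <= Y.[cos x] ^+ n <= 1 by rewrite exprn_ge0//= exprn_ile1.
  move=> /andP[h0 h1].
  rewrite PE ger0_norm; first by apply: exprn_ile1; lra.
  by apply: exprn_ge0; lra.
have i0 n : (\int[mu]_(a in cell c) ((P n).[cos (a - s)] * f a)%:E = 0)%E.
  have [i1 e1] := circle_cc0_horner s fi f0 (P n) 0 0.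
  have EE : (fun a => (P n).[cos (a - s)] * (cos (0%:~R * a + 0) * f a)) =
            (fun a => (P n).[cos (a - s)] * f a).
    by apply/funext => a; rewrite mul0r addr0 cos0 mul1r.
  rewrite EE in i1 e1.
  have fn : (\int[mu]_(a in cell c) ((P n).[cos (a - s)] * f a)%:E)%E \is a fin_num.
    by apply: integrable_fin_num i1; exact: mc.
  have {}e1 : fine (\int[mu]_(a in cell c) ((P n).[cos (a - s)] * f a)%:E) = 0 by exact: e1.
  by rewrite -(fineK fn) e1.
have fm := measurable_int _ fi.
have := @dominated_convergence _ _ R mu (cell c) mc
  (fun n a => ((P n).[cos (a - s)] * f a)%:E)
  ((EFin \o f) \_ `]c, t[%classic) (fun a => `|(f a)%:E|%E).
case.
- move=> n; have [i1 _] := circle_cc0_horner s fi f0 (P n) 0 0.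
  apply: (eq_measurable_fun _ _ (measurable_int _ i1)) => a _ /=.
  by rewrite mul0r addr0 cos0 mul1r.
- apply/measurable_restrict => //.
  by apply: measurable_funS fm => //; apply: subIsetl.
(* At the ends of the arc Y equals 1/2, where [cvg_bernoulli] says nothing. *)
- exists [set c; t]; split.
  + by apply: measurableU; exact: measurable_set1.
  + by apply: countable_lebesgue_measure0; apply/finite_set_countable/finite_set2.
  + move=> x /=; apply: contra_notP => /not_orP[xc xt] cx.
    have [n h] := cos_arc ct cx (introN eqP xc) (introN eqP xt).
    have xn : Y.[cos (x - s)] != 2^-1.
      by rewrite YE; apply: contra n => /eqP e; apply/eqP; rewrite -/s -/k; lra.
    have := cvg_bernoulli (Y01 (x - s)) xn.
    have -> : (Y.[cos (x - s)] < 2^-1) = (c < x < t).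
      by rewrite -h YE -/s -/k; apply/idP/idP => ?; lra.
    move=> hc; rewrite patchE mem_setE in_itv/=.
    rewrite (_ : (if _ then _ else _) = ((c < x < t)%R%:R * f x)%:E); last first.
      by case: ifP => _; rewrite ?mul1r ?mul0r.
    apply: cvg_EFin; first exact: nearW.
    apply: cvgM; last exact: cvg_cst.
    by under eq_fun do rewrite PE.
- exact: integrable_abse.
- apply: aeW => x n _ /=.
  by rewrite lee_fin normrM ler_piMl.
move=> _ _; under eq_fun do rewrite i0.
move=> h; have {h} := cvg_unique _ (cvg_cst 0%E) h => /(_ (@ereal_hausdorff R)).
rewrite -integral_mkcondr => h.
rewrite h; congr integral; apply/seteqP; split => x /=; last by case.
rewrite in_itv/= => /andP[x1 x2]; split; last by rewrite /= ?in_itv/= ?x1 ?x2.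
by move: ct; rewrite /cell /= !in_itv/= => /andP[t1 t2]; rewrite (ltW x1) (lt_trans x2).
Qed.

End uniqueness.

Section uniqueness_ae.
Context {R : realType}.
Local Notation mu := (@lebesgue_measure R).
Implicit Types (c t x y s : R) (f : R -> R).

(** By Lebesgue differentiation: the primitive of f restricted to the cell vanishes identically, and
    its derivative is f almost everywhere. *)
Theorem circle_cc_uniqueness c f : mu.-integrable (cell c) (EFin \o f) ->
  (forall q s, circle_cc c f q s = 0) -> {ae mu, forall a, cell c a -> f a = 0}.
Proof.
move=> fi f0.
have mc := @measurable_cell R c.
have loc := integrable_locally mc fi.
have fT : mu.-integrable setT (EFin \o (f \_ (cell c))).
  by rewrite -restrict_EFin; apply/(integrable_mkcond _ mc).1.
have fm : measurable_fun (cell c) (EFin \o f) := measurable_int _ fi.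
have F0 x : (\int[mu]_(t in `]-oo, x]) (f \_ (cell c)) t = 0)%R.
  rewrite -Rintegral_mkcondr.
  have [xc|cx] := ltP x c.
    rewrite (_ : _ `&` _ = set0) ?Rintegral_set0//.
    apply/seteqP; split => // y [] /=; rewrite /cell/= !in_itv/= => yx /andP[h _].
    by lra.
  have [xc|cx2] := ltP x (c + 2 * pi).
    have cx' : cell c x by rewrite /cell/= in_itv/= cx.
    rewrite (_ : _ `&` _ = `[c, x]%classic); last first.
      apply/seteqP; split => y /=; rewrite /cell/= !in_itv/=.
        by case=> -> /andP[-> _].
      by move=> /andP[h1 h2]; rewrite h2 h1 (le_lt_trans h2).
    rewrite /Rintegral (_ : (\int[mu]_(z in `[c, x]) (f z)%:E)%E = 0)//.
    rewrite (@integral_itv_bndoo R c x (EFin \o f) true false).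
      exact: integral_itv_circle_cc0.
    apply: measurable_funS fm; first exact: mc.
    move=> y; rewrite /cell/= !in_itv/= => /andP[h1 h2].
    by rewrite (ltW h1) (lt_trans h2).
  (* Beyond the cell the primitive is the full integral, which is the coefficient of frequency 0 and
     phase 0. *)
  rewrite (_ : _ `&` _ = cell c).
    have := f0 0 0; rewrite /circle_cc => <-; apply: eq_Rintegral => a _.
    by rewrite mul0r addr0 cos0 mul1r.
  apply/seteqP; split => y /=; first by case.
  rewrite /cell/= !in_itv/= => /andP[h1 h2]; split; last by rewrite h1.
  by apply: ltW (lt_le_trans h2 cx2).
have iy y : mu.-integrable `]-oo, y] (EFin \o (f \_ (cell c))).
  by apply: integrableS fT => //; exact: measurable_itv.
have := FTC1Ny iy loc; apply: filterS; first exact: (ae_filter_ringOfSetsType mu).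
move=> a /= [_ h] ca.
have : (fun x => (\int[mu]_(t in `]-oo, x]) (f \_ (cell c)) t)%R) = cst 0.
  by apply/funext => x; rewrite F0.
move=> e; move: h; rewrite e derive1_cst patchE mem_set// => <-.
Qed.

End uniqueness_ae.

(** * Functions on the torus *)

Section torus.
Context {R : realType}.
Local Notation mu := (@lebesgue_measure R).
Local Notation leb2 := (@leb2 R).
Local Notation bdry := (@bdry R).
Implicit Types (x : R * R) (f g : R * R -> R).

Lemma circle_cellE : circle_cell = cell (0 : R).
Proof. by rewrite /circle_cell /cell add0r. Qed.

Lemma fiber_cellE : fiber_cell = cell (- (pi / 2) : R).
Proof.
rewrite /fiber_cell /cell (_ : - (pi / 2) + 2 * pi = 3 * (pi / 2))//.
by field.
Qed.

Lemma measurable_circle_cell : measurable (circle_cell : set (measurableTypeR R)).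
Proof. by rewrite circle_cellE; exact: measurable_cell. Qed.

Lemma measurable_fiber_cell : measurable (fiber_cell : set (measurableTypeR R)).
Proof. by rewrite fiber_cellE; exact: measurable_cell. Qed.

Lemma measurable_bdry :
  measurable (bdry : set (measurableTypeR R * measurableTypeR R)).
Proof.
apply: measurableX; [exact: measurable_circle_cell|exact: measurable_fiber_cell].
Qed.

Lemma patch_bdry (F : R * R -> \bar R) b a :
  (F \_ bdry) (b, a) =
  if b \in (circle_cell : set R) then ((fun a => F (b, a)) \_ fiber_cell) a else 0%E.
Proof. 
rewrite !patchE /bdry.
have -> : ((b, a) \in circle_cell `*` fiber_cell) =
  (b \in (circle_cell : set R)) && (a \in (fiber_cell : set R)).
  by apply/idP/andP => [|[]]; rewrite !inE.
by case: (b \in _).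
Qed.

Lemma tonelli12 (F : R * R -> \bar R) : measurable_fun setT F ->
  (forall x, 0 <= F x)%E ->
  (\int[leb2]_(x in bdry) F x =
   \int[mu]_(b in circle_cell) \int[mu]_(a in fiber_cell) F (b, a))%E.
Proof.
move=> mF F0.
rewrite integral_mkcond fubini_tonelli1; first last.
- by move=> x; rewrite patchE; case: ifP.
- apply/(measurable_restrictT _ _).1; first exact: measurable_bdry.
  exact: measurable_funTS.
rewrite [RHS]integral_mkcond; apply: eq_integral => b _.
rewrite /fubini_F [RHS]patchE.
under eq_integral do rewrite patch_bdry.
case: ifP => _; last by rewrite integral0.
by rewrite [RHS]integral_mkcond.
Qed.

Lemma tonelli21 (F : R * R -> \bar R) : measurable_fun setT F ->
  (forall x, 0 <= F x)%E ->
  (\int[leb2]_(x in bdry) F x =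
   \int[mu]_(a in fiber_cell) \int[mu]_(b in circle_cell) F (b, a))%E.
Proof.
move=> mF F0.
rewrite integral_mkcond fubini_tonelli2; first last.
- by move=> x; rewrite patchE; case: ifP.
- apply/(measurable_restrictT _ _).1; first exact: measurable_bdry.
  exact: measurable_funTS.
rewrite [RHS]integral_mkcond; apply: eq_integral => a _.
rewrite /fubini_G [RHS]patchE.
under eq_integral do rewrite patch_bdry.
case: (boolP (a \in _)) => aI; last first.
  under eq_integral do rewrite patchE (negbTE aI) if_same.
  by rewrite integral0.
rewrite [RHS]integral_mkcond; apply: eq_integral => b _.
by rewrite !patchE aI.
Qed.

(** [torus_fun] with an arbitrary codomain, to cover real parts and extended real integrands as
    well. *)
Definition biperiodic (T : Type) (F : R * R -> T) :=
  forall b a, F (b + 2 * pi, a) = F (b, a) /\ F (b, a + 2 * pi) = F (b, a).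

(** Reversal of the direction. It multiplies the fiber harmonic of frequency q by (-1)^q and so
    detects the parity of q. *)
Definition half_turn x : R * R := (x.1, x.2 + pi).

Lemma biperiodic_scattering (T : Type) (F : R * R -> T) : biperiodic F ->
  biperiodic (F \o scattering).
Proof.
move=> Fp b a; rewrite /scattering/=; split.
  by rewrite -[RHS](Fp _ _).1; congr F; congr pair; ring.
rewrite -[LHS](Fp _ _).2 -(Fp (b + pi + 2 * a)%R _).1 -(Fp (b + pi + 2 * a + _)%R _).1.
by congr F; congr pair; ring.
Qed.

Lemma biperiodic_half_turn (T : Type) (F : R * R -> T) : biperiodic F ->
  biperiodic (F \o half_turn).
Proof.
move=> Fp b a; rewrite /half_turn/=; split; first exact: (Fp _ _).1.
by rewrite -[RHS](Fp _ _).2; congr F; congr pair; ring.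
Qed.

Lemma scatteringK (T : Type) (F : R * R -> T) : biperiodic F ->
  forall x, F (scattering (scattering x)) = F x.
Proof.
move=> Fp [b a]; rewrite /scattering/=.
rewrite -[RHS](Fp _ _).1 -[RHS](Fp _ _).1; congr F; congr pair; ring.
Qed.

Lemma measurable_scattering : measurable_fun setT (@scattering R).
Proof.
apply/measurable_fun_pairP; split; rewrite /comp /=.
  apply: measurable_funD; last exact: measurable_funM.
  exact: measurable_funD.
exact: measurable_funB.
Qed.

Lemma measurable_half_turn : measurable_fun setT half_turn.
Proof.
apply/measurable_fun_pairP; split; rewrite /comp /=; first exact: measurable_fst.
by apply: measurable_funD; [exact: measurable_snd|].
Qed.

(** For fixed a the map is a translation in b, so b is integrated first; what remains is a
    reflection followed by a translation of the fiber. *)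
Lemma ge0_integral_scattering (F : R * R -> \bar R) : measurable_fun setT F ->
  (forall x, 0 <= F x)%E -> biperiodic F ->
  (\int[leb2]_(x in bdry) F (scattering x) = \int[leb2]_(x in bdry) F x)%E.
Proof.
move=> mF F0 Fp.
rewrite tonelli21//; last by apply: (measurableT_comp mF measurable_scattering).
transitivity (\int[mu]_(a in fiber_cell) \int[mu]_(b in circle_cell) F (b, pi - a)%R)%E.
  apply: eq_integral => a _; rewrite /scattering/= circle_cellE.
  under eq_integral do rewrite -addrA.
  apply: (@ge0_integral_cell_shift _ (fun b => F (b, (pi - a)%R))) => //.
  - by apply: measurableT_comp => //; exact: measurable_pair2.
  - by move=> b; exact: (Fp _ _).1.
rewrite -(@tonelli21 (fun x => F (x.1, (pi - x.2)%R))); first last.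
- by [].
- apply: (measurableT_comp mF); apply/measurable_fun_pairP.
  by split; rewrite /comp/=; [exact: measurable_fst|exact: measurable_funB].
rewrite !tonelli12//; last first.
  apply: (measurableT_comp mF); apply/measurable_fun_pairP.
  by split; rewrite /comp/=; [exact: measurable_fst|exact: measurable_funB].
apply: eq_integral => b _; rewrite /= fiber_cellE.
rewrite (@ge0_integral_cell_opp _ (fun a => F (b, (pi + a)%R))).
- under eq_integral do rewrite addrC.
  apply: (@ge0_integral_cell_shift _ (fun a => F (b, a))) => //.
  + by apply: measurableT_comp => //; exact: measurable_pair1.
  + by move=> a; exact: (Fp _ _).2.
- apply: (measurableT_comp mF); apply/measurable_fun_pairP.
  by split; rewrite /comp/=; [exact: measurable_cst|exact: measurable_funD].
- by [].
- by move=> a; rewrite addrA; exact: (Fp _ _).2.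
Qed.

Lemma ge0_integral_half_turn (F : R * R -> \bar R) : measurable_fun setT F ->
  (forall x, 0 <= F x)%E -> biperiodic F ->
  (\int[leb2]_(x in bdry) F (half_turn x) = \int[leb2]_(x in bdry) F x)%E.
Proof.
move=> mF F0 Fp.
rewrite !tonelli12//; last by apply: (measurableT_comp mF measurable_half_turn).
apply: eq_integral => b _; rewrite /half_turn/= fiber_cellE.
apply: (@ge0_integral_cell_shift _ (fun a => F (b, a))) => //.
- by apply: measurableT_comp => //; exact: measurable_pair1.
- by move=> a; exact: (Fp _ _).2.
Qed.

End torus.

Section almost_everywhere.
Context d (T : measurableType d) (R : realType) (m : {measure set T -> \bar R}).

Lemma ae_sub (P Q : T -> Prop) : (forall x, P x -> Q x) ->
  {ae m, forall x, P x} -> {ae m, forall x, Q x}.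
Proof.
by move=> PQ [N [mN N0 sN]]; exists N; split => // x nQ; apply: sN => /PQ.
Qed.

Lemma ae_and (P Q : T -> Prop) : {ae m, forall x, P x} ->
  {ae m, forall x, Q x} -> {ae m, forall x, P x /\ Q x}.
Proof.
move=> hP hQ; apply: negligibleS (negligibleU hP hQ) => x /= /not_andP.
by case; [left|right].
Qed.

End almost_everywhere.

(** * Integration over the torus and over its fibers *)

Section torus_integrable.
Context {R : realType}.
Local Notation mu := (@lebesgue_measure R).
Local Notation leb2 := (@leb2 R).
Local Notation bdry := (@bdry R).
Implicit Types (x : R * R) (f g h : R * R -> R) (p q : int) (t : R).

(** Measurability is asked on the whole plane because [scattering] and [half_turn] move points out
    of the fundamental domain. *)
Definition torus_L1 f := [/\ biperiodic f, measurable_fun setT f &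
  leb2.-integrable bdry (EFin \o f)].

Definition bdry_int f : R := (\int[leb2]_(x in bdry) f x)%R.

Let mb := @measurable_bdry R.

Lemma torus_L1D f g : torus_L1 f -> torus_L1 g -> torus_L1 (fun x => f x + g x).
Proof.
move=> [fp fm fi] [gp gm gi]; split.
- by move=> b a; rewrite !(fp b a).1 !(fp b a).2 !(gp b a).1 !(gp b a).2.
- exact: measurable_funD.
- exact: integrableDR.
Qed.

Lemma torus_L1Z k f : torus_L1 f -> torus_L1 (fun x => k * f x).
Proof.
move=> [fp fm fi]; split.
- by move=> b a; rewrite !(fp b a).1 !(fp b a).2.
- exact: measurable_funM.
- exact: integrableZlR.
Qed.

Lemma torus_L1M (M : R) g f : biperiodic g -> measurable_fun setT g ->
  (forall x, `|g x| <= M) -> torus_L1 f -> torus_L1 (fun x => g x * f x).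
Proof.
move=> gp gm gM [fp fm fi]; split.
- by move=> b a; rewrite !(fp b a).1 !(fp b a).2 !(gp b a).1 !(gp b a).2.
- exact: measurable_funM.
- apply: (integrable_bndM mb (M := M)) => //; exact: measurable_funTS.
Qed.

Lemma bdry_intD f g : torus_L1 f -> torus_L1 g ->
  bdry_int (fun x => f x + g x) = bdry_int f + bdry_int g.
Proof. by move=> [_ _ fi] [_ _ gi]; rewrite /bdry_int RintegralD. Qed.

Lemma bdry_intZ k f : torus_L1 f -> bdry_int (fun x => k * f x) = k * bdry_int f.
Proof. by move=> [_ _ fi]; rewrite /bdry_int RintegralZl. Qed.

(** The change of variables is known for nonnegative integrands, so f is split into its positive and
    negative parts. *)
Let torus_L1_comp (s : R * R -> R * R) f : measurable_fun setT s ->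
  (forall F : R * R -> \bar R, measurable_fun setT F -> (forall x, 0 <= F x)%E ->
    biperiodic F -> (\int[leb2]_(x in bdry) F (s x) = \int[leb2]_(x in bdry) F x)%E) ->
  biperiodic (f \o s) -> torus_L1 f -> torus_L1 (f \o s) /\ bdry_int (f \o s) = bdry_int f.
Proof.
move=> ms inv fsp [fp fm fi]; have mE : measurable_fun setT (EFin \o f).
  exact/measurable_EFinP.
split; [split => //; first exact: measurableT_comp fm ms|].
  have /integrableP[_ fi'] := fi; apply/integrableP; split.
    apply: measurable_funTS; apply: (measurableT_comp mE ms).
  rewrite (inv (fun x => `|(EFin \o f) x|)%E)//.
  - exact: measurableT_comp.
  - by move=> b a; rewrite /= (fp b a).1 (fp b a).2.
have e : (fun x => ((f \o s) x)%:E) = (EFin \o f) \o s by [].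
rewrite /bdry_int /Rintegral integralE [in RHS]integralE e funepos_comp funeneg_comp.
congr (fine (_ - _)%E); apply: inv => //.
- exact: measurable_funepos.
- by move=> b a; rewrite !funeposE /= (fp b a).1 (fp b a).2.
- exact: measurable_funeneg.
- by move=> b a; rewrite !funenegE /= (fp b a).1 (fp b a).2.
Qed.

Lemma torus_L1_scattering f : torus_L1 f -> torus_L1 (f \o scattering).
Proof.
move=> ft; have [fp _ _] := ft.
by have [] := torus_L1_comp (@measurable_scattering R) (@ge0_integral_scattering R)
  (biperiodic_scattering fp) ft.
Qed.

Lemma bdry_int_scattering f : torus_L1 f -> bdry_int (f \o scattering) = bdry_int f.
Proof.
move=> ft; have [fp _ _] := ft.
by have [] := torus_L1_comp (@measurable_scattering R) (@ge0_integral_scattering R)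
  (biperiodic_scattering fp) ft.
Qed.

Lemma torus_L1_half_turn f : torus_L1 f -> torus_L1 (f \o half_turn).
Proof.
move=> ft; have [fp _ _] := ft.
by have [] := torus_L1_comp (@measurable_half_turn R) (@ge0_integral_half_turn R)
  (biperiodic_half_turn fp) ft.
Qed.

Lemma bdry_int_half_turn f : torus_L1 f -> bdry_int (f \o half_turn) = bdry_int f.
Proof.
move=> ft; have [fp _ _] := ft.
by have [] := torus_L1_comp (@measurable_half_turn R) (@ge0_integral_half_turn R)
  (biperiodic_half_turn fp) ft.
Qed.

Definition fiber f (b : R) : R -> R := fun a => f (b, a).

Lemma measurable_fiber f b : measurable_fun setT f -> measurable_fun setT (fiber f b).
Proof. by move=> fm; apply: measurableT_comp => //; exact: measurable_pair1. Qed.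

Lemma measurable_fiber_integral (F : R * R -> \bar R) : measurable_fun setT F ->
  measurable_fun setT (fun b => \int[mu]_(a in fiber_cell) F (b, a))%E.
Proof.
move=> mF.
pose D : set (R * R) := setT `*` fiber_cell.
have mD : measurable (D : set (measurableTypeR R * measurableTypeR R)).
  by apply: measurableX => //; exact: measurable_fiber_cell.
have pD b a : (F \_ D) (b, a) = ((fun a => F (b, a)) \_ fiber_cell) a.
  rewrite !patchE /D.
  suff -> : ((b, a) \in [set: R] `*` fiber_cell) = (a \in (fiber_cell : set R)) by [].
  by apply/idP/idP; rewrite !inE => // -[].
rewrite [X in measurable_fun _ X](_ : _ = fun b =>
    (\int[mu]_a (F \_ D)^\+%E (b, a) - \int[mu]_a (F \_ D)^\-%E (b, a))%E); last first.
  apply/funext => b; rewrite integral_mkcond integralE.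
  by congr (_ - _)%E; apply: eq_integral => a _; rewrite ?funeposE ?funenegE pD.
have mFD : measurable_fun setT (F \_ D).
  by apply/(measurable_restrictT _ _).1 => //; exact: measurable_funTS.
apply: emeasurable_funB.
- by apply: measurable_fun_fubini_tonelli_F => //; exact: measurable_funepos.
- by apply: measurable_fun_fubini_tonelli_F => //; exact: measurable_funeneg.
Qed.

Lemma measurable_fiber_Rintegral f : measurable_fun setT f ->
  measurable_fun setT (fun b => \int[mu]_(a in fiber_cell) f (b, a))%R.
Proof.
move=> fm; apply: (@measurableT_comp _ _ _ _ _ _ (@fine R)) => //.
by apply: (@measurable_fiber_integral (EFin \o f)); exact/measurable_EFinP.
Qed.

Lemma integrable_patch f : torus_L1 f -> leb2.-integrable setT ((EFin \o f) \_ bdry).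
Proof. by move=> [_ _ fi]; apply/(integrable_mkcond _ mb).1. Qed.

Lemma ae_fiber f : torus_L1 f ->
  {ae mu, forall b, circle_cell b -> mu.-integrable fiber_cell (EFin \o fiber f b)}.
Proof.
move=> ft; have := ae_integrable1 (integrable_patch ft).
apply: ae_sub.
move=> b h cb; apply/(integrable_mkcond _ (@measurable_fiber_cell R)).2.
apply: eq_integrable h => // a _.
by rewrite patch_bdry mem_set.
Qed.

Lemma bdry_int_fubini f : torus_L1 f ->
  bdry_int f = (\int[mu]_(b in circle_cell) \int[mu]_(a in fiber_cell) f (b, a))%R.
Proof.
move=> ft; have ip := integrable_patch ft; have [_ fm _] := ft.
rewrite /bdry_int /Rintegral integral_mkcond -integral12_prod_meas1//; congr fine.
rewrite [RHS]integral_mkcond.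
have E b : fubini_F mu ((EFin \o f) \_ bdry) b =
    ((fun b => \int[mu]_(a in fiber_cell) (f (b, a))%:E) \_ circle_cell)%E b.
  rewrite /fubini_F patchE; under eq_integral do rewrite patch_bdry.
  case: ifP => _; last by rewrite integral0.
  by rewrite [RHS]integral_mkcond.
apply: ae_eq_integral => //.
- exact: (measurable_fubini_F ip).
- apply/(measurable_restrictT _ _).1; first exact: measurable_circle_cell.
  apply: measurable_funTS; apply/measurable_EFinP.
  exact: (measurable_fiber_Rintegral fm).
(* The two outer integrands agree only over the almost all b with integrable fiber: elsewhere [fine]
   may replace an infinite inner integral by 0. *)
- have := ae_fiber ft.
  apply: ae_sub.
  move=> b h _; apply: etrans (E b) _; rewrite !patchE; case: ifPn => // /set_mem cb.
  rewrite fineK//; apply: integrable_fin_num; first exact: measurable_fiber_cell.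
  exact: h.
Qed.

Lemma integrable_fiber_Rintegral f : torus_L1 f ->
  mu.-integrable circle_cell
    (EFin \o (fun b => \int[mu]_(a in fiber_cell) f (b, a))%R).
Proof.
move=> [_ fm fi]; have /integrableP[_ fi'] := fi.
have fmE : measurable_fun setT (EFin \o f) by exact/measurable_EFinP.
have fmA : measurable_fun setT (fun x => `|(f x)%:E|%E) by exact: measurableT_comp.
have fmR := measurable_fiber_Rintegral fm.
apply/integrableP; split; first by apply: measurable_funTS; exact/measurable_EFinP.
apply: le_lt_trans fi'; rewrite tonelli12//.
apply: ge0_le_integral => //.
- exact: measurable_circle_cell.
- apply: measurable_funTS; apply: measurableT_comp => //; exact/measurable_EFinP.
- by apply: measurable_funTS; exact: (measurable_fiber_integral fmA).
move=> b _ /=.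
have fmb : measurable_fun fiber_cell (fun a => (f (b, a))%:E).
  by apply: measurable_funTS; apply/measurable_EFinP; exact: measurable_fiber.
apply: le_trans (le_abse_integral mu (@measurable_fiber_cell R) fmb).
suff key (z : \bar R) : (`|fine z|%:E <= `|z|)%E by exact: key.
by case: z => [r| |] /=; rewrite ?normr0 ?leey ?lexx.
Qed.

Lemma bdry_int_ae_fiber f g : torus_L1 f -> torus_L1 g ->
  {ae mu, forall b, circle_cell b ->
    (\int[mu]_(a in fiber_cell) f (b, a) = \int[mu]_(a in fiber_cell) g (b, a))%R} ->
  bdry_int f = bdry_int g.
Proof.
move=> ft gt fg; have [_ fm _] := ft; have [_ gm _] := gt.
rewrite !bdry_int_fubini// {1 3}/Rintegral; congr fine.
apply: ae_eq_integral.
- exact: measurable_circle_cell.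
- apply: measurable_funTS; apply/measurable_EFinP; exact: measurable_fiber_Rintegral.
- apply: measurable_funTS; apply/measurable_EFinP; exact: measurable_fiber_Rintegral.
- apply: ae_sub fg.
  by move=> b h cb; rewrite h.
Qed.

End torus_integrable.

(** * Fourier coefficients on the torus and on fibers *)

Section characters.
Context {R : realType}.
Local Notation mu := (@lebesgue_measure R).
Local Notation leb2 := (@leb2 R).
Local Notation bdry := (@bdry R).
Implicit Types (x : R * R) (f g h : R * R -> R) (p q : int) (s t : R).

Let mb := @measurable_bdry R.
Let mf := @measurable_fiber_cell R.
Let mc := @measurable_circle_cell R.

Definition null_bdry f := {ae leb2, forall x, bdry x -> f x = 0}.

(** The L^1 norm is invariant under the changes of variables above. This carries null sets along
    them although the maps leave the fundamental domain. *)
Lemma null_bdryP f : torus_L1 f ->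
  null_bdry f <-> (\int[leb2]_(x in bdry) `|(f x)%:E| = 0)%E.
Proof.
move=> [_ fm _].
have fmE : measurable_fun bdry (EFin \o f).
  by apply: measurable_funTS; exact/measurable_EFinP.
have := ae_eq_integral_abs leb2 mb fmE; rewrite /= => h.
split => [n|/h n]; first by apply/h; apply: ae_sub n => x fx /fx /= ->.
by apply: ae_sub n => x fx /fx /= [].
Qed.

Lemma null_bdry_scattering f : torus_L1 f -> null_bdry f -> null_bdry (f \o scattering).
Proof.
move=> ft; have [fp fm _] := ft; move=> /(null_bdryP ft) f0.
apply/(null_bdryP (torus_L1_scattering ft)); rewrite -[RHS]f0.
apply: (@ge0_integral_scattering R (fun x => `|(f x)%:E|%E)) => //.
- by apply: measurableT_comp => //; exact/measurable_EFinP.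
- by move=> b a; rewrite (fp b a).1 (fp b a).2.
Qed.

Lemma null_bdry_half_turn f : torus_L1 f -> null_bdry f -> null_bdry (f \o half_turn).
Proof.
move=> ft; have [fp fm _] := ft; move=> /(null_bdryP ft) f0.
apply/(null_bdryP (torus_L1_half_turn ft)); rewrite -[RHS]f0.
apply: (@ge0_integral_half_turn R (fun x => `|(f x)%:E|%E)) => //.
- by apply: measurableT_comp => //; exact/measurable_EFinP.
- by move=> b a; rewrite (fp b a).1 (fp b a).2.
Qed.

Lemma null_bdry_fiber f : torus_L1 f -> null_bdry f <->
  {ae mu, forall b, circle_cell b -> {ae mu, forall a, fiber_cell a -> f (b, a) = 0}}.
Proof.
move=> ft; have [_ fm _] := ft.
have fmE : measurable_fun setT (EFin \o f) by exact/measurable_EFinP.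
have fmA : measurable_fun setT (fun x => `|(f x)%:E|%E) by exact: measurableT_comp.
rewrite null_bdryP// tonelli12//.
have fiberP b : (\int[mu]_(a in fiber_cell) `|(f (b, a))%:E| = 0)%E <->
    {ae mu, forall a, fiber_cell a -> f (b, a) = 0}.
  have fmb : measurable_fun fiber_cell (EFin \o fiber f b).
    by apply: measurable_funTS; apply/measurable_EFinP; exact: measurable_fiber.
  have := ae_eq_integral_abs mu mf fmb; rewrite /= /fiber => h.
  split => [/h n|n]; first by apply: ae_sub n => x fx /fx /= [].
  by apply/h; apply: ae_sub n => x fx /fx /= ->.
have Fm : measurable_fun circle_cell (fun b => \int[mu]_(a in fiber_cell) `|(f (b,
  a))%:E|)%E.
  by apply: measurable_funTS; exact: (measurable_fiber_integral fmA).
have h := ae_eq_integral_abs mu mc Fm.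
have F0 b : (0 <= \int[mu]_(a in fiber_cell) `|(f (b, a))%:E|)%E by exact: integral_ge0.
under eq_integral do rewrite -(gee0_abs (F0 _)).
split => [/h n|n].
  by apply: ae_sub n => b fb /fb /= /fiberP.
by apply/h; apply: ae_sub n => b fb /fb /= /fiberP.
Qed.

Definition wave p q t x : R := cos (p%:~R * x.1 + q%:~R * x.2 + t).

Lemma cos_shift_int s (m : int) : cos (s + 2 * pi * m%:~R) = cos s.
Proof. by rewrite (periodic_int (@cos_periodic R)). Qed.

Lemma biperiodic_wave p q t : biperiodic (wave p q t).
Proof.
move=> b a; rewrite /wave/=; split.
  by rewrite -[RHS](cos_shift_int _ p); congr cos; ring.
by rewrite -[RHS](cos_shift_int _ q); congr cos; ring.
Qed.

Lemma measurable_wave p q t : measurable_fun setT (wave p q t).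
Proof.
apply: (@measurableT_comp _ _ _ _ _ _ (@cos R)).
  by apply: continuous_measurable_fun; exact: continuous_cos.
apply: measurable_funD => //; apply: measurable_funD; exact: measurable_funM.
Qed.

Lemma torus_L1_wave p q t f : torus_L1 f -> torus_L1 (fun x => wave p q t x * f x).
Proof.
apply: (@torus_L1M _ 1); [exact: biperiodic_wave|exact: measurable_wave|].
by move=> x; exact: cos_max.
Qed.

Definition torus_cc f p q t : R := bdry_int (fun x => wave p q t x * f x).

Definition fiber_cc f b q t : R := circle_cc (- (pi / 2)) (fiber f b) q t.

Lemma fiber_wave f p q t b :
  (\int[mu]_(a in fiber_cell) (wave p q t (b, a) * f (b, a)))%R =
  fiber_cc f b q (p%:~R * b + t).
Proof.
rewrite /fiber_cc /circle_cc -fiber_cellE; apply: eq_Rintegral => a _.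
by rewrite /wave /fiber/=; congr (cos _ * _); ring.
Qed.

(** Integrating over b against frequency p only adds p b to the phase, and the fiberwise identity
    holds for every phase s. Used with k = 0 to kill a frequency, and with k = 1, u = pi / 2 for the
    Hilbert transform. *)
Lemma torus_cc_ae k u f g q : torus_L1 f -> torus_L1 g ->
  {ae mu, forall b, circle_cell b ->
    forall s, fiber_cc f b q s = k * fiber_cc g b q (s + u)} ->
  forall p t, torus_cc f p q t = k * torus_cc g p q (t + u).
Proof.
move=> ft gt fg p t; rewrite /torus_cc -bdry_intZ; last exact: torus_L1_wave.
apply: bdry_int_ae_fiber; [exact: torus_L1_wave|by apply: torus_L1Z; exact: torus_L1_wave|].
apply: ae_sub (ae_and fg (ae_fiber (torus_L1_wave p q (t + u) gt))) => b [e i] cb.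
rewrite RintegralZl ?fiber_wave ?e//; last exact: i.
by rewrite addrA.
Qed.

Lemma fiber_cc_eq0 f : torus_L1 f -> null_bdry f ->
  {ae mu, forall b, circle_cell b -> forall q s, fiber_cc f b q s = 0}.
Proof.
move=> ft /(null_bdry_fiber ft); have [_ fm _] := ft.
apply: ae_sub => b + /[dup] cb => /[apply] f0 q s.
rewrite /fiber_cc /circle_cc -fiber_cellE /Rintegral.
rewrite (@ae_eq_integral _ _ _ mu fiber_cell (cst 0%E)) ?integral0//.
- apply: measurable_funTS; apply/measurable_EFinP; apply: measurable_funM.
    exact: measurable_cosMD.
  exact: measurable_fiber.
- by apply: ae_sub f0 => a h /h e /=; rewrite /fiber e mulr0.
Qed.

Lemma fiber_ccD f g b q s : mu.-integrable fiber_cell (EFin \o fiber f b) ->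
  mu.-integrable fiber_cell (EFin \o fiber g b) ->
  fiber_cc (fun x => f x + g x) b q s = fiber_cc f b q s + fiber_cc g b q s.
Proof.
rewrite /fiber_cc /circle_cc fiber_cellE => fi gi.
rewrite -RintegralD//; [|exact: measurable_cell|exact: integrable_cosM..].
by apply: eq_Rintegral => a _; rewrite /fiber mulrDr.
Qed.

Lemma fiber_ccZ k f b q s : mu.-integrable fiber_cell (EFin \o fiber f b) ->
  fiber_cc (fun x => k * f x) b q s = k * fiber_cc f b q s.
Proof.
rewrite /fiber_cc /circle_cc fiber_cellE => fi.
rewrite -RintegralZl//; [|exact: measurable_cell|exact: integrable_cosM..].
by apply: eq_Rintegral => a _; rewrite /fiber mulrCA.
Qed.

Lemma fiber_cc_ae_eq f g : torus_L1 f -> torus_L1 g -> null_bdry (fun x => f x - g x) ->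
  {ae mu, forall b, circle_cell b -> forall q s, fiber_cc f b q s = fiber_cc g b q s}.
Proof.
move=> ft gt; have gt' := torus_L1Z (-1) gt.
have e : (fun x => f x - g x) = (fun x => f x + -1 * g x).
  by apply/funext => x; rewrite mulN1r.
rewrite e => /(fiber_cc_eq0 (torus_L1D ft gt')) h.
apply: ae_sub (ae_and h (ae_and (ae_fiber ft) (ae_fiber gt))) => b [h1 [h2 h3]] cb q s.
have := h1 cb q s; rewrite fiber_ccD; [|exact: h2|apply: integrableZlR;
  [exact: mf|exact: h3]].
by rewrite fiber_ccZ ?mulN1r; [move=> /eqP; rewrite subr_eq0 => /eqP|exact: h3].
Qed.

(** Two phases determine all others. This replaces an uncountable family of almost everywhere
    statements by two. *)
Lemma circle_cc_phase c (F : R -> R) q s : mu.-integrable (cell c) (EFin \o F) ->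
  circle_cc c F q s = cos s * circle_cc c F q 0 + sin s * circle_cc c F q (pi / 2).
Proof.
move=> Fi; rewrite /circle_cc -!RintegralZl; try exact: measurable_cell;
  try exact: integrable_cosM.
rewrite -RintegralD; try exact: measurable_cell; last 2 first.
- by apply: integrableZlR; [exact: measurable_cell|exact: integrable_cosM].
- by apply: integrableZlR; [exact: measurable_cell|exact: integrable_cosM].
by apply: eq_Rintegral => a _; rewrite !cosD cos0 sin0 cos_pihalf sin_pihalf; ring.
Qed.

Lemma circle_cc_phase_eq0 c (F : R -> R) : mu.-integrable (cell c) (EFin \o F) ->
  (forall q, circle_cc c F q 0 = 0 /\ circle_cc c F q (pi / 2) = 0) ->
    forall q s, circle_cc c F q s = 0.
Proof. by move=> Fi h q s; rewrite circle_cc_phase// (h q).1 (h q).2 !mulr0 addr0. Qed.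

Lemma ae_forall_int (P : int -> R -> Prop) :
  (forall q, {ae mu, forall b, P q b}) -> {ae mu, forall b, forall q, P q b}.
Proof.
move=> h; pose Q (n : nat) b := if unpickle n is Some q then P q b else True.
have : {ae mu, forall b, forall n, Q n b}.
  apply: ae_foralln => n; rewrite /Q; case: unpickle => [q|]; first exact: h.
  exact: aeW.
by apply: ae_sub => b hb q; have := hb (pickle q); rewrite /Q pickleK.
Qed.

(** As a function of b, the fiber coefficient has circle coefficients that combine the torus modes
    (p, q) and (p, - q), by the product formula for cosines; one-variable uniqueness in b then
    applies. *)
Lemma torus_cc_eq0_fiber_cc f q s : torus_L1 f ->
  (forall p t, torus_cc f p q t = 0) -> (forall p t, torus_cc f p (- q) t = 0) ->
  {ae mu, forall b, circle_cell b -> fiber_cc f b q s = 0}.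
Proof.
move=> ft f0 f0'.
have gt : torus_L1 (fun x => cos (q%:~R * x.2 + s) * f x).
  have := torus_L1_wave 0 q s ft; rewrite /wave.
  rewrite (_ : (fun x => _) = (fun x => cos (q%:~R * x.2 + s) * f x))//.
  by apply/funext => x; rewrite mul0r add0r.
have Z b : (\int[mu]_(a in fiber_cell) (cos (q%:~R * a + s) * f (b, a)))%R =
  fiber_cc f b q s.
  by rewrite /fiber_cc /circle_cc -fiber_cellE.
have Zi := integrable_fiber_Rintegral gt.
have Zf : (fun b => \int[mu]_(a in fiber_cell) (cos (q%:~R * a + s) * f (b, a)))%R =
    fun b => fiber_cc f b q s by apply/funext => b; exact: Z.
rewrite /= Zf in Zi.
rewrite circle_cellE; apply: circle_cc_uniqueness; first by rewrite -circle_cellE.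
move=> p t; rewrite /circle_cc -circle_cellE.
have ht : torus_L1 (fun x => wave p 0 t x * (cos (q%:~R * x.2 + s) * f x))
  by exact: torus_L1_wave.
transitivity (bdry_int (fun x => wave p 0 t x * (cos (q%:~R * x.2 + s) * f x))).
  rewrite (bdry_int_fubini ht) {1 2}/Rintegral; congr fine.
  apply: ae_eq_integral => //.
  - apply: measurable_funTS; apply/measurable_EFinP; apply: measurable_funM.
      exact: measurable_cosMD.
    by rewrite -Zf; have [_ gm _] := gt; exact: (measurable_fiber_Rintegral gm).
  - apply: measurable_funTS; apply/measurable_EFinP.
    by have [_ hm _] := ht; exact: (measurable_fiber_Rintegral hm).
  - apply: ae_sub (ae_fiber gt) => b gi cb; congr EFin.
    rewrite -Z -RintegralZl//; last exact: gi.
    by apply: eq_Rintegral => a _; rewrite /wave/= mul0r addr0.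
transitivity (bdry_int (fun x => 2^-1 * (wave p q (t + s) x * f x) + 2^-1 * (wave p (- q)
  (t - s) x * f x))).
  congr bdry_int; apply/funext => x.
  rewrite mulrA /wave cos_prod -(cosN (_ - _)) -mulrDr -mulrDl -!mulrA.
  by congr (_ * ((cos _ + cos _) * _)); rewrite ?mulrNz; ring.
rewrite bdry_intD; try (by apply: torus_L1Z; exact: torus_L1_wave).
rewrite !bdry_intZ; try exact: torus_L1_wave.
have := f0 p (t + s); have := f0' p (t - s); rewrite /torus_cc => -> ->.
by rewrite mulr0 addr0.
Qed.

(** One-variable uniqueness is used twice: in b on each fiber coefficient, then in a on almost every
    fiber. *)
Theorem torus_cc_uniqueness f : torus_L1 f -> (forall p q t, torus_cc f p q t = 0) ->
  null_bdry f.
Proof.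
move=> ft f0; apply/null_bdry_fiber => //.
have fq q s : {ae mu, forall b, circle_cell b -> fiber_cc f b q s = 0}.
  by apply: torus_cc_eq0_fiber_cc => // p t.
have := ae_and (ae_fiber ft) (ae_and (ae_forall_int (fq ^~ 0)) (ae_forall_int (fq ^~ (pi
  / 2)))).
apply: ae_sub => b [fi [h1 h2]] cb; rewrite fiber_cellE;
  apply: (@circle_cc_uniqueness _ _ (fiber f b)).
  by rewrite -fiber_cellE; exact: fi.
apply: circle_cc_phase_eq0; first by rewrite -fiber_cellE; exact: fi.
by move=> q; split; [exact: h1|exact: h2].
Qed.

End characters.

(** * The fiberwise Hilbert transform *)

Section trigonometric_sums.
Context {R : realType}.
Local Notation mu := (@lebesgue_measure R).
Implicit Types (c s t : R) (F G : R -> R) (q m : int).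

Lemma integrable_cst_cell c (k : R) : mu.-integrable (cell c) (EFin \o cst k).
Proof.
apply: measurable_bounded_integrable.
- exact: measurable_cell.
- have h : (mu (cell c) < +oo)%E by rewrite lebesgue_cell ltry.
  exact: h.
- exact: measurable_cst.
- exists `|k|; split; first exact: num_real.
  by move=> M kM x _ /=; exact: ltW.
Qed.

Lemma integrable_cos c (u v : R) : mu.-integrable (cell c) (EFin \o (fun a => cos (u * a
  + v))).
Proof.
have := integrable_cosM u v (integrable_cst_cell c 1).
by apply: eq_integrable => [|x _ /=]; rewrite ?mulr1//; exact: measurable_cell.
Qed.

Lemma Rintegral_cos c m t :
  (\int[mu]_(a in cell c) cos (m%:~R * a + t))%R = if m == 0 then 2 * pi * cos t else 0.
Proof.
case: eqVneq => [->|m0].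
  under eq_Rintegral do rewrite mul0r add0r.
  rewrite Rintegral_cst; last exact: measurable_cell.
  have -> : fine (mu (cell c)) = 2 * pi by rewrite lebesgue_cell.
  by rewrite mulrC.
have mR : (m%:~R : R) != 0 by rewrite intr_eq0.
pose J t := (\int[mu]_(a in cell c) cos (m%:~R * a + t))%R.
(* A phase shift by pi changes the sign of J, so equality forces J to vanish. The shift is realized
   by translating a by pi / m. *)
suff : J t = J (t + pi).
  rewrite /J (_ : (fun a => cos (m%:~R * a + (t + pi))) =
    fun a => -1 * cos (m%:~R * a + t)).
    rewrite RintegralZl; [|exact: measurable_cell|exact: integrable_cos].
    by clear; move: (Rintegral _ _ _) => z; lra.
  by apply/funext => a; rewrite addrA cosDpi mulN1r.
(* The translation lemma concerns nonnegative integrands, hence the added 1. *)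
have E u : 1 + cos u >= 0 by have := cos_geN1 u; lra.
have K u : (\int[mu]_(a in cell c) (1 + cos (m%:~R * a + u)))%R = 2 * pi + J u.
  rewrite RintegralD; [|exact: measurable_cell|exact: integrable_cst_cell|exact:
    integrable_cos].
  rewrite Rintegral_cst; last exact: measurable_cell.
  have -> : fine (mu (cell c)) = 2 * pi by rewrite lebesgue_cell.
  by rewrite mul1r.
apply: (@addrI _ (2 * pi)); rewrite -!K.
rewrite /Rintegral; congr fine.
rewrite -(@ge0_integral_cell_shift _ (fun a => (1 + cos (m%:~R * a + t))%:E) c (pi /
  m%:~R)).
- apply: eq_integral => a _; congr ((1 + cos _)%:E).
  by rewrite mulrDr mulrCA divff// mulr1; ring.
- apply/measurable_EFinP; apply: measurable_funD => //; exact: measurable_cosMD.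
- by move=> x; rewrite lee_fin.
- move=> x; congr ((1 + _)%:E); rewrite -[RHS](cos_shift_int _ m); congr cos; ring.
Qed.

(* The shift to k + 1 leaves out the constant mode, which the Hilbert transform kills. *)
Definition harmonic (k : nat) (x y a : R) : R :=
  pi^-1 * (x * cos (k.+1%:~R * a + 0) + y * cos (k.+1%:~R * a + pi / 2)).

Lemma continuous_harmonic k x y : continuous (harmonic k x y).
Proof.
move=> a; apply: cvgM; first exact: cvg_cst.
by apply: cvgD; (apply: cvgM; [exact: cvg_cst|exact: continuous_cosMD]).
Qed.

Lemma pi_neq0 : pi != 0 :> R. Proof. by rewrite gt_eqF// pi_gt0. Qed.

Lemma circle_cc_cos c (k q : nat) s t :
  (\int[mu]_(a in cell c) (cos (q%:~R * a + t) * cos (k.+1%:~R * a + s)))%R =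
  if q == k.+1 then pi * cos (s - t) else 0.
Proof.
under eq_Rintegral => a _.
  rewrite cos_prod.
  rewrite (_ : q%:~R * a + t + _ = (q%:Z + k.+1%:Z)%:~R * a + (t + s));
    last by rewrite intrD; ring.
  rewrite (_ : k.+1%:~R * a + s - _ = (k.+1%:Z - q%:Z)%:~R * a + (s - t));
    last by rewrite intrD mulrNz; ring.
  over.
rewrite RintegralZl; [|exact: measurable_cell|apply: integrableDR;
  [exact: measurable_cell|exact: integrable_cos..]].
rewrite RintegralD; [|exact: measurable_cell|exact: integrable_cos..].
rewrite !Rintegral_cos (_ : (q%:Z + k.+1%:Z == 0) = false); last by apply/eqP; lia.
rewrite add0r (_ : (k.+1%:Z - q%:Z == 0) = (q == k.+1)); last by apply/eqP/eqP; lia.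
by case: eqP => _; rewrite ?mulr0// mulrA mulKf.
Qed.

Lemma integrable_harmonic c k x y : mu.-integrable (cell c) (EFin \o harmonic k x y).
Proof.
apply: integrableZlR; first exact: measurable_cell.
by apply: integrableDR; [exact: measurable_cell|
  apply: integrableZlR; [exact: measurable_cell|exact: integrable_cos]..].
Qed.

Lemma circle_cc_harmonic c k x y (q : nat) t :
  circle_cc c (harmonic k x y) q t = if q == k.+1 then x * cos t + y * sin t else 0.
Proof.
have mc := @measurable_cell R c.
have i1 s : mu.-integrable (cell c) (EFin \o (fun a => cos (q%:~R * a + t) * cos
  (k.+1%:~R * a + s))).
  by apply: integrable_cosM; exact: integrable_cos.
rewrite /circle_cc /harmonic.
under eq_Rintegral => a _.
  rewrite mulrCA mulrDr (mulrCA _ x) (mulrCA _ y). over.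
rewrite RintegralZl//; last by apply: integrableDR => //; exact: integrableZlR.
rewrite RintegralD//; [|exact: integrableZlR..].
rewrite !RintegralZl// !circle_cc_cos; case: eqP => _; last by rewrite !mulr0 addr0 mulr0.
rewrite sub0r cosN (_ : cos (pi / 2 - t) = sin t); last first.
  by rewrite cosB cos_pihalf sin_pihalf mul0r mul1r add0r.
by rewrite !(mulrCA _ pi) -mulrDr mulKf// pi_neq0.
Qed.

Lemma Rintegral_harmonicM c F k x y : mu.-integrable (cell c) (EFin \o F) ->
  (\int[mu]_(a in cell c) (harmonic k x y a * F a))%R =
  pi^-1 * (x * circle_cc c F k.+1 0 + y * circle_cc c F k.+1 (pi / 2)).
Proof.
move=> Fi; have mc := @measurable_cell R c.
rewrite /circle_cc /harmonic.
under eq_Rintegral do rewrite -mulrA mulrDl -(mulrA x) -(mulrA y).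
have i1 s := integrable_cosM k.+1%:~R s Fi.
rewrite RintegralZl//; last by apply: integrableDR => //; exact: integrableZlR.
by rewrite RintegralD//; [rewrite !RintegralZl|exact: integrableZlR..].
Qed.

Definition trig_sum (x y : nat -> R) (M N : nat) (a : R) : R :=
  \sum_(M <= k < N) harmonic k (x k) (y k) a.

Lemma integrable_sumR d (T : measurableType d) (m : {measure set T -> \bar R}) (D : set T)
    (f : nat -> T -> R) (r : seq nat) : measurable D ->
  (forall k, m.-integrable D (EFin \o f k)) ->
  m.-integrable D (EFin \o (fun z => \sum_(k <- r) f k z)).
Proof.
move=> mD fi; elim: r => [|k r ih].
  apply: eq_integrable (integrable0 m D) => // z _.
  by rewrite /= big_nil.
apply: eq_integrable (integrableDR mD (fi k) ih) => // z _.
by rewrite /= big_cons.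
Qed.

Lemma Rintegral_sum d (T : measurableType d) (m : {measure set T -> \bar R}) (D : set T)
    (f : nat -> T -> R) (r : seq nat) : measurable D ->
  (forall k, m.-integrable D (EFin \o f k)) ->
  (\int[m]_(z in D) (\sum_(k <- r) f k z) = \sum_(k <- r) \int[m]_(z in D) f k z)%R.
Proof.
move=> mD fi; elim: r => [|k r ih].
  rewrite big_nil; under eq_Rintegral do rewrite big_nil.
  by rewrite Rintegral_cst// mul0r.
rewrite big_cons; under eq_Rintegral do rewrite big_cons.
by rewrite RintegralD// ?ih//; exact: integrable_sumR.
Qed.

Lemma integrable_trig_sum c x y M N : mu.-integrable (cell c) (EFin \o trig_sum x y M N).
Proof.
apply: integrable_sumR; first exact: measurable_cell.
by move=> k; exact: integrable_harmonic.
Qed.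

Lemma circle_cc_trig_sum c x y M N (q : nat) t :
  circle_cc c (trig_sum x y M N) q t =
  if (0 < q)%N && (M <= q.-1 < N)%N then x q.-1 * cos t + y q.-1 * sin t else 0.
Proof.
have mc := @measurable_cell R c.
rewrite /circle_cc /trig_sum; under eq_Rintegral do rewrite big_distrr/=.
rewrite Rintegral_sum//; last first.
  by move=> k; apply: integrable_cosM; exact: integrable_harmonic.
under eq_bigr => k _ do rewrite -/(circle_cc c (harmonic k (x k) (y k)) q t)
  circle_cc_harmonic.
case: q => [|q]/=; first by rewrite big1.
under eq_bigr => k _ do rewrite eqSS eq_sym.
rewrite -big_mkcond/=.
case: ifPn => h.
  rewrite big_mkcond (bigD1_seq q) ?mem_index_iota ?iota_uniq//= eqxx big1 ?addr0//.
  by move=> k /negbTE ->.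
rewrite big1_seq// => k /andP[/eqP ->]; rewrite mem_index_iota.
by rewrite (negbTE h).
Qed.

Lemma continuous_trig_sum x y M N : continuous (trig_sum x y M N).
Proof.
move=> a; rewrite /trig_sum; elim: (index_iota M N) => [|k r ih].
  rewrite (_ : (fun a => _) = cst 0); first exact: cvg_cst.
  by apply/funext => b; rewrite big_nil.
rewrite (_ : (fun a => _) = harmonic k (x k) (y k) \+ (fun a => \sum_(k <- r) harmonic k
  (x k) (y k) a)).
  by apply: cvgD; [exact: continuous_harmonic|exact: ih].
by apply/funext => b; rewrite big_cons.
Qed.

Lemma trig_sum_bounded x y M N : exists B : R, forall a, `|trig_sum x y M N a| <= B.
Proof.
have hb k u v : exists B : R, forall a, `|harmonic k u v a| <= B.
  exists (pi^-1 * (`|u| + `|v|)) => a;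
    rewrite /harmonic normrM ger0_norm ?invr_ge0 ?pi_ge0//.
  rewrite ler_wpM2l ?invr_ge0 ?pi_ge0// (le_trans (ler_normD _ _))// !normrM lerD//.
    by rewrite ler_piMr// cos_max.
  by rewrite ler_piMr// cos_max.
rewrite /trig_sum; elim: (index_iota M N) => [|k r [B ih]].
  by exists 0 => a; rewrite big_nil normr0.
have [B' h] := hb k (x k) (y k); exists (B' + B) => a; rewrite big_cons.
by rewrite (le_trans (ler_normD _ _))// lerD.
Qed.

Lemma integrable_trig_sumM c F x y M N : mu.-integrable (cell c) (EFin \o F) ->
  mu.-integrable (cell c) (EFin \o (fun a => trig_sum x y M N a * F a)).
Proof.
have [B hB] := trig_sum_bounded x y M N.
apply: (integrable_bndM (@measurable_cell R c) (M := B)) => //.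
apply: measurable_funTS; apply: continuous_measurable_fun; exact: continuous_trig_sum.
Qed.

Lemma Rintegral_trig_sumM c F x y M N : mu.-integrable (cell c) (EFin \o F) ->
  (\int[mu]_(a in cell c) (trig_sum x y M N a * F a))%R =
  \sum_(M <= k < N) pi^-1 * (x k * circle_cc c F k.+1 0 + y k * circle_cc c F k.+1 (pi /
    2)).
Proof.
move=> Fi; have mc := @measurable_cell R c.
under eq_Rintegral do rewrite /trig_sum big_distrl/=.
rewrite Rintegral_sum//; first by apply: eq_bigr => k _; rewrite Rintegral_harmonicM.
move=> k; have := integrable_trig_sumM (fun=> x k) (fun=> y k) k k.+1 Fi.
by apply: eq_integrable => // a _; rewrite /= /trig_sum big_nat1.
Qed.

Lemma Rintegral_trig_sum_sqr c x y M N :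
  (\int[mu]_(a in cell c) (trig_sum x y M N a ^+ 2))%R =
  \sum_(M <= k < N) pi^-1 * (x k ^+ 2 + y k ^+ 2).
Proof.
under eq_Rintegral do rewrite expr2.
rewrite Rintegral_trig_sumM; last exact: integrable_trig_sum.
apply: eq_big_nat => k kI; rewrite !circle_cc_trig_sum/= kI.
by rewrite cos0 sin0 cos_pihalf sin_pihalf !mulr0 !mulr1 addr0 add0r !expr2.
Qed.

(** Expand the integral of (F - T)^2 for the partial sum T: by orthogonality the integrals of T F
    and of T^2 are both the left-hand side. *)
Lemma bessel c F N : mu.-integrable (cell c) (EFin \o F) ->
  mu.-integrable (cell c) (EFin \o (fun a => F a ^+ 2)) ->
  \sum_(0 <= k < N) pi^-1 * (circle_cc c F k.+1 0 ^+ 2 + circle_cc c F k.+1 (pi / 2) ^+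
    2) <=
  (\int[mu]_(a in cell c) (F a ^+ 2))%R.
Proof.
move=> Fi F2i; have mc := @measurable_cell R c.
pose x k := circle_cc c F (k.+1)%N 0; pose y k := circle_cc c F (k.+1)%N (pi / 2).
pose T := trig_sum x y 0 N.
have i2 := integrable_trig_sumM x y 0 N Fi.
have i3 := integrable_trig_sumM x y 0 N (integrable_trig_sum c x y 0 N).
have : 0 <= (\int[mu]_(a in cell c) (F a ^+ 2 + (-2 * (T a * F a) + T a * T a)))%R.
  by apply: Rintegral_ge0 => a _; have := sqr_ge0 (F a - T a); rewrite sqrrB; lra.
have j2 := integrableZlR mc (-2) i2.
rewrite RintegralD//; last exact: integrableDR.
rewrite RintegralD// RintegralZl// !Rintegral_trig_sumM//; last exact: integrable_trig_sum.
set S1 := \sum_(_ <= _ < _) _.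
set S2 := \sum_(_ <= _ < _) _.
have -> : S2 = S1.
  apply: eq_big_nat => k /andP[_ kN]; rewrite !circle_cc_trig_sum/= kN.
  by rewrite cos0 sin0 cos_pihalf sin_pihalf !mulr0 !mulr1 addr0 add0r.
move=> h.
by move: S1 (Rintegral _ _ _) h => z w; clear; lra.
Qed.

End trigonometric_sums.

(** * Choice of the subsequence *)

Section fast_subsequence.
Context {R : realType}.

(** The rate 4^-j leaves room for the factor 2^j lost when [norm_le_sqr] turns an L^2 bound into an
    L^1 bound. *)
Lemma fast_subsequence (u : nat -> R) (V : R) : (forall k, 0 <= u k) ->
  (forall n, \sum_(0 <= k < n) u k <= V) ->
  exists N : nat -> nat, exists C : R, [/\ N 0%N = 0%N,
    forall j, (N j <= N j.+1)%N, forall j, (j <= N j)%N &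
    forall j, \sum_(N j <= k < N j.+1) u k <= C * 4^-1 ^+ j].
Proof.
move=> u0 uV; pose s n := \sum_(0 <= k < n) u k.
have sS m n : (m <= n)%N -> s n = s m + \sum_(m <= k < n) u k.
  by move=> mn; rewrite /s (big_cat_nat (n := m)).
have sh : {homo s : m n / (m <= n)%N >-> m <= n}.
  by move=> m n mn; rewrite (sS m n)// lerDl sumr_ge0.
have sin_cc : cvgn s.
  apply: nondecreasing_is_cvgn => //; exists V => _ [n _ <-]; exact: uV.
have sl n : s n <= limn s by exact: nondecreasing_cvgn_le.
have h j : exists n, limn s - s n < 4^-1 ^+ j.
  have e0 : (0 : R) < 4^-1 ^+ j by rewrite exprn_gt0.
  have /cvgrPdist_lt/(_ _ e0) [n _ hn] := sin_cc.
  by exists n; have := hn n (leqnn n); rewrite /= ger0_norm// subr_ge0.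
have [n hn] := choice h.
(* Cumulative sums make N monotone, with N j >= j and N (j + 1) > n j. *)
pose N j := (\sum_(0 <= i < j) (n i).+1)%N.
have NS j : N j.+1 = (N j + (n j).+1)%N by rewrite /N big_nat_recr.
(* V bounds the block j = 0. For j + 1 the tail beyond n j is below 4^-j, which is 4 times 4^-(j +
   1). *)
exists N, (4 + V); split.
- by rewrite /N big_geq.
- by move=> j; rewrite NS leq_addr.
- by elim=> // j ih; rewrite NS; lia.
move=> j; have -> : \sum_(N j <= k < N j.+1) u k = s (N j.+1) - s (N j).
  by rewrite (sS (N j) (N j.+1)) ?NS ?leq_addr// addrC addKr.
have V0 : 0 <= V by have := uV 0%N; rewrite big_geq.
case: j => [|j].
  rewrite expr0 mulr1.
  have h1 : s (N 1%N) <= V := uV (N 1%N).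
  have h0 : 0 <= s (N 0%N) by rewrite sumr_ge0.
  by move: (s (N 1%N)) (s (N 0%N)) h1 h0 => y z h1 h0; clear -h1 h0; lra.
have h1 : s (n j) <= s (N j.+1) by apply: sh; rewrite NS; lia.
have h2 := hn j; have h3 := sl (N j.+2).
have h4 : 0 <= V * 4^-1 ^+ j by rewrite mulr_ge0// exprn_ge0.
rewrite exprS.
move: (s (n j)) (s _) (s _) (limn s) (4^-1 ^+ j) h1 h2 h3 h4 => a b c d p h1 h2 h3 h4.
by clear -h1 h2 h3 h4; lra.
Qed.

(** An arithmetic-geometric mean bound that takes the place of the Cauchy-Schwarz inequality on a
    domain of finite measure. *)
Lemma norm_le_sqr (r s : R) : 0 < s -> `|r| <= s * r ^+ 2 + s^-1.
Proof.
move=> s0; rewrite -(real_normK (num_real r)); set z := `|r|.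
have := mulr_ge0 (ltW s0) (sqr_ge0 (z - s^-1 / 2)).
rewrite sqrrB mulrDr mulrDr mulrN expr_div_n mulrA (_ : s * (z * (s^-1 / 2) *+ 2) = z);
  last first.
  by rewrite -mulr_natl; field; rewrite gt_eqF.
have : 0 <= s^-1 by rewrite invr_ge0 ltW.
rewrite exprVn expr2 invfM !mulrA divff ?gt_eqF// mul1r.
by lra.
Qed.

End fast_subsequence.

Section square_integrable.
Context {R : realType}.
Local Notation mu := (@lebesgue_measure R).
Local Notation leb2 := (@leb2 R).
Local Notation bdry := (@bdry R).
Implicit Types (f g : R * R -> R).

Let mb := @measurable_bdry R.
Let mf := @measurable_fiber_cell R.
Let mc := @measurable_circle_cell R.

Definition torus_L2 f : Prop :=
  [/\ biperiodic f, measurable_fun setT f &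
      (\int[leb2]_(x in bdry) (f x ^+ 2)%:E < +oo)%E].

Lemma lebesgue_fiber_cell : mu (fiber_cell : set R) = (2 * pi)%:E.
Proof. by rewrite fiber_cellE lebesgue_cell. Qed.

Lemma lebesgue_circle_cell : mu (circle_cell : set R) = (2 * pi)%:E.
Proof. by rewrite circle_cellE lebesgue_cell. Qed.

Lemma leb2_bdry : leb2 bdry = ((2 * pi) * (2 * pi))%:E.
Proof.
rewrite -[leb2 bdry]mul1e -integral_cst; last exact: mb.
rewrite tonelli12//.
transitivity (\int[mu]_(b in circle_cell) (cst (2 * pi)%:E b))%E.
  apply: eq_integral => b _; rewrite integral_cst ?mul1e//.
  exact: lebesgue_fiber_cell.
rewrite integral_cst; last exact: mc.
by rewrite [RHS]EFinM; congr (_ * _)%E; exact: lebesgue_circle_cell.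
Qed.

Lemma integrable_bdry_cst (k : R) : leb2.-integrable bdry (EFin \o cst k).
Proof.
apply: measurable_bounded_integrable.
- exact: mb.
- have h : (leb2 bdry < +oo)%E by rewrite leb2_bdry ltry.
  exact: h.
- exact: measurable_cst.
- exists `|k|; split; first exact: num_real.
  by move=> M kM x _ /=; exact: ltW.
Qed.

Lemma torus_L2_sqr_L1 f : torus_L2 f -> torus_L1 (fun x => f x ^+ 2).
Proof.
move=> [fp fm fi]; split.
- by move=> b a; rewrite (fp b a).1 (fp b a).2.
- exact: measurable_funX.
- apply/integrableP; split.
    by apply: measurable_funTS; apply/measurable_EFinP; exact: measurable_funX.
  under eq_integral do rewrite /= ger0_norm ?sqr_ge0//.
  exact: fi.
Qed.

Lemma torus_L2_L1 f : torus_L2 f -> torus_L1 f.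
Proof.
move=> fs; have [fp fm _] := fs; have [_ _ fi] := torus_L2_sqr_L1 fs; split => //.
have := integrableDR mb fi (integrable_bdry_cst 1).
apply: le_integrable; first exact: mb.
  by apply: measurable_funTS; exact/measurable_EFinP.
move=> x _ /=; rewrite lee_fin [leRHS]ger0_norm ?addr_ge0 ?sqr_ge0//.
have := sqr_ge0 (`|f x| - 1); have := sqr_ge0 (`|f x|).
by rewrite sqrrB real_normK ?num_real//; lra.
Qed.

Lemma torus_L2_le f g k : biperiodic f -> measurable_fun setT f -> torus_L1 g ->
  (forall x, f x ^+ 2 <= k * g x) -> torus_L2 f.
Proof.
move=> fp fm gt fg; split => //.
have [_ _ gi] := torus_L1Z k gt.
apply: le_lt_trans (integrable_lty mb gi).
apply: ge0_le_integral; first exact: mb.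
- by move=> x _; rewrite lee_fin sqr_ge0.
- by apply: measurable_funTS; apply/measurable_EFinP; exact: measurable_funX.
- by apply: measurable_int gi.
- by move=> x _; rewrite /= lee_fin.
Qed.

Lemma torus_L2D f g : torus_L2 f -> torus_L2 g -> torus_L2 (fun x => f x + g x).
Proof.
move=> fs gs; have [fp fm _] := fs; have [gp gm _] := gs.
apply: (@torus_L2_le _ (fun x => f x ^+ 2 + g x ^+ 2) 2).
- by move=> b a; rewrite !(fp b a).1 !(fp b a).2 !(gp b a).1 !(gp b a).2.
- exact: measurable_funD.
- by apply: torus_L1D; exact: torus_L2_sqr_L1.
- by move=> x; have := sqr_ge0 (f x - g x); rewrite sqrrB sqrrD; lra.
Qed.

Lemma torus_L2Z k f : torus_L2 f -> torus_L2 (fun x => k * f x).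
Proof.
move=> fs; have [fp fm _] := fs.
apply: (@torus_L2_le _ (fun x => f x ^+ 2) (k ^+ 2)).
- by move=> b a; rewrite !(fp b a).1 !(fp b a).2.
- exact: measurable_funM.
- exact: torus_L2_sqr_L1.
- by move=> x; rewrite exprMn.
Qed.

Lemma torus_L2_scattering f : torus_L2 f -> torus_L2 (f \o scattering).
Proof.
move=> fs; have [fp fm fi] := fs; split.
- exact: biperiodic_scattering.
- by apply: (measurableT_comp fm); exact: measurable_scattering.
- rewrite (@ge0_integral_scattering _ (fun x => (f x ^+ 2)%:E))//.
  + by apply/measurable_EFinP; exact: measurable_funX.
  + by move=> x; rewrite lee_fin sqr_ge0.
  + by move=> b a; rewrite (fp b a).1 (fp b a).2.
Qed.

End square_integrable.

Section hilbert_transform.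
Context {R : realType}.
Local Notation mu := (@lebesgue_measure R).
Local Notation leb2 := (@leb2 R).
Local Notation bdry := (@bdry R).
Implicit Types (f g : R * R -> R) (q : int) (s t b : R).
Variable v : R * R -> R.
Hypothesis vs : torus_L2 v.

Let mb := @measurable_bdry R.
Let mf := @measurable_fiber_cell R.
Let mc := @measurable_circle_cell R.
Let vt := torus_L2_L1 vs.
Let V := fine (\int[leb2]_(z in bdry) (v z ^+ 2)%:E).

(** The coefficients of the conjugate series: the transform of v has at phase s the coefficient of v
    at s + pi / 2, so phase 0 reads pi / 2, and phase pi / 2 reads pi, whence the minus sign in
    [y]. *)
Let x (b : R) (k : nat) := fiber_cc v b k.+1 (pi / 2).
Let y (b : R) (k : nat) := - fiber_cc v b k.+1 0.
Let H (M N : nat) (z : R * R) : R := trig_sum (x z.1) (y z.1) M N z.2.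

Lemma measurable_fiber_cc f q s : measurable_fun setT f ->
  measurable_fun setT (fun b : R => fiber_cc f b q s).
Proof.
move=> fm.
rewrite (_ : (fun b => _) = fun b => \int[mu]_(a in fiber_cell) (wave 0 q s (b, a) * f
  (b, a)))%R.
  apply: (@measurable_fiber_Rintegral _ (fun z => wave 0 q s z * f z)).
  by apply: measurable_funM => //; exact: measurable_wave.
by apply/funext => b; rewrite fiber_wave mul0r add0r.
Qed.

Lemma per_fiber_cc f q s b : biperiodic f -> fiber_cc f (b + 2 * pi) q s = fiber_cc f b q s.
Proof.
move=> fp; rewrite /fiber_cc (_ : fiber f (b + 2 * pi) = fiber f b)//.
by apply/funext => a; exact: (fp b a).1.
Qed.

Let biperiodic_H M N : biperiodic (H M N).
Proof.
have [vp _ _] := vt; move=> b a; rewrite /H /=; split.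
  congr (trig_sum _ _ _ _ _); apply/funext => k; rewrite /x /y per_fiber_cc//.
rewrite /trig_sum; apply: eq_bigr => k _; rewrite /harmonic.
have e s : cos (k.+1%:~R * (a + 2 * pi) + s) = cos (k.+1%:~R * a + s).
  by rewrite -[RHS](cos_shift_int _ k.+1); congr cos; ring.
by rewrite !e.
Qed.

Let measurable_H M N : measurable_fun setT (H M N).
Proof.
have [_ vm _] := vt.
apply: measurable_sum => k; rewrite /harmonic; apply: measurable_funM => //.
have ms s : measurable_fun setT (fun z : R * R => cos (k.+1%:~R * z.2 + s)).
  by apply: (measurableT_comp (measurable_cosMD _ _)).
have mx q s : measurable_fun setT (fun z : R * R => fiber_cc v z.1 q s).
  by apply: (@measurableT_comp _ _ _ _ _ _ (fun b => fiber_cc v b q s)) => //;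
    exact: measurable_fiber_cc.
apply: measurable_funD; apply: measurable_funM => //; first exact: mx.
by apply: measurable_funN; exact: mx.
Qed.

(** By orthogonality, the squared norm of the k-th term of the conjugate series on the fiber over
    b. *)
Let c (k : nat) (b : R) : R := pi^-1 * (x b k ^+ 2 + y b k ^+ 2).
Let c0 k b : 0 <= c k b.
Proof. by rewrite mulr_ge0 ?invr_ge0 ?pi_ge0// addr_ge0// sqr_ge0. Qed.

Let measurable_c k : measurable_fun setT (c k).
Proof.
have [_ vm _] := vt.
apply: measurable_funM => //; apply: measurable_funD; apply: measurable_funX.
  exact: measurable_fiber_cc.
by apply: measurable_funN; exact: measurable_fiber_cc.
Qed.

Let C k : \bar R := (\int[mu]_(b in circle_cell) (c k b)%:E)%E.

Let integral_H_fiber M N b :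
  (\int[mu]_(a in fiber_cell) (H M N (b, a) ^+ 2)%:E = (\sum_(M <= k < N) c k b)%:E)%E.
Proof.
rewrite /H /= -(@Rintegral_trig_sum_sqr _ (- (pi / 2))) -fiber_cellE fineK//.
apply: integrable_fin_num; first exact: mf.
rewrite fiber_cellE; have := integrable_trig_sumM (x b) (y b) M N
  (integrable_trig_sum (- (pi / 2)) (x b) (y b) M N).
by apply: eq_integrable => [|a _ /=]; [exact: measurable_cell|rewrite expr2].
Qed.

Let integral_H M N :
  (\int[leb2]_(z in bdry) (H M N z ^+ 2)%:E = \sum_(M <= k < N) C k)%E.
Proof.
rewrite tonelli12; first last.
- by move=> z; rewrite lee_fin sqr_ge0.
- by apply/measurable_EFinP; exact: measurable_funX.
under eq_integral do rewrite integral_H_fiber.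
under eq_integral do rewrite -sumEFin.
rewrite ge0_integral_sum//.
- by move=> k; apply: measurable_funTS; apply/measurable_EFinP; exact: measurable_c.
- by move=> k b _; rewrite lee_fin.
Qed.

Let V_fin : (\int[leb2]_(z in bdry) (v z ^+ 2)%:E)%E = V%:E.
Proof.
have [_ _ v2] := vs; rewrite fineK// ge0_fin_numE//.
by apply: integral_ge0 => z _; rewrite lee_fin sqr_ge0.
Qed.

(** Conjugation only permutes the two phases up to sign, so Bessel's inequality for v on almost
    every fiber bounds the conjugate sums as well. *)
Let bessel2 N : (\sum_(0 <= k < N) C k <= V%:E)%E.
Proof.
rewrite -integral_H tonelli12; first last.
- by move=> z; rewrite lee_fin sqr_ge0.
- by apply/measurable_EFinP; exact: measurable_funX.
have [_ vm _] := vs.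
have v2m : measurable_fun setT (fun z => (v z ^+ 2)%:E).
  by apply/measurable_EFinP; exact: measurable_funX.
have v20 z : (0 <= (v z ^+ 2)%:E)%E by rewrite lee_fin sqr_ge0.
rewrite -V_fin tonelli12//.
under eq_integral do rewrite integral_H_fiber.
apply: ae_ge0_le_integral.
- exact: mc.
- by move=> b _; rewrite lee_fin sumr_ge0.
- apply: measurable_funTS; apply/measurable_EFinP; exact: measurable_sum.
- by move=> b _; exact: integral_ge0.
- by apply: measurable_funTS; exact: (measurable_fiber_integral v2m).
apply: ae_sub (ae_and (ae_fiber vt) (ae_fiber (torus_L2_sqr_L1 vs))) => b [i1 i2] cb.
have := @bessel _ (- (pi / 2)) (fiber v b) N; rewrite -fiber_cellE.
move=> /(_ (i1 cb) (i2 cb)) h.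
have fin : (\int[mu]_(a in fiber_cell) (v (b, a) ^+ 2)%:E)%E \is a fin_num.
  by apply: integrable_fin_num; [exact: mf|exact: i2].
rewrite -(fineK fin) lee_fin; apply: le_trans h.
by apply: ler_sum => k _; rewrite /c /x /y /fiber_cc sqrrN addrC.
Qed.

Let C0 k : (0 <= C k)%E.
Proof. by apply: integral_ge0 => b _; rewrite lee_fin. Qed.

Let C_fin k : C k = (fine (C k))%:E.
Proof.
rewrite fineK// ge0_fin_numE//; apply: (@le_lt_trans _ _ V%:E); last exact: ltry.
apply: le_trans (bessel2 k.+1); rewrite big_nat_recr//=.
by rewrite leeDr// sume_ge0.
Qed.

Let sum_C M N : (\sum_(M <= k < N) C k = (\sum_(M <= k < N) fine (C k))%:E)%E.
Proof. by rewrite -sumEFin; apply: eq_bigr => k _; exact: C_fin. Qed.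

Let subseq : exists N : nat -> nat, exists K : R, [/\ N 0%N = 0%N,
    forall j, (N j <= N j.+1)%N, forall j, (j <= N j)%N &
    forall j, (\int[leb2]_(z in bdry) (H (N j) (N j.+1) z ^+ 2)%:E <= (K * 4^-1 ^+
      j)%:E)%E].
Proof.
have u0 k : 0 <= fine (C k) by exact: fine_ge0.
have uV n : \sum_(0 <= k < n) fine (C k) <= V by rewrite -lee_fin -sum_C.
have [N [K [h1 h2 h3 h4]]] := fast_subsequence u0 uV.
exists N, K; split => // j; rewrite integral_H sum_C lee_fin; exact: h4.
Qed.

Let H_recr M N P z : (M <= N)%N -> (N <= P)%N -> H M P z = H M N z + H N P z.
Proof. by move=> MN NP; rewrite /H /trig_sum (big_cat_nat (n := N)). Qed.

Theorem hilbert_transform_exists : exists g, torus_L2 g /\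
  {ae mu, forall b, circle_cell b -> forall (q : nat) s,
    fiber_cc g b q s = if q == 0%N then 0 else fiber_cc v b q (s + pi / 2)}.
Proof.
have [N [K [N0 NS Nj HK]]] := subseq.
pose Del j := H (N j) (N j.+1).
have sumD n z : \sum_(0 <= j < n) Del j z = H 0 (N n) z.
  elim: n => [|n ih]; first by rewrite big_geq// N0 /H /trig_sum big_geq.
  by rewrite big_nat_recr//= ih -H_recr//; exact: NS.
pose W : R := (2 * pi) * (2 * pi).
have DelM j : measurable_fun setT (Del j) := measurable_H (N j) (N j.+1).
have DelE j : measurable_fun bdry (fun z => (Del j z ^+ 2)%:E).
  by apply: measurable_funTS; apply/measurable_EFinP; exact: measurable_funX.
have mDel j : measurable_fun setT (fun z => `|Del j z|%:E).
  by apply/measurable_EFinP; exact: measurableT_comp.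
(* With s = 2^j in [norm_le_sqr], the energy bound K 4^-j and the constant 2^-j over a torus of area
   W both contribute multiples of 2^-j. *)
have dL1 j : (\int[leb2]_(z in bdry) `|Del j z|%:E <= ((K + W) * 2^-1 ^+ j)%:E)%E.
  have p0 : (0 : R) < 2 ^+ j by rewrite exprn_gt0.
  apply: (@le_trans _ _ (\int[leb2]_(z in bdry) ((2 ^+ j)%:E * (Del j z ^+ 2)%:E + (2 ^-
    j)%:E)))%E.
    apply: ge0_le_integral; first exact: mb.
    - by move=> z _; rewrite lee_fin.
    - by apply: measurable_funTS; exact: mDel.
    - apply: emeasurable_funD; [apply: measurable_funeM; exact: DelE|exact: measurable_cst].
    - by move=> z _; rewrite -EFinM -EFinD lee_fin norm_le_sqr.
  rewrite ge0_integralD; [|exact: mb| | | |exact: measurable_cst]; last 3 first.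
  - by move=> z _; rewrite -EFinM lee_fin mulr_ge0 ?sqr_ge0// ltW.
  - by apply: measurable_funeM; exact: DelE.
  - by move=> z _; rewrite lee_fin invr_ge0 ltW.
  rewrite ge0_integralZl_EFin; [|exact: mb| |exact: DelE|exact: ltW]; last first.
  - by move=> z _; rewrite lee_fin sqr_ge0.
  have -> : (\int[leb2]_(z in bdry) (2 ^- j)%:E = (2 ^- j)%:E * W%:E)%E.
    rewrite -[X in (_ = _ * X)%E](@leb2_bdry R) -integral_cst//; exact: mb.
  apply: le_trans (leeD2r _ (lee_wpmul2l _ (HK j))) _; first by rewrite lee_fin ltW.
  rewrite -!EFinM -EFinD lee_fin.
  rewrite (_ : 4^-1 = 2^-1 * 2^-1 :> R); last by rewrite -invfM; congr (_^-1); ring.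
  rewrite exprMn -exprVn; set r := 2^-1 ^+ j.
  have -> : 2 ^+ j = r^-1 by rewrite /r exprVn invrK.
  have rK : r^-1 * r = 1 by rewrite mulVf// /r expf_neq0// invr_neq0.
  by rewrite mulrCA (mulrA r^-1) rK mul1r mulrDl (mulrC r W).
(* The sum of the absolute increments. It is integrable, its finiteness gives pointwise convergence,
   and it dominates every partial sum along N. *)
pose G z := (\sum_(0 <= j <oo) `|Del j z|%:E)%E.
have G0 z : (0 <= G z)%E by apply: nneseries_ge0 => j _ _; rewrite lee_fin.
have mG : measurable_fun setT G.
  have := @ge0_emeasurable_sum _ _ R setT (fun j z => `|Del j z|%:E) predT.
  by apply => [k z _ _|k _]; [rewrite lee_fin|exact: mDel].
have KW : 0 <= K + W.
  rewrite -lee_fin; apply: le_trans (le_trans _ (dL1 0%N)) _; last by rewrite expr0 mulr1.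
  by apply: integral_ge0 => z _; rewrite lee_fin.
have geo n : \sum_(0 <= j < n) 2^-1 ^+ j <= 2 :> R.
  suff -> : \sum_(0 <= j < n) 2^-1 ^+ j = 2 - 2 * 2^-1 ^+ n :> R.
    by rewrite gerBl mulr_ge0// exprn_ge0.
  elim: n => [|n ih]; first by rewrite big_geq// expr0 mulr1 subrr.
  by rewrite big_nat_recr//= ih exprS mulVKf//; ring.
have iG : (\int[leb2]_(z in bdry) G z < +oo)%E.
  rewrite integral_nneseries; [|exact: mb| |]; last 2 first.
  - by move=> j; apply: measurable_funTS; exact: mDel.
  - by move=> j z _; rewrite lee_fin.
  apply: (@le_lt_trans _ _ ((K + W) * 2)%:E); last exact: ltry.
  apply: lime_le.
    by apply: is_cvg_nneseries => j _ _; apply: integral_ge0 => z _; rewrite lee_fin.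
  apply: nearW => n.
  apply: (@le_trans _ _ (\sum_(0 <= j < n) ((K + W) * 2^-1 ^+ j)%:E)%E).
    by apply: lee_sum => j _; exact: dL1.
  by rewrite sumEFin lee_fin -big_distrr/= ler_wpM2l.
have sumG n z : (`|H 0 (N n) z|%:E <= G z)%E.
  rewrite -sumD; apply: (@le_trans _ _ (\sum_(0 <= j < n) `|Del j z|%:E)%E).
    by rewrite sumEFin lee_fin; exact: ler_norm_sum.
  by apply: nneseries_lim_ge => j _ _; rewrite lee_fin.
have cvgD z : (G z < +oo)%E -> cvgn (fun n => H 0 (N n) z).
  move=> Goo.
  have : cvgn (series (Del ^~ z)).
    apply: normed_cvg; apply: nondecreasing_is_cvgn.
      by move=> m n mn; rewrite /= /series/= [leRHS](big_cat_nat (n := m))//= lerDl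
        sumr_ge0.
    exists (fine (G z)) => _ [n _ <-]; rewrite -lee_fin fineK ?ge0_fin_numE//.
    rewrite /series/= -sumEFin.
    by apply: nneseries_lim_ge => j _ _; rewrite lee_fin.
  rewrite (_ : series (Del ^~ z) = fun n => H 0 (N n) z)//.
  by apply/funext => n; rewrite /series/= sumD.
pose A := [set z | G z < +oo]%E.
have mA : measurable (A : set (measurableTypeR R * measurableTypeR R)).
  have := @emeasurable_fun_infty_o _ _ R setT G measurableT mG +oo%E.
  by rewrite setTI.
(* Cutting the sums off to 0 outside A makes them converge everywhere, so the limit is measurable
   and periodic without exceptional points. *)
pose sg n z := \1_A z * H 0 (N n) z.
have sgE n z : (G z < +oo)%E -> sg n z = H 0 (N n) z.
  by move=> Goo; rewrite /sg indicE mem_set// mul1r.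
pose g z := limn (sg ^~ z).
have sgc z : sg n z @[n --> \oo] --> g z.
  have [Goo|Goo] := boolP (G z < +oo)%E.
    rewrite (_ : sg ^~ z = fun n => H 0 (N n) z); last by apply/funext => n; exact: sgE.
    rewrite /g (_ : sg ^~ z = fun n => H 0 (N n) z); last by apply/funext => n; exact: sgE.
    exact: cvgD.
  have e : sg ^~ z = cst 0.
    by apply/funext => n; rewrite /sg indicE memNset ?mul0r//; exact/negP.
  by rewrite /g e lim_cst//; exact: cvg_cst.
have msg n : measurable_fun setT (sg n).
  by apply: measurable_funM; [exact: measurable_indic|exact: measurable_H].
have mg : measurable_fun setT g.
  by apply: (measurable_fun_cvg (h := sg)) => // z _; exact: sgc.
have perH n b a : H 0 (N n) (b + 2 * pi, a) = H 0 (N n) (b, a) /\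
    H 0 (N n) (b, a + 2 * pi) = H 0 (N n) (b, a) by exact: biperiodic_H.
have perG : biperiodic G.
  move=> b a; rewrite /G; split; apply: congr_lim; apply/funext => n;
    apply: eq_bigr => j _; rewrite /Del.
    by rewrite (biperiodic_H (N j) (N j.+1) b a).1.
  by rewrite (biperiodic_H (N j) (N j.+1) b a).2.
have Aper z z' : G z = G z' -> (z \in A) = (z' \in A).
  by move=> e; apply/idP/idP; rewrite !inE /A /= e.
have perg : biperiodic g.
  move=> b a; rewrite /g; split; congr (limn _); apply/funext => n; rewrite /sg !indicE.
    by rewrite (perH n b a).1 (Aper _ (b, a))// (perG b a).1.
  by rewrite (perH n b a).2 (Aper _ (b, a))// (perG b a).2.
have sg2 n : (\int[leb2]_(z in bdry) (sg n z ^+ 2)%:E <= V%:E)%E.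
  apply: le_trans (bessel2 (N n)); rewrite -integral_H.
  apply: ge0_le_integral; first exact: mb.
  - by move=> z _; rewrite lee_fin sqr_ge0.
  - by apply: measurable_funTS; apply/measurable_EFinP; apply: measurable_funX; exact: msg.
  - by apply: measurable_funTS; apply/measurable_EFinP; apply: measurable_funX;
    exact: measurable_H.
  - move=> z _; rewrite lee_fin /sg indicE exprMn.
    by case: (_ \in _); rewrite ?expr1n ?mul1r// expr0n mul0r sqr_ge0.
(* Square integrability passes to the limit by Fatou's lemma. *)
have gs : torus_L2 g.
  split => //; apply: (@le_lt_trans _ _ V%:E); last exact: ltry.
  have E z : limn_einf (fun n => (sg n z ^+ 2)%:E) = (g z ^+ 2)%:E.
    apply: (cvg_limn_einf_sup _).1; apply: cvg_EFin; first exact: nearW.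
    by rewrite /= expr2; under eq_fun do rewrite /= expr2; exact: cvgM.
  under eq_integral do rewrite -E.
  apply: (le_trans (@fatou _ _ R leb2 bdry mb (fun n z => (sg n z ^+ 2)%:E) _ _)).
  - by move=> n; apply: measurable_funTS; apply/measurable_EFinP; apply: measurable_funX;
    exact: msg.
  - by move=> n z _; rewrite lee_fin sqr_ge0.
  rewrite limn_einf_lim; apply: lime_le; first exact: is_cvg_einfs.
  apply: nearW => n; apply: le_trans (sg2 n).
  by apply: ereal_inf_lbound; exists n => /=.
exists g; split => //.
(* By Tonelli, G is integrable on almost every fiber, which permits dominated convergence of the
   coefficients there. *)
have iGfib : {ae mu, forall b, circle_cell b ->
    (\int[mu]_(a in fiber_cell) G (b, a) < +oo)%E}.
  have mGf : measurable_fun circle_cell (fun b => \int[mu]_(a in fiber_cell) G (b, a))%E.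
    by apply: measurable_funTS; exact: (measurable_fiber_integral mG).
  have Gf0 b : (0 <= \int[mu]_(a in fiber_cell) G (b, a))%E by exact: integral_ge0.
  have iGf : mu.-integrable circle_cell (fun b => \int[mu]_(a in fiber_cell) G (b, a))%E.
    apply/integrableP; split => //.
    under eq_integral do rewrite (gee0_abs (Gf0 _)).
    by rewrite -tonelli12.
  have := integrable_ae mc iGf; apply: ae_sub => b h cb.
  by rewrite -ge0_fin_numE//; exact: h.
apply: ae_sub (ae_and iGfib (ae_fiber vt)) => b [Goo vi] cb q s.
have mGb : measurable_fun fiber_cell (fun a => G (b, a)).
  by apply: measurable_funTS; apply: measurableT_comp => //; exact: measurable_pair1.
have iGb : mu.-integrable fiber_cell (fun a => G (b, a)).
  apply/integrableP; split => //.
  by under eq_integral do rewrite (gee0_abs (G0 _)); exact: Goo.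
have mcosM F : measurable_fun setT F ->
    measurable_fun fiber_cell (fun a => (cos (q%:~R * a + s) * F (b, a))%:E).
  move=> Fm; apply: measurable_funTS; apply/measurable_EFinP; apply: measurable_funM.
    exact: measurable_cosMD.
  exact: (measurable_fiber b Fm).
have := @dominated_convergence _ _ R mu fiber_cell mf
  (fun n a => (cos (q%:~R * a + s) * H 0 (N n) (b, a))%:E)
  (fun a => (cos (q%:~R * a + s) * g (b, a))%:E) (fun a => G (b, a)).
case.
- by move=> n; apply: mcosM; exact: measurable_H.
- exact: mcosM.
- have := integrable_ae mf iGb; apply: ae_sub => a /= h fa.
  have Gf : (G (b, a) < +oo)%E by rewrite -ge0_fin_numE//; exact: h.
  apply: cvg_EFin; first exact: nearW.
  apply: cvgM; first exact: cvg_cst.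
  have := sgc (b, a).
  by under eq_fun do rewrite sgE//.
- exact: iGb.
- apply: aeW => a n _; apply: le_trans (sumG n (b, a)).
  by rewrite /= lee_fin normrM ler_piMl// cos_max.
move=> ig _ hc.
have fcH n : (\int[mu]_(a in fiber_cell) (cos (q%:~R * a + s) * H 0 (N n) (b, a))%:E)%E =
    (if (0 < q)%N && (q.-1 < N n)%N then fiber_cc v b q (s + pi / 2) else 0)%:E.
  have -> : (if (0 < q)%N && (q.-1 < N n)%N then fiber_cc v b q (s + pi / 2) else 0) =
      circle_cc (- (pi / 2)) (trig_sum (x b) (y b) 0 (N n)) q s.
    rewrite circle_cc_trig_sum leq0n /=; case: q {ig hc mcosM} => //= q.
    rewrite /x /y /fiber_cc [in LHS]circle_cc_phase -?fiber_cellE; last exact: vi.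
    by rewrite !(cosDpihalf, sinDpihalf); case: ifP => // _; ring.
  rewrite /circle_cc -fiber_cellE fineK//; apply: integrable_fin_num; first exact: mf.
  by rewrite fiber_cellE; apply: integrable_cosM; exact: integrable_trig_sum.
have hf : fiber_cc g b q s = fine (\int[mu]_(a in fiber_cell) (cos (q%:~R * a + s) * g
  (b, a))%:E)%E.
  by rewrite /fiber_cc /circle_cc -fiber_cellE.
rewrite hf.
set L := (if _ then _ else _);
  suff -> : (\int[mu]_(a in fiber_cell) (cos (q%:~R * a + s) * g (b, a))%:E)%E = L%:E by [].
apply: (cvg_unique (@ereal_hausdorff R) hc).
(* The coefficient of frequency q is stationary from n = q on, because N n >= n. *)
apply: cvg_near_cst; exists q => // n /= qn.
rewrite fcH /L; case: q qn {ig hc mcosM fcH hf L} => //= q qn.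
by rewrite (leq_trans qn (Nj n)).
Qed.

End hilbert_transform.

(** * Real-valued range characterization *)

Section antipodal.
Context {R : realType}.
Implicit Types (f g u v w : R * R -> R) (p q : int) (s t : R) (x : R * R) (n k : nat).

Lemma cos_pi_sub (a : R) : cos (pi - a) = - cos a.
Proof. by rewrite cosB cospi sinpi mul0r addr0 mulN1r. Qed.

Lemma sin_pi_sub (a : R) : sin (pi - a) = sin a.
Proof. by rewrite sinB cospi sinpi mul0r sub0r mulN1r opprK. Qed.

Lemma cosD_oddpi (a : R) (m : int) : odd `|m|%N -> cos (a + m%:~R * pi) = - cos a.
Proof.
move=> om; have [r ->] : exists r : int, m = 2 * r + 1.
  by exists (m %/ 2)%Z; lia.
rewrite intrD intrM mulrDl mul1r addrA cosDpi; congr (- _).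
by rewrite -[RHS](cos_shift_int _ r); congr cos; ring.
Qed.

Lemma cosD_evenpi (a : R) (m : int) : ~~ odd `|m|%N -> cos (a + m%:~R * pi) = cos a.
Proof.
move=> om; have [r ->] : exists r : int, m = 2 * r by exists (m %/ 2)%Z; lia.
by rewrite -[RHS](cos_shift_int _ r) intrM; congr cos; ring.
Qed.

Lemma wave_scattering p q t x :
  wave p q t (scattering x) = wave p (2 * p - q) (t + (p + q)%:~R * pi) x.
Proof.
rewrite /wave /scattering/=; congr cos.
by ring.
Qed.

Lemma wave_half_turn p q t x : wave p q t (half_turn x) = wave p q (t + q%:~R * pi) x.
Proof. by rewrite /wave /half_turn/=; congr cos; ring. Qed.

Lemma waveN p q t x : wave (- p) (- q) (- t) x = wave p q t x.
Proof. by rewrite /wave -[RHS]cosN !mulrNz; congr cos; ring. Qed.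

(** Reduces negative fiber frequencies to positive ones, for which the Hilbert transform is a single
    phase shift. *)
Lemma torus_ccN f p q t : torus_cc f (- p) (- q) (- t) = torus_cc f p q t.
Proof. by rewrite /torus_cc; under [LHS]eq_Rintegral do rewrite waveN. Qed.

Lemma torus_cc_half_turn f p q t : torus_L1 f ->
  torus_cc (f \o half_turn) p q (t + q%:~R * pi) = torus_cc f p q t.
Proof.
move=> ft; rewrite /torus_cc -(bdry_int_half_turn (torus_L1_wave p q t ft)); congr bdry_int.
by apply/funext => x /=; rewrite wave_half_turn.
Qed.

Lemma torus_cc_scattering f p q t : torus_L1 f ->
  torus_cc (f \o scattering) p q t = torus_cc f p (2 * p - q) (t + (p + q)%:~R * pi).
Proof.
move=> ft; have [fp _ _] := ft.
rewrite {1}/torus_cc -(bdry_int_scattering (torus_L1_wave p q t (torus_L1_scattering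
  ft))); congr bdry_int.
by apply/funext => x /=; rewrite wave_scattering scatteringK.
Qed.

Lemma torus_ccD f g p q t : torus_L1 f -> torus_L1 g ->
  torus_cc (fun x => f x + g x) p q t = torus_cc f p q t + torus_cc g p q t.
Proof.
move=> ft gt; rewrite /torus_cc -bdry_intD; try exact: torus_L1_wave.
by congr bdry_int; apply/funext => x; rewrite mulrDr.
Qed.

Lemma torus_ccZ (k : R) f p q t : torus_L1 f ->
  torus_cc (fun x => k * f x) p q t = k * torus_cc f p q t.
Proof.
move=> ft; rewrite /torus_cc -bdry_intZ; last exact: torus_L1_wave.
by congr bdry_int; apply/funext => x; rewrite mulrCA.
Qed.

Lemma torus_cc_pi f p q t : torus_L1 f -> torus_cc f p q (t + pi) = - torus_cc f p q t.
Proof.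
move=> ft; rewrite -mulN1r -torus_ccZ// /torus_cc; congr bdry_int; apply/funext => x.
by rewrite /wave addrA cosDpi mulN1r mulrN mulNr.
Qed.

Lemma torus_cc_oddpi f p q t (m : int) : torus_L1 f -> odd `|m|%N ->
  torus_cc f p q (t + m%:~R * pi) = - torus_cc f p q t.
Proof.
move=> ft om; rewrite -mulN1r -torus_ccZ// /torus_cc; congr bdry_int; apply/funext => x.
by rewrite /wave addrA cosD_oddpi// mulN1r mulrN mulNr.
Qed.

Lemma torus_cc_evenpi f p q t (m : int) : ~~ odd `|m|%N ->
  torus_cc f p q (t + m%:~R * pi) = torus_cc f p q t.
Proof.
move=> om; rewrite /torus_cc; congr bdry_int; apply/funext => x.
by rewrite /wave addrA cosD_evenpi.
Qed.

(** Interpolates between the Fourier modes (n = 0) and the moment kernels, which have p = q = k and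
    an extra factor cos a. *)
Definition sin_wave n p q t x : R := sin x.2 ^+ n * wave p q t x.

Lemma torus_L1_sin_wave n p q t f : torus_L1 f ->
  torus_L1 (fun x => sin_wave n p q t x * f x).
Proof.
apply: (@torus_L1M _ 1).
- move=> b a; rewrite /sin_wave /= !(biperiodic_wave p q t b a).1 !(biperiodic_wave p q t
  b a).2.
  by rewrite mulr_natl sinD2pi.
- apply: measurable_funM; last exact: measurable_wave.
  apply: measurable_funX; apply: (@measurableT_comp _ _ _ _ _ _ (@sin R)) => //.
  by apply: continuous_measurable_fun; exact: continuous_sin.
- move=> x; rewrite /sin_wave normrM normrX -[leRHS]mulr1 ler_pM//.
    by apply: exprn_ile1 => //; exact: sin_max.
  exact: cos_max.
Qed.

Definition sin_cc n f p q t : R := bdry_int (fun x => sin_wave n p q t x * f x).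

Lemma sin_cc0 f p q t : sin_cc 0 f p q t = torus_cc f p q t.
Proof. by rewrite /sin_cc /torus_cc; congr bdry_int; apply/funext => x;
  rewrite /sin_wave expr0 mul1r. Qed.

Lemma bdry_int_lincomb (k : R) f g : torus_L1 f -> torus_L1 g ->
  bdry_int (fun x => 2^-1 * (f x + k * g x)) = 2^-1 * (bdry_int f + k * bdry_int g).
Proof.
move=> ft gt; have kt := torus_L1Z k gt.
by rewrite bdry_intZ ?bdry_intD ?bdry_intZ//; exact: torus_L1D.
Qed.

(** Trades one power of the sine for the two neighbouring frequencies. Read backwards, it is a
    recursion for the coefficient of frequency q + 1. *)
Lemma sin_ccS n f p q t : torus_L1 f ->
  sin_cc n.+1 f p q t =
  2^-1 * (sin_cc n f p (q + 1) (t - pi / 2) + -1 * sin_cc n f p (q - 1) (t - pi / 2)).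
Proof.
move=> ft; rewrite /sin_cc -bdry_int_lincomb; try exact: torus_L1_sin_wave.
have key x : sin x.2 * wave p q t x =
    2^-1 * (wave p (q + 1) (t - pi / 2) x - wave p (q - 1) (t - pi / 2) x).
  rewrite /wave.
  rewrite (_ : p%:~R * x.1 + (q + 1)%:~R * x.2 + (t - pi / 2) =
    (p%:~R * x.1 + q%:~R * x.2 + t) + x.2 - pi / 2); last by ring.
  rewrite (_ : p%:~R * x.1 + (q - 1)%:~R * x.2 + (t - pi / 2) =
    (p%:~R * x.1 + q%:~R * x.2 + t) - x.2 - pi / 2); last by ring.
  by move: (_ + _ + t) => A; rewrite !cosBpihalf sinD sinB; field.
congr bdry_int; apply/funext => x; rewrite /sin_wave exprSr.
transitivity (sin x.2 ^+ n * (sin x.2 * wave p q t x) * f x); first by ring.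
by rewrite key; ring.
Qed.

Definition cos_sin_wave n p q t x : R := cos x.2 * sin_wave n p q t x.

Lemma cos_sin_waveE n p q t x :
  cos_sin_wave n p q t x = 2^-1 * (sin_wave n p (q + 1) t x + 1 * sin_wave n p (q - 1) t x).
Proof.
have key : cos x.2 * wave p q t x = 2^-1 * (wave p (q + 1) t x + wave p (q - 1) t x).
  rewrite /wave.
  rewrite (_ : p%:~R * x.1 + (q + 1)%:~R * x.2 + t =
    (p%:~R * x.1 + q%:~R * x.2 + t) + x.2); last by ring.
  rewrite (_ : p%:~R * x.1 + (q - 1)%:~R * x.2 + t =
    (p%:~R * x.1 + q%:~R * x.2 + t) - x.2); last by ring.
  by move: (_ + _ + t) => A; rewrite cosD cosB; field.
by rewrite /cos_sin_wave /sin_wave mulrCA key; ring.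
Qed.

Lemma torus_L1_cos_sin_wave n p q t f : torus_L1 f ->
  torus_L1 (fun x => cos_sin_wave n p q t x * f x).
Proof.
move=> ft; rewrite (_ : (fun x => _) = fun x =>
  2^-1 * (sin_wave n p (q + 1) t x * f x + 1 * (sin_wave n p (q - 1) t x * f x))).
  by apply: torus_L1Z; apply: torus_L1D; [|apply: torus_L1Z]; exact: torus_L1_sin_wave.
by apply/funext => x; rewrite cos_sin_waveE; ring.
Qed.

Lemma bdry_int_cos_sin_wave n p q t f : torus_L1 f ->
  bdry_int (fun x => cos_sin_wave n p q t x * f x) =
  2^-1 * (sin_cc n f p (q + 1) t + sin_cc n f p (q - 1) t).
Proof.
move=> ft; rewrite -[sin_cc n f p (q - 1) t]mul1r /sin_cc -bdry_int_lincomb;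
  try exact: torus_L1_sin_wave.
by congr bdry_int; apply/funext => x; rewrite cos_sin_waveE; ring.
Qed.

(** Scattering preserves b + a modulo 2 pi and sin a, and changes the sign of cos a. *)
Lemma cos_sin_wave_scattering n k t x :
  cos_sin_wave n k k t (scattering x) = - cos_sin_wave n k k t x.
Proof.
rewrite /cos_sin_wave /sin_wave wave_scattering /= cos_pi_sub sin_pi_sub.
rewrite mulNr; congr (- (_ * (_ * _))).
rewrite /wave (_ : 2 * k%:Z - k%:Z = k%:Z); last by lia.
by rewrite addrA cosD_evenpi//; lia.
Qed.

Definition influx_ind x : R := (0 < cos x.2)%R%:R.
Definition outflux_ind x : R := (cos x.2 < 0)%R%:R.

Lemma influx_ind_scattering x : influx_ind (scattering x) = outflux_ind x.
Proof. by rewrite /influx_ind /outflux_ind /= cos_pi_sub oppr_gt0. Qed.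

Lemma outflux_ind_scattering x : outflux_ind (scattering x) = influx_ind x.
Proof. by rewrite /influx_ind /outflux_ind /= cos_pi_sub oppr_lt0. Qed.

Lemma influx_ind_half_turn x : influx_ind (half_turn x) = outflux_ind x.
Proof. by rewrite /influx_ind /outflux_ind /= cosDpi oppr_gt0. Qed.

Lemma biperiodic_influx_ind : biperiodic influx_ind.
Proof. by move=> b a; rewrite /influx_ind /= cos_periodic. Qed.

Lemma biperiodic_outflux_ind : biperiodic outflux_ind.
Proof. by move=> b a; rewrite /outflux_ind /= cos_periodic. Qed.

Let measurable_cos2 : measurable_fun setT (fun x => cos x.2).
Proof.
apply: (@measurableT_comp _ _ _ _ _ _ (@cos R)) => //.
by apply: continuous_measurable_fun; exact: continuous_cos.
Qed.

Lemma measurable_influx_ind_set :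
  measurable ([set x | 0 < cos x.2] : set (measurableTypeR R * measurableTypeR R)).
Proof.
rewrite (_ : [set x | _] = (fun x => cos x.2) @^-1` `]0, +oo[).
  rewrite -[_ @^-1` _]setTI; apply: measurable_cos2 => //.
by apply/seteqP; split => x /=; rewrite in_itv/= andbT.
Qed.

Lemma measurable_outflux_ind_set :
  measurable ([set x | cos x.2 < 0] : set (measurableTypeR R * measurableTypeR R)).
Proof.
rewrite (_ : [set x | _] = (fun x => cos x.2) @^-1` `]-oo, 0[).
  rewrite -[_ @^-1` _]setTI; apply: measurable_cos2 => //.
by apply/seteqP; split => x /=; rewrite in_itv/=.
Qed.

Lemma indic_bool (P : pred (R * R)) x : \1_[set y | P y] x = (P x)%:R :> R.
Proof.
rewrite indicE; case: (boolP (P x)) => h; first by rewrite mem_set.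
by rewrite memNset//; exact/negP.
Qed.

Lemma measurable_influx_ind : measurable_fun setT influx_ind.
Proof.
rewrite (_ : influx_ind = \1_[set x | 0 < cos x.2]).
  by apply: measurable_indic; exact: measurable_influx_ind_set.
by apply/funext => x; rewrite indic_bool.
Qed.

Lemma measurable_outflux_ind : measurable_fun setT outflux_ind.
Proof.
rewrite (_ : outflux_ind = \1_[set x | cos x.2 < 0]).
  by apply: measurable_indic; exact: measurable_outflux_ind_set.
by apply/funext => x; rewrite indic_bool.
Qed.

Lemma influx_ind_le1 x : `|influx_ind x| <= 1. Proof. by rewrite /influx_ind;
  case: ltP => _; rewrite ?normr0 ?normr1. Qed.
Lemma outflux_ind_le1 x : `|outflux_ind x| <= 1. Proof. by rewrite /outflux_ind;
  case: ltP => _; rewrite ?normr0 ?normr1. Qed.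

Lemma torus_L1_influx_ind f : torus_L1 f -> torus_L1 (fun x => influx_ind x * f x).
Proof. by apply: (@torus_L1M _ 1);
  [exact: biperiodic_influx_ind|exact: measurable_influx_ind|exact: influx_ind_le1]. Qed.

Lemma torus_L1_outflux_ind f : torus_L1 f -> torus_L1 (fun x => outflux_ind x * f x).
Proof. by apply: (@torus_L1M _ 1);
  [exact: biperiodic_outflux_ind|exact: measurable_outflux_ind|exact: outflux_ind_le1]. Qed.

Lemma eq_bdry_int_ae f g : torus_L1 f -> torus_L1 g -> null_bdry (fun x => f x - g x) ->
  bdry_int f = bdry_int g.
Proof.
move=> [_ fm _] [_ gm _] h; rewrite /bdry_int /Rintegral; congr fine.
apply: ae_eq_integral.
- exact: measurable_bdry.
- by apply: measurable_funTS; exact/measurable_EFinP.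
- by apply: measurable_funTS; exact/measurable_EFinP.
- apply: ae_sub h => x + bx => /(_ bx) /eqP; rewrite subr_eq0 => /eqP e.
  by rewrite /= e.
Qed.

End antipodal.

(** * Functions in the range satisfy the moment and symmetry conditions *)

Section range_real.
Context {R : realType}.
Local Notation mu := (@lebesgue_measure R).
Implicit Types (f g u v w : R * R -> R) (p q : int) (s t : R) (x : R * R) (n k : nat).

(** The multiplier - i at q > 0 in phase form: H sends cos (q a) to sin (q a), which shifts s by pi
    / 2. Frequencies q >= 0 determine a real function. *)
Definition hilbert_odd u w := {ae mu, forall b, circle_cell b ->
  forall (q : nat) s, fiber_cc w b q s = if odd q then fiber_cc u b q (s + pi / 2) else 0}.

Lemma hilbert_odd_torus_cc u w : torus_L1 u -> torus_L1 w -> hilbert_odd u w ->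
  (forall p (q : nat) t, odd q -> torus_cc w p q t = torus_cc u p q (t + pi / 2)) /\
  (forall p q t, ~~ odd `|q|%N -> torus_cc w p q t = 0).
Proof.
move=> ut wt h.
have even p (q : nat) t : ~~ odd q -> torus_cc w p q t = 0.
  move=> oq; rewrite (@torus_cc_ae _ 0 0 w u q wt ut _ p t) ?mul0r//.
  by apply: ae_sub h => b hb cb s; rewrite hb// (negbTE oq) mul0r.
split=> [p q t oq|p [q|q] t oq].
- rewrite (@torus_cc_ae _ 1 (pi / 2) w u q wt ut _ p t) ?mul1r//.
  by apply: ae_sub h => b hb cb s; rewrite hb// oq mul1r.
- exact: even.
- by rewrite -torus_ccN NegzE opprK even.
Qed.

(** Expanding sin^n moves the frequency by at most n, in steps that keep the parity of q - n. All
    frequencies met are thus positive and odd, where the transform is a pure phase shift. *)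
Lemma sin_cc_hilbert_odd u w : torus_L1 u -> torus_L1 w -> hilbert_odd u w ->
  forall n p (q : nat) t, (n < q)%N -> odd (q - n) ->
    sin_cc n w p q t = sin_cc n u p q (t + pi / 2).
Proof.
move=> ut wt /(hilbert_odd_torus_cc ut wt)[h _].
elim=> [|n ih] p q t nq oq; first by rewrite !sin_cc0 h//; rewrite subn0 in oq.
case: q nq oq => // q nq oq.
rewrite !sin_ccS// (_ : q.+1%:Z + 1 = q.+2%:Z); last by lia.
rewrite (_ : q.+1%:Z - 1 = q%:Z); last by lia.
rewrite (ih p q.+2) 1?(ih p q); try lia.
by rewrite (addrAC t).
Qed.

Lemma bdry_int_cos_sin_wave_symmetric n k t f : torus_L1 f ->
  (forall x, f (scattering x) = f x) ->
  bdry_int (fun x => cos_sin_wave n k k t x * f x) = 0.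
Proof.
move=> ft fS; have ct := torus_L1_cos_sin_wave n k k t ft.
have := bdry_int_scattering ct.
rewrite (_ : _ \o _ = fun x => -1 * (cos_sin_wave n k k t x * f x)).
  by rewrite bdry_intZ//; move: (bdry_int _) => z; lra.
by apply/funext => x; rewrite /= cos_sin_wave_scattering fS; ring.
Qed.

Lemma cos_sin_wave_split n p q t x :
  cos_sin_wave n p q t x * influx_ind x + cos_sin_wave n p q t x * outflux_ind x =
    cos_sin_wave n p q t x.
Proof.
rewrite /influx_ind /outflux_ind /cos_sin_wave; case: ltgtP => [||<-];
  rewrite ?mulr1 ?mulr0 ?addr0 ?add0r//.
by rewrite mul0r.
Qed.

(** The kernel is anti-invariant, so the term in w o S over the influx boundary is the contribution
    of w over the outflux boundary. *)
Lemma bdry_int_cos_sin_wave_half n k t w : torus_L1 w ->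
  bdry_int (fun x => cos_sin_wave n k k t x * (influx_ind x * (w x - w (scattering x)))) =
  bdry_int (fun x => cos_sin_wave n k k t x * w x).
Proof.
move=> wt.
have t1 := torus_L1_cos_sin_wave n k k t (torus_L1_influx_ind wt).
have t2 := torus_L1_cos_sin_wave n k k t (torus_L1_outflux_ind wt).
rewrite (_ : (fun x => cos_sin_wave n k k t x * w x) = fun x =>
    cos_sin_wave n k k t x * (influx_ind x * w x) + cos_sin_wave n k k t x * (outflux_ind
      x * w x)); last first.
  by apply/funext => x; rewrite -{1}cos_sin_wave_split; ring.
rewrite bdry_intD// -(bdry_int_scattering t2) -bdry_intD//; last exact: torus_L1_scattering.
congr bdry_int; apply/funext => x;
  rewrite /= cos_sin_wave_scattering outflux_ind_scattering; ring.
Qed.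

(** After unfolding to the torus, only the frequencies k - 1 and k + 1 occur; k - n even and
    positive makes both exceed n with odd difference. The moment is therefore a phase-shifted moment
    of u, zero because u is invariant and the kernel is not. *)
Lemma hilbert_odd_moments u w : torus_L1 u -> torus_L1 w -> hilbert_odd u w ->
  (forall x, u (scattering x) = u x) ->
  forall n k t, (n < k)%N -> ~~ odd (k - n) ->
  bdry_int (fun x => cos_sin_wave n k k t x * (influx_ind x * (w x - w (scattering x))))
    = 0.
Proof.
move=> ut wt h uS n k t nk okn.
rewrite bdry_int_cos_sin_wave_half// bdry_int_cos_sin_wave//.
case: k nk okn => // k nk okn.
rewrite (_ : k.+1%:Z + 1 = k.+2%:Z); last by lia.
rewrite (_ : k.+1%:Z - 1 = k%:Z); last by lia.
have h1 := @sin_cc_hilbert_odd u w ut wt h n k.+1 k.+2 t.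
have h2 := @sin_cc_hilbert_odd u w ut wt h n k.+1 k t.
rewrite h1 ?h2; try lia.
have := bdry_int_cos_sin_wave_symmetric n k.+1 (t + pi / 2) ut uS;
  rewrite bdry_int_cos_sin_wave//.
rewrite (_ : k.+1%:Z + 1 = k.+2%:Z); last by lia.
by rewrite (_ : k.+1%:Z - 1 = k%:Z); last by lia.
Qed.

Lemma hilbert_odd_antipodal u w : torus_L1 u -> torus_L1 w -> hilbert_odd u w ->
  null_bdry (fun x => w x + w (half_turn x)).
Proof.
move=> ut wt /(hilbert_odd_torus_cc ut wt)[_ h].
apply: torus_cc_uniqueness; first by apply: torus_L1D => //; exact: torus_L1_half_turn.
move=> p q t; rewrite torus_ccD//; last exact: torus_L1_half_turn.
have -> : torus_cc (fun x => w (half_turn x)) p q t = torus_cc w p q (t - q%:~R * pi).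
  by rewrite -[in RHS]torus_cc_half_turn// subrK.
case: (boolP (odd `|q|%N)) => oq; last by rewrite !h ?addr0.
have {1}-> : t = (t - q%:~R * pi) + q%:~R * pi by rewrite subrK.
by rewrite torus_cc_oddpi// addNr.
Qed.

(* Composition of S with the half turn of the direction, modulo 2 pi. *)
Definition antipodal x : R * R := (x.1 + pi + 2 * x.2, - x.2).

Lemma scattering_half_turn (T : Type) (F : R * R -> T) x : biperiodic F ->
  F (scattering (half_turn x)) = F (antipodal x).
Proof.
move=> Fp; case: x => b a; rewrite /scattering /half_turn /antipodal/= -[RHS](Fp _ _).1.
by congr F; congr pair; ring.
Qed.

Lemma half_turn_scattering (T : Type) (F : R * R -> T) x : biperiodic F ->
  F (half_turn (scattering x)) = F (antipodal x).
Proof.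
move=> Fp; case: x => b a; rewrite /scattering /half_turn /antipodal/= -[RHS](Fp _ _).2.
by congr F; congr pair; ring.
Qed.

Lemma influx_ind_antipodal x : influx_ind (antipodal x) = influx_ind x.
Proof. by rewrite /influx_ind /antipodal/= cosN. Qed.

(** The half turn negates w, and [antipodal] is S composed with it, so it sends w - w o S to - w o S
    + w. *)
Lemma hilbert_odd_symmetry u w D : torus_L1 u -> torus_L1 w -> torus_L1 D ->
  hilbert_odd u w ->
  null_bdry (fun x => D x - influx_ind x * (w x - w (scattering x))) ->
  null_bdry (fun x => influx_ind x * (D (antipodal x) - D x)).
Proof.
move=> ut wt Dt h eD; have [wp _ _] := wt; have [Dp _ _] := Dt.
have wSt := torus_L1_scattering wt.
have et : torus_L1 (fun x => D x - influx_ind x * (w x - w (scattering x))).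
  rewrite (_ : (fun x => _) = fun x => D x + -1 * (influx_ind x * (w x + -1 * w
    (scattering x)))).
    by apply: torus_L1D => //; apply: torus_L1Z; apply: torus_L1_influx_ind;
      apply: torus_L1D => //; exact: torus_L1Z.
  by apply/funext => x; rewrite !mulN1r.
have yt : torus_L1 (fun x => w x + w (half_turn x)) by apply: torus_L1D => //;
  exact: torus_L1_half_turn.
have y0 := hilbert_odd_antipodal ut wt h.
have y1 := null_bdry_scattering yt y0.
(* The equation for D is needed at the antipodal point too; its null set is transported by
   scattering and then by the half turn. *)
have e1 := null_bdry_half_turn (torus_L1_scattering et) (null_bdry_scattering et eD).
have [ep _ _] := et.
apply: ae_sub (ae_and (ae_and y0 y1) (ae_and e1 eD)) => x [[h1 h2] [h3 h4]] bx.
have {}h1 := h1 bx; have {}h2 := h2 bx; have {}h3 := h3 bx; have {}h4 := h4 bx.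
move: h2 h3; rewrite /= -/(half_turn (scattering x)) -/(antipodal x).
rewrite (scattering_half_turn x ep) (half_turn_scattering x wp) influx_ind_antipodal.
have -> : w (scattering (antipodal x)) = w (half_turn x).
  have wSp : biperiodic (w \o scattering) by exact: biperiodic_scattering.
  by rewrite -[LHS](scattering_half_turn x wSp) /= scatteringK.
move=> h2 h3; move: h1 h2 h3 h4; rewrite /influx_ind; case: (0 < _);
  rewrite ?mul0r// !mul1r.
move: (D _) (D _) (w _) (w _) (w _) (w _) => a b c d e f; lra.
Qed.

End range_real.

(** * The conditions imply membership in the range *)

Section range_real_converse.
Context {R : realType}.
Local Notation mu := (@lebesgue_measure R).
Implicit Types (f g u v w : R * R -> R) (p q : int) (s t : R) (x : R * R) (n k : nat).

(** Scattering reflects the fiber frequency about k, exchanging k + j and k - j. The phase (2 k + j)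
    pi reduces to j pi. *)
Lemma sin_cc_antisymmetric n v k (j : int) t : torus_L1 v ->
  (forall x, v (scattering x) = - v x) ->
  sin_cc n v k (k%:Z + j) t = - sin_cc n v k (k%:Z - j) (t + j%:~R * pi).
Proof.
move=> vt vS; rewrite /sin_cc -(bdry_int_scattering (torus_L1_sin_wave n k (k%:Z + j) t
  vt)).
rewrite -mulN1r -bdry_intZ; last exact: torus_L1_sin_wave.
congr bdry_int; apply/funext => x /=; rewrite vS /sin_wave wave_scattering /= sin_pi_sub.
rewrite (_ : 2 * k%:Z - (k%:Z + j) = k%:Z - j); last by lia.
rewrite (_ : wave k (k%:Z - j) _ x = wave k (k%:Z - j) (t + j%:~R * pi) x); first by ring.
rewrite /wave -[RHS](cos_shift_int _ k); congr cos; ring.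
Qed.

(** Induction on the distance j to the centre k. For j = 0 reflection gives z = - z. For j = 1
    reflection makes the coefficients at k + 1 and k - 1 equal, and the moment is their mean. Then
    [sin_ccS] obtains distance j + 2 for n from j + 1 for n + 1 and j for n, all with the same
    parity of n + j. *)
Lemma sin_cc_triangular v k : torus_L1 v -> (forall x, v (scattering x) = - v x) ->
  (forall n t, (n < k)%N -> ~~ odd (k - n) ->
    bdry_int (fun x => cos_sin_wave n k k t x * v x) = 0) ->
  forall j n t, (n + j < k)%N -> odd (k - (n + j)) -> sin_cc n v k (k%:Z + j%:Z) t = 0.
Proof.
move=> vt vS vm j.
have base0 n t : sin_cc n v k (k%:Z + 0%:Z) t = 0.
  have := sin_cc_antisymmetric n k 0 t vt vS; rewrite mul0r !addr0 ?subr0.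
  by move: (sin_cc _ _ _ _ _) => z; lra.
(* The recursion has order two, so two consecutive distances are carried. *)
suff : (forall n t, (n + j < k)%N -> odd (k - (n + j)) ->
  sin_cc n v k (k%:Z + j%:Z) t = 0) /\
  (forall n t, (n + j.+1 < k)%N -> odd (k - (n + j.+1)) ->
    sin_cc n v k (k%:Z + j.+1%:Z) t = 0).
  by case.
elim: j => [|j [ih1 ih2]].
  split=> // n t nk onk.
  have := vm n t; rewrite bdry_int_cos_sin_wave// => /(_ ltac:(lia) ltac:(lia)).
  have := sin_cc_antisymmetric n k 1 t vt vS; rewrite mul1r.
  have e' : sin_cc n v k (k%:Z - 1) (t + pi) = - sin_cc n v k (k%:Z - 1) t.
    rewrite /sin_cc -[RHS]mulN1r -bdry_intZ; last exact: torus_L1_sin_wave.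
    congr bdry_int; apply/funext => x; rewrite /sin_wave /wave addrA cosDpi; ring.
  rewrite e' -[1%:Z]/(1 : int).
  by move: (sin_cc _ _ _ (k%:Z + 1) t) (sin_cc _ _ _ (k%:Z - 1) t) => a b; lra.
split=> // n t nk onk.
have := sin_ccS n k (k%:Z + j.+1%:Z) (t + pi / 2) vt; rewrite addrK.
rewrite (ih2 n.+1); try lia.
rewrite (_ : k%:Z + j.+1%:Z + 1 = k%:Z + j.+2%:Z); last by lia.
rewrite (_ : k%:Z + j.+1%:Z - 1 = k%:Z + j%:Z); last by lia.
rewrite (ih1 n); try lia.
by rewrite mulr0 addr0 => /esym/eqP; rewrite mulf_eq0 invr_eq0 pnatr_eq0 => /eqP.
Qed.

Lemma torus_cc_triangular v k : torus_L1 v -> (forall x, v (scattering x) = - v x) ->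
  (forall n t, (n < k)%N -> ~~ odd (k - n) ->
    bdry_int (fun x => cos_sin_wave n k k t x * v x) = 0) ->
  forall (q : nat) t, odd q -> (q < 2 * k)%N -> torus_cc v k q t = 0.
Proof.
move=> vt vS vm q t oq qk; have tri := sin_cc_triangular vt vS vm.
have [kq|qk'] := leqP k q.
  by rewrite -sin_cc0 (_ : q%:Z = k%:Z + (q - k)%N%:Z) ?tri//; lia.
rewrite -sin_cc0 (_ : q%:Z = k%:Z + - (k - q)%N%:Z); last by lia.
by rewrite sin_cc_antisymmetric// opprK tri ?oppr0//; lia.
Qed.

Lemma torus_cc_scattering_anti v p q t : torus_L1 v ->
  (forall x, v (scattering x) = - v x) ->
  torus_cc v p q t = - torus_cc v p (2 * p - q) (t + (p + q)%:~R * pi).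
Proof.
move=> vt vS; rewrite -(torus_cc_scattering p q t vt) -mulN1r -torus_ccZ;
  last exact: torus_L1_scattering.
by rewrite /torus_cc; congr bdry_int; apply/funext => x; rewrite /= vS mulN1r opprK.
Qed.

Lemma torus_cc_halfpi_opp v p q t : torus_L1 v ->
  torus_cc v p q (t + pi / 2) = - torus_cc v p q (t - pi / 2).
Proof.
move=> vt; rewrite -torus_cc_pi//; congr torus_cc.
by rewrite -addrA; congr (_ + _); field.
Qed.

(* For q odd either q (2 p - q) > 0, where the moments vanish, or the
   frequencies q and 2 p - q exchanged by the scattering relation have opposite
   signs, and the Hilbert transform turns an antisymmetric function into a
   symmetric one. *)
Lemma hilbert_scattering_sym v g : torus_L1 v -> torus_L1 g ->
  (forall x, v (scattering x) = - v x) ->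
  (forall p q t, ~~ odd `|q|%N -> torus_cc v p q t = 0) ->
  (forall (k q : nat) t, odd q -> (q < 2 * k)%N -> torus_cc v k q t = 0) ->
  (forall p (q : nat) t, torus_cc g p q t =
    if q == 0%N then 0 else torus_cc v p q (t + pi / 2)) ->
  null_bdry (fun x => g x - g (scattering x)).
Proof.
move=> vt gt vS veven vmom gv.
have gN p (q : nat) t : torus_cc g p (- q.+1%:Z) t = torus_cc v p (- q.+1%:Z) (t - pi / 2).
  by rewrite -[LHS]torus_ccN -[RHS]torus_ccN opprK gv/= opprB addrC.
have geven p q t : ~~ odd `|q|%N -> torus_cc g p q t = 0.
  case: q => [q|q] oq; last by rewrite NegzE gN veven.
  by rewrite gv; case: eqP => // _; rewrite veven.
have vmom' p q t : odd `|q|%N -> 0 < q -> q < 2 * p -> torus_cc v p q t = 0.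
  case: p => p; case: q => q; try lia.
  by move=> oq q0 qp; apply: vmom; lia.
have gSt := torus_L1_scattering gt.
have main p (q : nat) t : torus_cc g p q t = torus_cc (g \o scattering) p q t.
  rewrite torus_cc_scattering//.
  have [oq|oq] := boolP (odd q); last by rewrite !geven//; lia.
  rewrite gv; case: eqP oq => [->//|_ oq].
  (* In the first case q' = 0 is excluded because q is odd, so 0 < q < 2 p and both sides vanish. In
     the second the shifts by pi / 2 and - pi / 2 differ by a sign, which cancels the one from the
     anti-invariance of v. *)
  case Eq : (2 * p - q%:Z) => [q'|q'].
    rewrite gv; case: eqP => [?|q'0]; first lia.
    have {1}-> : torus_cc v p q (t + pi / 2) = 0 by apply: vmom'; lia.
    by rewrite vmom'//; lia.
  rewrite NegzE gN (torus_cc_scattering_anti p q _ vt vS) Eq NegzE.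
  by rewrite (addrAC t) torus_cc_halfpi_opp// opprK.
have e : (fun x => g x - g (scattering x)) = fun x => g x + -1 * (g \o scattering) x.
  by apply/funext => x; rewrite mulN1r.
rewrite e; apply: torus_cc_uniqueness; first by apply: torus_L1D => //; exact: torus_L1Z.
move=> p q t; rewrite torus_ccD ?torus_ccZ//; last exact: torus_L1Z.
suff -> : torus_cc g p q t = torus_cc (g \o scattering) p q t by rewrite mulN1r subrr.
by case: q => q; [exact: main|rewrite -[LHS]torus_ccN -[RHS]torus_ccN NegzE opprK main].
Qed.

Definition odd_fiber u := {ae mu, forall b, circle_cell b ->
  forall (q : nat) s, ~~ odd q -> fiber_cc u b q s = 0}.

Lemma odd_fiber_torus_cc v : torus_L1 v -> (forall p q t, ~~ odd `|q|%N ->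
  torus_cc v p q t = 0) ->
  odd_fiber v.
Proof.
move=> vt veven.
have h q s : ~~ odd `|q|%N -> {ae mu, forall b, circle_cell b -> fiber_cc v b q s = 0}.
  by move=> oq; apply: torus_cc_eq0_fiber_cc => // p t; apply: veven; rewrite ?abszN.
have H s : {ae mu, forall b, forall q, ~~ odd `|q|%N -> circle_cell b ->
  fiber_cc v b q s = 0}.
  apply: ae_forall_int => q; case: (boolP (odd `|q|%N)) => oq; first exact: aeW.
  by apply: ae_sub (h q s oq).
apply: ae_sub (ae_and (ae_fiber vt) (ae_and (H 0) (H (pi / 2)))) => b [i [h0 h1]] cb q s oq.
rewrite /fiber_cc circle_cc_phase; last by rewrite -fiber_cellE; exact: i.
by rewrite -!/(fiber_cc _ _ _ _) h0// h1// !mulr0 addr0.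
Qed.

(* A_+ g, up to the null set cos alpha = 0. *)
Definition even_ext g x := influx_ind x * g x + outflux_ind x * g (scattering x).

(** On each fiber cosine vanishes only at - pi / 2 and pi / 2. *)
Lemma null_bdry_cos0 f : torus_L1 f ->
  null_bdry (fun x => f x - (influx_ind x + outflux_ind x) * f x).
Proof.
move=> ft; have [_ fm _] := ft.
have h : (fun x => f x - (influx_ind x + outflux_ind x) * f x) =
  fun x => f x + -1 * (influx_ind x * f x + outflux_ind x * f x).
  by apply/funext => x; ring.
rewrite h; apply/null_bdry_fiber.
  by apply: torus_L1D => //; apply: torus_L1Z; apply: torus_L1D;
    [exact: torus_L1_influx_ind|exact: torus_L1_outflux_ind].
apply: aeW => b cb; exists [set - (pi / 2); pi / 2]; split.
- by apply: measurableU; exact: measurable_set1.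
- by apply: countable_lebesgue_measure0; apply/finite_set_countable/finite_set2.
move=> a /=; apply: contra_notP => /not_orP[a1 a2];
  rewrite /fiber_cell/= in_itv/= => /andP[a3 a4].
rewrite /influx_ind /outflux_ind /=.
have [h0|h0] : (0 < cos a) \/ (cos a < 0).
- have := pi_gt0 R => pi0.
  have [a5|a5] := ltP a (pi / 2).
    left; apply: cos_gt0_pihalf; rewrite a5 andbT lt_neqAle a3 andbT.
    by apply/eqP => /esym.
  right; have a6 : pi / 2 < a by rewrite lt_neqAle a5 andbT; apply/eqP => /esym.
  have : 0 < cos (a - pi) by apply: cos_gt0_pihalf; apply/andP; split; lra.
  by rewrite -[X in _ -> cos X < 0](subrK pi) cosDpi; lra.
- by rewrite h0 ltNge (ltW h0)/=; ring.
- by rewrite h0 ltNge (ltW h0)/=; ring.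
Qed.

Lemma even_ext_ae_eq g : torus_L1 g -> null_bdry (fun x => g x - g (scattering x)) ->
  null_bdry (fun x => even_ext g x - g x).
Proof.
move=> gt g0; apply: ae_sub (ae_and g0 (null_bdry_cos0 gt)) => x [h1 h2] bx.
have {}h1 := h1 bx; have {}h2 := h2 bx; rewrite /even_ext.
have -> : g (scattering x) = g x by move: h1; move: (g _) (g _) => y z; lra.
by rewrite -mulrDl -opprB h2 oppr0.
Qed.

Lemma torus_L2_mul g f : biperiodic g -> measurable_fun setT g ->
  (forall x, `|g x| <= 1) -> torus_L2 f -> torus_L2 (fun x => g x * f x).
Proof.
move=> gp gm g1 fs; have [fp fm _] := fs.
apply: (@torus_L2_le _ _ (fun x => f x ^+ 2) 1).
- by move=> b a; rewrite !(fp b a).1 !(fp b a).2 !(gp b a).1 !(gp b a).2.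
- exact: measurable_funM.
- exact: torus_L2_sqr_L1.
- move=> x; rewrite exprMn ler_wpM2r ?sqr_ge0//.
  by rewrite -real_normK ?num_real// exprn_ile1.
Qed.

Lemma torus_L2_even_ext g : torus_L2 g -> torus_L2 (even_ext g).
Proof.
move=> gs; apply: torus_L2D.
- by apply: torus_L2_mul => //;
  [exact: biperiodic_influx_ind|exact: measurable_influx_ind|exact: influx_ind_le1].
- apply: torus_L2_mul; [exact: biperiodic_outflux_ind|exact:
  measurable_outflux_ind|exact: outflux_ind_le1|].
  exact: torus_L2_scattering.
Qed.

Theorem moments_hilbert_range D : torus_L2 D -> (forall x, influx_ind x * D x = D x) ->
  (forall n k t, (n < k)%N -> ~~ odd (k - n) ->
    bdry_int (fun x => cos_sin_wave n k k t x * D x) = 0) ->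
  null_bdry (fun x => influx_ind x * (D (antipodal x) - D x)) ->
  exists g w, [/\ torus_L2 g, torus_L2 w, hilbert_odd (even_ext g) w,
    odd_fiber (even_ext g) &
    forall x, influx_ind x * (w x - w (scattering x)) = D x].
Proof.
move=> Ds Dpos Dmom Dsym; have Dt := torus_L2_L1 Ds; have [Dp _ _] := Ds.
pose v x := D x + -1 * D (scattering x).
have DSs := torus_L2_scattering Ds.
have vs : torus_L2 v by apply: torus_L2D => //; exact: torus_L2Z.
have vt := torus_L2_L1 vs.
have vS x : v (scattering x) = - v x.
  by rewrite /v (scatteringK Dp); ring.
have vpos x : influx_ind x * v x = D x.
  rewrite /v mulrDr Dpos -(Dpos (scattering x)) influx_ind_scattering.
  rewrite (_ : influx_ind x * _ = - ((influx_ind x * outflux_ind x) * D (scattering x)));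
    last by ring.
  by rewrite /influx_ind /outflux_ind; case: ltgtP => _;
    rewrite ?mulr0 ?mul0r ?oppr0 ?addr0.
have vmom k n t : (n < k)%N -> ~~ odd (k - n) ->
  bdry_int (fun x => cos_sin_wave n k k t x * v x) = 0.
  move=> nk ok; have ct := torus_L1_cos_sin_wave n k k t Dt.
  rewrite (_ : (fun x => _) = fun x => cos_sin_wave n k k t x * D x +
    ((fun x => cos_sin_wave n k k t x * D x) \o scattering) x).
    by rewrite bdry_intD// ?bdry_int_scattering// ?Dmom ?addr0//;
      exact: torus_L1_scattering.
  by apply/funext => x /=; rewrite cos_sin_wave_scattering /v; ring.
(* Fan-beam symmetry of D is antisymmetry of v under the half turn: directly at influx points, and
   after scattering at outflux points. *)
have vanti : null_bdry (fun x => v x + v (half_turn x)).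
  pose e x := influx_ind x * (D (antipodal x) - D x).
  have eE : e = fun x => influx_ind x * ((D \o scattering) (half_turn x) + -1 * D x).
    by apply/funext => x; rewrite /e /= (scattering_half_turn x Dp) mulN1r.
  have et : torus_L1 e.
    rewrite eE; apply: torus_L1_influx_ind; apply: torus_L1D; last exact: torus_L1Z.
    by apply: torus_L1_half_turn; exact: torus_L1_scattering.
  apply: ae_sub (ae_and Dsym (null_bdry_scattering et Dsym)) => x [h1 h2] bx.
  have := h1 bx; have := h2 bx; rewrite /= /e influx_ind_scattering.
  have -> : D (antipodal (scattering x)) = D (half_turn x).
    have DSp : biperiodic (D \o scattering) by exact: biperiodic_scattering.
    rewrite -(scattering_half_turn _ Dp) -[LHS]/((D \o scattering) (half_turn (scattering
      x))).
    by rewrite (half_turn_scattering x DSp) -(scattering_half_turn x DSp) /= scatteringK.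
  rewrite /v (scattering_half_turn x Dp).
  have := Dpos x; have := Dpos (half_turn x); have := Dpos (scattering x);
    have := Dpos (antipodal x).
  rewrite influx_ind_scattering influx_ind_antipodal influx_ind_half_turn.
  move: (D x) (D (half_turn x)) (D (scattering x)) (D (antipodal x)) => d1 d2 d3 d4.
  by rewrite /influx_ind /outflux_ind; case: ltgtP => _; rewrite ?mul1r ?mul0r; lra.
have veven p q t : ~~ odd `|q|%N -> torus_cc v p q t = 0.
  move=> oq.
  have z : null_bdry (fun x => v x + (v \o half_turn) x) by exact: vanti.
  have zt : torus_L1 (fun x => v x + (v \o half_turn) x) by apply: torus_L1D => //;
    exact: torus_L1_half_turn.
  have t0 : torus_L1 (fun=> 0 : R).
    by have := torus_L1Z 0 vt; rewrite (_ : (fun x => _) = fun=> 0)//; apply/funext => x;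
      rewrite mul0r.
  have : torus_cc (fun x => v x + (v \o half_turn) x) p q t = 0.
    have c0 : torus_L1 (fun x => wave p q t x * (v x + (v \o half_turn) x))
      by exact: torus_L1_wave.
    rewrite /torus_cc (eq_bdry_int_ae c0 t0).
      by rewrite /bdry_int Rintegral_cst ?mul0r//; exact: measurable_bdry.
    by apply: ae_sub z => x h /h ->; rewrite mulr0 subr0.
  rewrite torus_ccD//; last exact: torus_L1_half_turn.
  have <- : torus_cc (v \o half_turn) p q (t + q%:~R * pi) =
    torus_cc (v \o half_turn) p q t by rewrite torus_cc_evenpi.
  by rewrite torus_cc_half_turn//; move: (torus_cc _ _ _ _) => z'; lra.
have vmoms (k q : nat) t : odd q -> (q < 2 * k)%N -> torus_cc v k q t = 0.
  by move=> oq qk; apply: torus_cc_triangular => // n s nk onk; exact: vmom.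
have [g0 [g0s hg0]] := hilbert_transform_exists vs.
have g0t := torus_L2_L1 g0s.
have g0v p (q : nat) t : torus_cc g0 p q t =
  if q == 0%N then 0 else torus_cc v p q (t + pi / 2).
  case: eqP => q0.
    rewrite (@torus_cc_ae _ 0 0 g0 v q g0t vt _ p t) ?mul0r//.
    by apply: ae_sub hg0 => b hb cb s; rewrite hb// q0 mul0r.
  rewrite (@torus_cc_ae _ 1 (pi / 2) g0 v q g0t vt _ p t) ?mul1r//.
  by apply: ae_sub hg0 => b hb cb s; rewrite hb// (introF eqP q0) mul1r.
have g0S := hilbert_scattering_sym vt g0t vS veven vmoms g0v.
(* Transforming g gives v / 2, because two shifts by pi / 2 change the sign; the factor 1/2
   compensates for v - v o S = 2 v. *)
pose g x := - 2^-1 * g0 x.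
have gs : torus_L2 g by exact: torus_L2Z.
have gt := torus_L2_L1 gs.
have gS : null_bdry (fun x => g x - g (scattering x)).
  by apply: ae_sub g0S => x h /h e; rewrite /g -mulrBr e mulr0.
exists g, (fun x => 2^-1 * v x).
have us := torus_L2_even_ext gs; have ut := torus_L2_L1 us.
have ug := fiber_cc_ae_eq ut gt (even_ext_ae_eq gt gS).
have all := ae_and (ae_and ug hg0) (ae_and (odd_fiber_torus_cc vt veven) (ae_and
  (ae_fiber vt) (ae_fiber g0t))).
split => //.
- exact: torus_L2Z.
- apply: ae_sub all => b [[h1 h2] [h3 [h4 h5]]] cb q s.
  rewrite fiber_ccZ; last exact: h4.
  case: ifPn => oq; last by rewrite h3// mulr0.
  rewrite h1// fiber_ccZ; last exact: h5.
  rewrite h2//; case: eqP oq => [->//|_ oq].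
  have -> : s + pi / 2 + pi / 2 = s + pi by field.
  have -> : fiber_cc v b q (s + pi) = -1 * fiber_cc v b q s.
    rewrite -fiber_ccZ; last exact: h4.
    rewrite /fiber_cc /circle_cc; apply: eq_Rintegral => a _.
    by rewrite addrA cosDpi /fiber; ring.
  by ring.
- apply: ae_sub all => b [[h1 h2] [h3 [h4 h5]]] cb q s oq.
  rewrite h1// fiber_ccZ; last exact: h5.
  by rewrite h2//; case: eqP => _; rewrite ?h3// mulr0.
- by move=> x; rewrite vS -vpos; field.
Qed.

End range_real_converse.

(** * Complex-valued data *)

Section complex_reduction.
Context {R : realType}.
Local Notation leb2 := (@leb2 R).
Local Notation bdry := (@bdry R).
Local Notation influx := (@influx R).
Local Notation re := (@complex.Re R).
Local Notation im := (@complex.Im R).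
Local Open Scope complex_scope.
Implicit Types (f g h w : R * R -> R[i]) (F : R * R -> R) (b a : R) (x : R * R).

Let wrap2 x : R * R := (wrap 0 x.1, wrap (- (pi / 2)) x.2).

Let measurable_wrap2 : measurable_fun setT wrap2.
Proof.
apply/measurable_fun_pairP; split; rewrite /comp/=.
  by apply: (@measurableT_comp _ _ _ _ _ _ (@wrap R 0)) => //; exact: measurable_wrap.
apply: (@measurableT_comp _ _ _ _ _ _ (@wrap R (- (pi / 2)))) => //; exact: measurable_wrap.
Qed.

Let wrap2_bdry x : bdry (wrap2 x).
Proof.
by split => /=; [rewrite circle_cellE|rewrite fiber_cellE]; exact: wrap_cell.
Qed.

Let biperiodic_wrap2 (T : Type) (G : R * R -> T) : biperiodic G ->
  forall x, G (wrap2 x) = G x.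
Proof.
move=> Gp [b a]; rewrite /wrap2/=.
rewrite (@periodic_wrap R T (fun b' => G (b', wrap (- (pi / 2)) a))); last first.
  by move=> b'; exact: (Gp _ _).1.
by rewrite (@periodic_wrap R T (fun a' => G (b, a'))) => // a'; exact: (Gp _ _).2.
Qed.

(** A periodic function is its restriction to the fundamental domain composed with the measurable
    map [wrap2]. *)
Lemma measurable_biperiodic F : biperiodic F -> measurable_fun bdry F ->
  measurable_fun setT F.
Proof.
move=> Fp Fm.
have -> : F = (F \_ bdry) \o wrap2.
  apply/funext => x; rewrite /= patchE mem_set; last exact: wrap2_bdry.
  by rewrite biperiodic_wrap2.
apply: (measurableT_comp _ measurable_wrap2).
by apply/(measurable_restrictT _ _).1 => //; exact: measurable_bdry.
Qed.

Lemma fiber_cell_cos a : fiber_cell a -> influx_fiber a <-> 0 < cos a.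
Proof.
rewrite /fiber_cell /influx_fiber /= !in_itv/= => /andP[a1 a2]; split.
  exact: cos_gt0_pihalf.
move=> ca; apply/andP; split.
  rewrite lt_neqAle a1 andbT; apply/eqP => e.
  by move: ca; rewrite -e cosN cos_pihalf ltxx.
rewrite ltNge; apply/negP => a3.
have ge0 : 0 <= cos (a - pi) by apply: cos_ge0_pihalf; apply/andP; split; lra.
have e : cos a = - cos (a - pi) by rewrite -{1}(subrK pi a) cosDpi.
by move: ca; rewrite e oppr_gt0 ltNge ge0.
Qed.

Lemma influxE : influx = bdry `&` [set x | 0 < cos x.2].
Proof.
apply/seteqP; split => -[b a] /=.
  move=> [cb ia]; have fa : fiber_cell a.
    move: ia; rewrite /influx_fiber /fiber_cell /= !in_itv/= => /andP[a1 a2].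
    by apply/andP; split; have := pi_gt0 R; lra.
  by split; [split|exact/(fiber_cell_cos fa)].
by move=> [[cb fa] ca]; split => //; exact/(fiber_cell_cos fa).
Qed.

Lemma measurable_influx :
  measurable (influx : set (measurableTypeR R * measurableTypeR R)).
Proof.
by rewrite influxE; apply: measurableI;
  [exact: measurable_bdry|exact: measurable_influx_ind_set].
Qed.

(** The indicator discards the values outside the influx boundary, about which F is
    unconstrained. *)
Lemma measurable_influx_ind_mul F : biperiodic F -> measurable_fun influx F ->
  measurable_fun setT (fun x => influx_ind x * F x).
Proof.
move=> Fp Fm.
have -> : (fun x => influx_ind x * F x) = (F \_ influx) \o wrap2.
  apply/funext => x; rewrite /= patchE.
  have cx : cos (wrap2 x).2 = cos x.2.
    by rewrite /wrap2 /=; exact: (periodic_wrap _ (@cos_periodic R)).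
  case: ifPn => [|]; rewrite influxE ?in_setE.
    move=> [_ h]; have {}h : 0 < cos (wrap2 x).2 := h.
    by rewrite cx in h; rewrite /influx_ind h mul1r biperiodic_wrap2.
  rewrite notin_setE => nx; rewrite /influx_ind; case: ltP => h; last by rewrite mul0r.
  by exfalso; apply: nx; split; [exact: wrap2_bdry|rewrite -cx in h].
apply: (measurableT_comp _ measurable_wrap2).
by apply/(measurable_restrictT _ _).1 => //; exact: measurable_influx.
Qed.

Lemma integral_influx (F : R * R -> \bar R) :
  (\int[leb2]_(x in influx) F x = \int[leb2]_(x in bdry) ((influx_ind x)%:E * F x))%E.
Proof.
rewrite influxE integral_mkcondr; apply: eq_integral => x _.
rewrite patchE /influx_ind; case: (boolP (0 < cos x.2)) => h.
  by rewrite mem_set// mul1e.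
by rewrite memNset ?mul0e//; exact/negP.
Qed.

Lemma Rintegral_influx F : (\int[leb2]_(x in influx) F x)%R =
  bdry_int (fun x => influx_ind x * F x).
Proof.
by rewrite /bdry_int /Rintegral integral_influx; congr fine.
Qed.

Lemma influx_indM x : influx_ind x * influx_ind x = influx_ind x :> R.
Proof. by rewrite /influx_ind; case: ltP => _; rewrite ?mulr1 ?mulr0. Qed.

Lemma L2_influx f : L2 influx f ->
  torus_L2 (fun x => influx_ind x * re (f x)) /\
    torus_L2 (fun x => influx_ind x * im (f x)).
Proof.
move=> [fp mr mi fi].
have rp : biperiodic (re \o f) by move=> b a; rewrite /= (fp b a).1 (fp b a).2.
have ip : biperiodic (im \o f) by move=> b a; rewrite /= (fp b a).1 (fp b a).2.
have mr' := measurable_influx_ind_mul rp mr.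
have mi' := measurable_influx_ind_mul ip mi.
have pp : biperiodic (fun x => influx_ind x * re (f x)).
  by move=> b a; rewrite (fp b a).1 (fp b a).2 (biperiodic_influx_ind b a).1
    (biperiodic_influx_ind b a).2.
have qp : biperiodic (fun x => influx_ind x * im (f x)).
  by move=> b a; rewrite (fp b a).1 (fp b a).2 (biperiodic_influx_ind b a).1
    (biperiodic_influx_ind b a).2.
rewrite integral_influx in fi.
have E x : ((influx_ind x)%:E * (re (f x) ^+ 2 + im (f x) ^+ 2)%:E =
  ((influx_ind x * re (f x)) ^+ 2 + (influx_ind x * im (f x)) ^+ 2)%:E)%E.
  by rewrite -EFinM !exprMn (expr2 (influx_ind x)) influx_indM mulrDr.
have {}fi : (\int[leb2]_(x in bdry)
    ((influx_ind x * re (f x)) ^+ 2 + (influx_ind x * im (f x)) ^+ 2)%:E < +oo)%E.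
  by under eq_integral do rewrite -E; exact: fi.
split; split => //; apply: le_lt_trans fi; apply: ge0_le_integral.
all: try exact: measurable_bdry.
all: try by move=> x _; rewrite lee_fin ?addr_ge0 ?sqr_ge0.
all: try by apply: measurable_funTS; apply/measurable_EFinP; exact: measurable_funX.
all: try by apply: measurable_funTS; apply/measurable_EFinP;
  apply: measurable_funD; exact: measurable_funX.
- by move=> x _; rewrite lee_fin lerDl sqr_ge0.
- by move=> x _; rewrite lee_fin lerDr sqr_ge0.
Qed.

Lemma L2_bdry f : L2 bdry f -> torus_L2 (re \o f) /\ torus_L2 (im \o f).
Proof.
move=> [fp mr mi fi].
have rp : biperiodic (re \o f) by move=> b a; rewrite /= (fp b a).1 (fp b a).2.
have ip : biperiodic (im \o f) by move=> b a; rewrite /= (fp b a).1 (fp b a).2.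
have mr' := measurable_biperiodic rp mr.
have mi' := measurable_biperiodic ip mi.
split; split => //; apply: le_lt_trans fi; apply: ge0_le_integral.
all: try exact: measurable_bdry.
all: try by move=> x _; rewrite lee_fin ?addr_ge0 ?sqr_ge0.
all: try by apply: measurable_funTS; apply/measurable_EFinP; exact: measurable_funX.
all: try by apply: measurable_funTS; apply/measurable_EFinP;
  apply: measurable_funD; exact: measurable_funX.
- by move=> x _; rewrite lee_fin lerDl sqr_ge0.
- by move=> x _; rewrite lee_fin lerDr sqr_ge0.
Qed.

Lemma torus_L2_pair (F G : R * R -> R) : torus_L2 F -> torus_L2 G ->
  L2 bdry (fun x => F x +i* G x) /\ L2 influx (fun x => F x +i* G x).
Proof.
move=> Fs Gs; have [Fp Fm Fi] := Fs; have [Gp Gm Gi] := Gs.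
have per : torus_fun (fun x => F x +i* G x).
  by move=> b a; rewrite (Fp b a).1 (Fp b a).2 (Gp b a).1 (Gp b a).2.
have [_ _ i1] := torus_L2_sqr_L1 Fs; have [_ _ i2] := torus_L2_sqr_L1 Gs.
have fin : (\int[leb2]_(x in bdry) (F x ^+ 2 + G x ^+ 2)%:E < +oo)%E.
  apply: integrable_lty; first exact: measurable_bdry.
  by apply: integrableDR i1 i2; exact: measurable_bdry.
split; split => //=; try exact: measurable_funTS.
apply: le_lt_trans fin; apply: ge0_subset_integral.
- exact: measurable_influx.
- exact: measurable_bdry.
- by apply: measurable_funTS; apply/measurable_EFinP; apply: measurable_funD;
  exact: measurable_funX.
- by move=> x _; rewrite lee_fin addr_ge0 ?sqr_ge0.
- by rewrite influxE; exact: subIsetl.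
Qed.

Lemma ae_influx (P : R * R -> Prop) : {ae leb2, forall x, influx x -> P x} <->
  {ae leb2, forall x, bdry x -> 0 < cos x.2 -> P x}.
Proof.
split; apply: ae_sub => x; rewrite influxE.
  by move=> h bx cx; exact: h.
by move=> h [bx cx]; exact: h.
Qed.

End complex_reduction.

Section complex_statements.
Context {R : realType}.
Local Notation mu := (@lebesgue_measure R).
Local Notation influx := (@influx R).
Local Notation re := (@complex.Re R).
Local Notation im := (@complex.Im R).
Local Open Scope complex_scope.
Implicit Types (f g h w : R * R -> R[i]) (F G : R * R -> R) (b a : R) (x : R * R).

Lemma fiber_ccN F b q s : fiber_cc F b (- q) s = fiber_cc F b q (- s).
Proof.
by rewrite /fiber_cc /circle_cc; apply: eq_Rintegral => a _; rewrite -cosN mulrNz;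
  congr (cos _ * _); ring.
Qed.

Lemma fiber_coefE f b (k : int) :
  mu.-integrable fiber_cell (EFin \o fiber (re \o f) b) ->
  mu.-integrable fiber_cell (EFin \o fiber (im \o f) b) ->
  fiber_coef f b k = ((2 * pi)^-1)%:C *
    ((fiber_cc (re \o f) b k 0 - fiber_cc (im \o f) b k (pi / 2)) +i*
     (fiber_cc (im \o f) b k 0 + fiber_cc (re \o f) b k (pi / 2))).
Proof.
move=> i1 i2; rewrite /fiber_coef; congr (_ * _).
have mf := @measurable_fiber_cell R.
have j F s : mu.-integrable fiber_cell (EFin \o fiber F b) ->
    mu.-integrable fiber_cell (EFin \o (fun a => cos (k%:~R * a + s) * F (b, a))).
  by rewrite fiber_cellE => i; exact: integrable_cosM.
rewrite /Cintegral /fiber_cc /circle_cc -fiber_cellE; congr (_ +i* _).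
  rewrite -RintegralB//; try exact: j.
  apply: eq_Rintegral => a _; rewrite /fiber/=.
  rewrite addr0 cosDpihalf /cis cosN sinN; case: (f (b, a)) => y z /=; ring.
rewrite -RintegralD//; try exact: j.
apply: eq_Rintegral => a _; rewrite /fiber/=.
rewrite addr0 cosDpihalf /cis cosN sinN; case: (f (b, a)) => y z /=; ring.
Qed.

Definition moment_cc F n k (t : R) := bdry_int (fun x => cos_sin_wave n k k t x * F x).

Lemma moment_ccE F n k t : torus_L1 F ->
  moment_cc F n k t = cos t * moment_cc F n k 0 + sin t * moment_cc F n k (pi / 2).
Proof.
move=> Ft; rewrite /moment_cc -!bdry_intZ; try exact: torus_L1_cos_sin_wave.
rewrite -bdry_intD; try (by apply: torus_L1Z; exact: torus_L1_cos_sin_wave).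
congr bdry_int; apply/funext => x; rewrite /cos_sin_wave /sin_wave /wave.
by rewrite addr0 [in LHS]cosD cosDpihalf; ring.
Qed.

Lemma momentE f (n k : nat) (s : bool) : L2 influx f ->
  moment f n k s =
  (moment_cc (fun x => influx_ind x * re (f x)) n k 0 +
    (-1) ^+ s * moment_cc (fun x => influx_ind x * im (f x)) n k (pi / 2)) +i*
  (moment_cc (fun x => influx_ind x * im (f x)) n k 0 -
    (-1) ^+ s * moment_cc (fun x => influx_ind x * re (f x)) n k (pi / 2)).
Proof.
move=> /L2_influx[/torus_L2_L1 rt /torus_L2_L1 it].
have c F t : torus_L1 F -> torus_L1 (fun x => cos_sin_wave n k k t x * F x)
  by exact: torus_L1_cos_sin_wave.
have sgn : (-1) ^+ s * (-1) ^+ s = 1 :> R by rewrite -signr_addb addbb.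
have cosS (y : R) : cos ((-1) ^+ s * y) = cos y.
  by case: s {sgn}; rewrite ?expr1 ?expr0 ?mulN1r ?mul1r ?cosN.
have sinS (y : R) : sin ((-1) ^+ s * y) = (-1) ^+ s * sin y.
  by case: s {sgn cosS}; rewrite ?expr1 ?expr0 ?mulN1r ?mul1r ?sinN.
rewrite /moment /Cintegral !Rintegral_influx; congr (_ +i* _).
  rewrite /moment_cc -bdry_intZ; last exact: c.
  rewrite -bdry_intD; [|exact: c|by apply: torus_L1Z; exact: c].
  congr bdry_int; apply/funext => x; rewrite /cos_sin_wave /sin_wave /wave addr0 cosDpihalf.
  rewrite /= /cis -(mulrA ((-1) ^+ s)) cosS sinS -!pmulrn mulrDr; case: (f x) => y z /=;
    ring.
rewrite /moment_cc -mulNr -bdry_intZ; last exact: c.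
rewrite -bdry_intD; [|exact: c|by apply: torus_L1Z; exact: c].
congr bdry_int; apply/funext => x; rewrite /cos_sin_wave /sin_wave /wave addr0 cosDpihalf.
rewrite /= /cis -(mulrA ((-1) ^+ s)) cosS sinS -!pmulrn mulrDr; case: (f x) => y z /=; ring.
Qed.

(** Sums and differences over the two signs of the exponent separate the moments of the real part
    from those of the imaginary part, at phases 0 and pi / 2; these give every phase. *)
Lemma moments_real f : L2 influx f ->
  (forall (n k : nat) (s : bool), (n < k)%N -> ~~ odd (k - n) -> moment f n k s = 0) <->
  (forall (n k : nat) t, (n < k)%N -> ~~ odd (k - n) ->
    moment_cc (fun x => influx_ind x * re (f x)) n k t = 0 /\
    moment_cc (fun x => influx_ind x * im (f x)) n k t = 0).
Proof.
move=> fL; have [/torus_L2_L1 rt /torus_L2_L1 it] := L2_influx fL.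
split=> [h n k t nk ok|h n k s nk ok].
  have := h n k false nk ok; have := h n k true nk ok.
  rewrite !momentE// expr0 expr1 => -[e1 e2] [e3 e4].
  rewrite (moment_ccE n k t rt) (moment_ccE n k t it).
  move: e1 e2 e3 e4.
  move: (moment_cc _ _ _ _) (moment_cc _ _ _ _) (moment_cc _ _ _ _) (moment_cc _ _ _ _).
  move=> y1 y2 y3 y4 e1 e2 e3 e4.
  have -> : y1 = 0 by lra.
  have -> : y2 = 0 by lra.
  have -> : y3 = 0 by lra.
  have -> : y4 = 0 by lra.
  by rewrite !mulr0 addr0.
by rewrite momentE// !(h n k _ nk ok).1 !(h n k _ nk ok).2 !mulr0 subr0 addr0.
Qed.

Lemma symmetry_real f : torus_fun f ->
  fan_beam_symmetry f <->
  null_bdry (fun x => influx_ind x * (influx_ind (antipodal x) * re (f (antipodal x)) -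
    influx_ind x * re (f x))) /\
  null_bdry (fun x => influx_ind x * (influx_ind (antipodal x) * im (f (antipodal x)) -
    influx_ind x * im (f x))).
Proof.
move=> fp; rewrite /fan_beam_symmetry; split.
  move=> /ae_influx h; split; apply: ae_sub h => x h bx;
    rewrite influx_ind_antipodal /influx_ind.
    case: (boolP (0 < cos x.2)) => cx; last by rewrite !mul0r.
    by rewrite !mul1r /antipodal h// subrr.
  case: (boolP (0 < cos x.2)) => cx; last by rewrite !mul0r.
  by rewrite !mul1r /antipodal h// subrr.
move=> [h1 h2]; apply/ae_influx; apply: ae_sub (ae_and h1 h2) => x [{}h1 {}h2] bx cx.
have := h1 bx; have := h2 bx; rewrite influx_ind_antipodal /influx_ind cx !mul1r /antipodal.
move=> /eqP; rewrite subr_eq0 => /eqP e2 /eqP; rewrite subr_eq0 => /eqP e1.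
by move: e1 e2; case: (f _) => y z; case: (f x) => y' z' /= -> ->.
Qed.

End complex_statements.

(** * Complex multipliers as phase shifts of real coefficients *)

Section multipliers.
Context {R : realType}.
Local Notation mu := (@lebesgue_measure R).
Local Notation re := (@complex.Re R).
Local Notation im := (@complex.Im R).
Local Open Scope complex_scope.
Implicit Types (f g h u w : R * R -> R[i]) (F G : R * R -> R) (b a : R) (x : R * R).

Definition fiber_int f b :=
  mu.-integrable fiber_cell (EFin \o fiber (re \o f) b) /\
  mu.-integrable fiber_cell (EFin \o fiber (im \o f) b).

(** The Fourier coefficient multiplied by 2 pi, in terms of real coefficients. *)
Definition fourier_pair f b (k : int) : R[i] :=
  (fiber_cc (re \o f) b k 0 - fiber_cc (im \o f) b k (pi / 2)) +i*
  (fiber_cc (im \o f) b k 0 + fiber_cc (re \o f) b k (pi / 2)).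

Lemma fourier_pairE f b k : fiber_int f b ->
  fiber_coef f b k = ((2 * pi)^-1)%:C * fourier_pair f b k.
Proof. by move=> [i1 i2]; rewrite fiber_coefE. Qed.

Lemma fiber_cc_phase F b q s : mu.-integrable fiber_cell (EFin \o fiber F b) ->
  fiber_cc F b q s = cos s * fiber_cc F b q 0 + sin s * fiber_cc F b q (pi / 2).
Proof. by move=> i; rewrite /fiber_cc circle_cc_phase// -fiber_cellE. Qed.

Lemma fourier_pairN f b k : fiber_int f b ->
  fourier_pair f b (- k) =
  (fiber_cc (re \o f) b k 0 + fiber_cc (im \o f) b k (pi / 2)) +i*
  (fiber_cc (im \o f) b k 0 - fiber_cc (re \o f) b k (pi / 2)).
Proof.
move=> [i1 i2]; rewrite /fourier_pair !fiber_ccN oppr0.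
rewrite (fiber_cc_phase k (- (pi / 2)) i1) (fiber_cc_phase k (- (pi / 2)) i2).
by rewrite cosN sinN cos_pihalf sin_pihalf !mul0r !add0r !mulN1r opprK.
Qed.

Lemma twopi_inv_neq0 : ((2 * pi)^-1)%:C != 0 :> R[i].
Proof. by rewrite fmorph_eq0 invr_eq0 gt_eqF// pi2_gt0. Qed.

Lemma symbol_nat (q : nat) : @hilbert_symbol R q%:Z * @odd_symbol R q%:Z =
  if odd q then 0 +i* -1 else 0.
Proof.
rewrite /hilbert_symbol /odd_symbol /=; case: (boolP (odd q)) => oq; last by rewrite mulr0.
by rewrite mulr1 (_ : sgz q%:Z = 1) ?mulr1; [simpc|lia].
Qed.

Lemma symbol_opp (q : nat) : @hilbert_symbol R (- q%:Z) * @odd_symbol R (- q%:Z) =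
  if odd q then 0 +i* 1 else 0.
Proof.
rewrite /hilbert_symbol /odd_symbol abszN /=; case: (boolP (odd q)) => oq;
  last by rewrite mulr0.
by rewrite mulr1 (_ : sgz (- q%:Z) = -1) ?mulrN1; [simpc|lia].
Qed.

Definition coef_rel u w b := forall k,
  fiber_coef w b k = @hilbert_symbol R k * (@odd_symbol R k * fiber_coef u b k).

Definition real_rel F G b := forall (q : nat) s,
  fiber_cc G b q s = if odd q then fiber_cc F b q (s + pi / 2) else 0.

Lemma coef_fourier_pair u w b k : fiber_int u b -> fiber_int w b ->
  fiber_coef w b k = @hilbert_symbol R k * (@odd_symbol R k * fiber_coef u b k) <->
  fourier_pair w b k = @hilbert_symbol R k * @odd_symbol R k * fourier_pair u b k.
Proof.
move=> ui wi; rewrite !fourier_pairE//.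
rewrite (mulrCA (odd_symbol _)) (mulrCA (hilbert_symbol _)) -(mulrA (hilbert_symbol _)).
by split=> [/(mulfI twopi_inv_neq0)|->].
Qed.

Lemma real_rel_coefs F G b : mu.-integrable fiber_cell (EFin \o fiber F b) ->
  mu.-integrable fiber_cell (EFin \o fiber G b) ->
  real_rel F G b <-> forall q : nat,
    fiber_cc G b q 0 = (if odd q then fiber_cc F b q (pi / 2) else 0) /\
    fiber_cc G b q (pi / 2) = (if odd q then - fiber_cc F b q 0 else 0).
Proof.
move=> Fi Gi; split=> h q.
  have h0 := h q 0; have h1 := h q (pi / 2); rewrite h0 h1 add0r; split => //.
  case: (odd q) => //; rewrite fiber_cc_phase// cosDpihalf sinDpihalf sin_pihalf cos_pihalf.
  by rewrite mul0r addr0 mulN1r.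
move=> s; rewrite fiber_cc_phase// (h q).1 (h q).2.
case: (odd q); last by rewrite !mulr0 addr0.
by rewrite [RHS]fiber_cc_phase// cosDpihalf sinDpihalf; ring.
Qed.

(** The complex equations at q and - q amount to four real ones. As the symbol takes conjugate
    values there, they combine into two equations for real parts and two for imaginary parts. *)
Lemma coef_relP u w b : fiber_int u b -> fiber_int w b ->
  coef_rel u w b <->
  real_rel (re \o u) (re \o w) b /\ real_rel (im \o u) (im \o w) b.
Proof.
move=> ui wi; have [u1 u2] := ui; have [w1 w2] := wi.
have E : coef_rel u w b <-> forall q : nat,
    fourier_pair w b q = (if odd q then 0 +i* -1 else 0) * fourier_pair u b q /\
    fourier_pair w b (- q%:Z) = (if odd q then 0 +i* 1 else 0) * fourier_pair u b (- q%:Z).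
  split=> [h q|h [q|q]].
  - by rewrite -symbol_nat -symbol_opp; split; apply/coef_fourier_pair.
  - by apply/coef_fourier_pair => //; rewrite symbol_nat; exact: (h q).1.
  - by rewrite NegzE; apply/coef_fourier_pair => //; rewrite symbol_opp; exact: (h q.+1).2.
rewrite E !real_rel_coefs//.
split=> [h|[h1 h2] q].
  suff H (q : nat) : (fiber_cc (re \o w) b q 0 =
    (if odd q then fiber_cc (re \o u) b q (pi / 2) else 0) /\
    fiber_cc (re \o w) b q (pi / 2) = (if odd q then - fiber_cc (re \o u) b q 0 else 0)) /\
    (fiber_cc (im \o w) b q 0 = (if odd q then fiber_cc (im \o u) b q (pi / 2) else 0) /\
    fiber_cc (im \o w) b q (pi / 2) = (if odd q then - fiber_cc (im \o u) b q 0 else 0)).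
    by split=> q; have [] := H q.
  have [] := h q; rewrite !fourier_pairN// /fourier_pair.
  move: (fiber_cc _ _ _ _) (fiber_cc _ _ _ _) (fiber_cc _ _ _ _) (fiber_cc _ _ _ _).
  move=> c1 c2 c3 c4; move: (fiber_cc _ _ _ _) (fiber_cc _ _ _ _) (fiber_cc _ _ _ _)
    (fiber_cc _ _ _ _).
  move=> d1 d2 d3 d4; case: (odd q) => -[e1 e2] [e3 e4]; do 2?split; lra.
rewrite !fourier_pairN// /fourier_pair (h1 q).1 (h1 q).2 (h2 q).1 (h2 q).2.
move: (fiber_cc _ _ _ _) (fiber_cc _ _ _ _) (fiber_cc _ _ _ _) (fiber_cc _ _ _ _) => c1
  c2 c3 c4.
by case: (odd q); simpc; split; congr (_ +i* _); ring.
Qed.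

End multipliers.

Section main.
Context {R : realType}.
Local Notation mu := (@lebesgue_measure R).
Local Notation bdry := (@bdry R).
Local Notation influx := (@influx R).
Local Notation re := (@complex.Re R).
Local Notation im := (@complex.Im R).
Local Open Scope complex_scope.
Implicit Types (f g h u w : R * R -> R[i]) (F G : R * R -> R) (b a : R) (x : R * R).

Lemma ae_fiber_int f : L2 bdry f -> {ae mu, forall b, circle_cell b -> fiber_int f b}.
Proof.
move=> /L2_bdry[/torus_L2_L1 rt /torus_L2_L1 it].
by apply: ae_sub (ae_and (ae_fiber rt) (ae_fiber it)) => b [h1 h2] cb; split;
  [exact: h1|exact: h2].
Qed.

(** An equality at every point: both sides are 0 where cosine vanishes. *)
Lemma AplusE (g1 g2 : R * R -> R) :
  Aplus (fun x => g1 x +i* g2 x) = fun x => even_ext g1 x +i* even_ext g2 x.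
Proof.
apply/funext => x; rewrite /Aplus /even_ext /influx_ind /outflux_ind.
by case: ltgtP => _; rewrite ?mul1r ?mul0r ?addr0 ?add0r.
Qed.

Lemma even_ext_influx_ind F : even_ext F = even_ext (fun x => influx_ind x * F x).
Proof.
apply/funext => x; rewrite /even_ext influx_ind_scattering mulrA influx_indM.
by rewrite mulrA /outflux_ind; case: ltP => _; rewrite ?mulr1 ?mulr0.
Qed.

Lemma Aplus_reim h : Aplus h = fun x =>
  even_ext (fun y => influx_ind y * re (h y)) x +i* even_ext (fun y => influx_ind y * im
    (h y)) x.
Proof.
rewrite -!(even_ext_influx_ind (fun y => _ (h y))) -AplusE; congr Aplus.
by apply/funext => x; case: (h x).
Qed.

Lemma L2_Aplus h : L2 influx h -> L2 bdry (Aplus h).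
Proof.
move=> /L2_influx[h1 h2]; rewrite Aplus_reim.
by have [] := torus_L2_pair (torus_L2_even_ext h1) (torus_L2_even_ext h2).
Qed.

Lemma even_ext_scattering F : biperiodic F ->
  forall x, even_ext F (scattering x) = even_ext F x.
Proof.
move=> Fp x; rewrite /even_ext influx_ind_scattering outflux_ind_scattering scatteringK//.
by rewrite addrC.
Qed.

Lemma Hminus_hilbert_odd u w : L2 bdry u -> Hminus u w ->
  [/\ L2 bdry w, hilbert_odd (re \o u) (re \o w) & hilbert_odd (im \o u) (im \o w)].
Proof.
move=> uL [p [_ hp] [wL hw]].
have h : {ae mu, forall b, circle_cell b ->
    real_rel (re \o u) (re \o w) b /\ real_rel (im \o u) (im \o w) b}.
  apply: ae_sub (ae_and (ae_and hp hw) (ae_and (ae_fiber_int uL) (ae_fiber_int wL))).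
  move=> b [[h1 h2] [h3 h4]] cb.
  by apply/(coef_relP (h3 cb) (h4 cb)) => k; rewrite h2// h1.
by split => //; apply: ae_sub h => b h /h [].
Qed.

Lemma hilbert_odd_Hminus u w : L2 bdry u -> L2 bdry w ->
  odd_fiber (re \o u) -> odd_fiber (im \o u) ->
  hilbert_odd (re \o u) (re \o w) -> hilbert_odd (im \o u) (im \o w) -> Hminus u w.
Proof.
move=> uL wL o1 o2 h1 h2.
have odd_u : {ae mu, forall b, circle_cell b ->
    forall k, fiber_coef u b k = odd_symbol k * fiber_coef u b k}.
  apply: ae_sub (ae_and (ae_and o1 o2) (ae_fiber_int uL)) => b [[e1 e2] e3] cb k.
  rewrite /odd_symbol; case: (boolP (odd `|k|%N)) => ok; first by rewrite mul1r.
  rewrite mul0r fourier_pairE; last exact: e3.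
  case: k ok => q oq; first by rewrite /fourier_pair !(e1 cb)// !(e2 cb)// subr0 addr0
    mulr0.
  by rewrite NegzE fourier_pairN ?(e1 cb)// ?(e2 cb)// ?subr0 ?addr0 ?mulr0//; exact: e3.
(* A function with only odd fiber modes is its own odd projection. *)
exists u; first by split.
split=> //.
apply: ae_sub (ae_and (ae_and h1 h2) (ae_and odd_u (ae_and (ae_fiber_int uL)
  (ae_fiber_int wL)))).
move=> b [[e1 e2] [e3 [e4 e5]]] cb k; rewrite [in RHS](e3 cb).
by apply: (coef_relP (e4 cb) (e5 cb)).2; split; [exact: e1|exact: e2].
Qed.

End main.

Theorem theorem3 (R : realType) (D : R * R -> R[i]%C) (hD : L2 influx D) :
  (fan_beam_symmetry D /\
   forall (n k : nat) (s : bool),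
     (n < k)%N -> ~~ odd (k - n) -> moment D n k s = 0%R)
  <-> range_Pminus D.
Proof.
have [Dp _ _ _] := hD; have [D1s D2s] := L2_influx hD.
rewrite (moments_real hD) (symmetry_real Dp).
have Dpos (F : R * R -> R) x : influx_ind x * (influx_ind x * F x) =
  influx_ind x * F x by rewrite mulrA influx_indM.
split=> [[[sym1 sym2] mom]|[h hL [w Hw Dw]]].
  have [g1 [w1 [g1s w1s hil1 odd1 e1]]] := moments_hilbert_range D1s (Dpos _)
    (fun n k t nk ok => (mom n k t nk ok).1) sym1.
  have [g2 [w2 [g2s w2s hil2 odd2 e2]]] := moments_hilbert_range D2s (Dpos _)
    (fun n k t nk ok => (mom n k t nk ok).2) sym2.
  have [_ hL] := torus_L2_pair g1s g2s; have [wL _] := torus_L2_pair w1s w2s.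
  have [uL _] := torus_L2_pair (torus_L2_even_ext g1s) (torus_L2_even_ext g2s).
  eexists; first exact: hL.
  eexists; first by rewrite AplusE; exact: (hilbert_odd_Hminus uL wL odd1 odd2 hil1 hil2).
  apply: aeW => x; rewrite influxE => -[_ cx]; rewrite /Aminus_adj.
  have := e1 x; have := e2 x; rewrite /influx_ind cx !mul1r.
  by case: (D x) => y z /= <- <-.
have [h1s h2s] := L2_influx hL.
have uL := L2_Aplus hL; have [wL hil1 hil2] := Hminus_hilbert_odd uL Hw.
have [w1s w2s] := L2_bdry wL.
rewrite Aplus_reim in hil1 hil2.
have [h1p _ _] := h1s; have [h2p _ _] := h2s.
have u1t := torus_L2_L1 (torus_L2_even_ext h1s);
  have u2t := torus_L2_L1 (torus_L2_even_ext h2s).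
have w1t := torus_L2_L1 w1s; have w2t := torus_L2_L1 w2s.
have D1t := torus_L2_L1 D1s; have D2t := torus_L2_L1 D2s.
have Dw' := (ae_influx _).1 Dw.
have n1 : null_bdry (fun x => influx_ind x * complex.Re (D x) -
    influx_ind x * (complex.Re (w x) - complex.Re (w (scattering x)))).
  apply: ae_sub Dw' => x e bx; rewrite /influx_ind.
  case: (boolP (0 < cos x.2)) => cx; last by rewrite !mul0r subr0.
  rewrite e// /Aminus_adj; case: (w x) => y z; case: (w _) => y' z' /=; ring.
have n2 : null_bdry (fun x => influx_ind x * complex.Im (D x) -
    influx_ind x * (complex.Im (w x) - complex.Im (w (scattering x)))).
  apply: ae_sub Dw' => x e bx; rewrite /influx_ind.
  case: (boolP (0 < cos x.2)) => cx; last by rewrite !mul0r subr0.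
  rewrite e// /Aminus_adj; case: (w x) => y z; case: (w _) => y' z' /=; ring.
split.
  split.
    exact: (hilbert_odd_symmetry u1t w1t D1t hil1 n1).
  exact: (hilbert_odd_symmetry u2t w2t D2t hil2 n2).
move=> n k t nk ok.
(* Stated for real functions so that it serves both the real and the imaginary part. *)
have key (F v u' : R * R -> R) : torus_L1 F -> torus_L1 v -> torus_L1 u' ->
  hilbert_odd u' v ->
    (forall x, u' (scattering x) = u' x) ->
    null_bdry (fun x => F x - influx_ind x * (v x - v (scattering x))) ->
    moment_cc F n k t = 0.
  move=> Ft vt ut' hil uS nF.
  rewrite -(hilbert_odd_moments ut' vt hil uS t nk ok); apply: eq_bdry_int_ae.
  - exact: torus_L1_cos_sin_wave.
  - apply: torus_L1_cos_sin_wave; apply: torus_L1_influx_ind.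
    rewrite (_ : (fun x => _) = fun x => v x + -1 * v (scattering x)).
      by apply: torus_L1D => //; apply: torus_L1Z; exact: torus_L1_scattering.
    by apply/funext => x; rewrite mulN1r.
  - by apply: ae_sub nF => x e bx; rewrite -mulrBr e// mulr0.
split.
  by apply: key D1t w1t u1t hil1 _ n1; exact: even_ext_scattering.
by apply: key D2t w2t u2t hil2 _ n2; exact: even_ext_scattering.
Qed.
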